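(* Let $1<p,q<\infty$ and let $w$ and $\sigma$ be a pair of weights on $\mathbb{R}^n$. Then for all $\bm{f}=\{f_j\}_{j=1}^\infty$ $$\|\overline{M}_q(\sigma\bm{f})\|_{L^p(w)}\lesssim[w,\sigma]_{A_p}^{\frac1p}\left([w]_{A_\infty}^{\left(\frac1q-\frac1p\right)_+}+[\sigma]_{A_\infty}^{\frac1p}\right)\||\bm{f}|_q\|_{L^p(\sigma)} .$$ If moreover $p\ne q$, then $$\|\overline{M}_q(\sigma\bm{f})\|_{L^{p,\infty}(w)}\lesssim[w,\sigma]_{A_p}^{\frac1p}[w]_{A_\infty}^{\left(\frac1q-\frac1p\right)_+}\||\bm{f}|_q\|_{L^p(\sigma)} .$$ Here the implicit constants are independent of $w,\sigma,\bm{f}$ (they depend only on $n,p,q$).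
   Context: A weight is a non-negative locally integrable function on $\mathbb{R}^n$. Cubes have sides parallel to the axes. $Mf(x)=\sup_{Q\ni x}\frac1{|Q|}\int_Q|f|$; for $\bm{f}=\{f_j\}$, $|\bm{f}|_q=\left(\sum_j|f_j|^q\right)^{1/q}$, $\overline{M}_q\bm{f}(x)=\left(\sum_j Mf_j(x)^q\right)^{1/q}$, and $\sigma\bm{f}=\{\sigma f_j\}$. $$[w,\sigma]_{A_p}=\sup_Q\left(\frac1{|Q|}\int_Qw\right)\left(\frac1{|Q|}\int_Q\sigma\right)^{p-1},\qquad [w]_{A_\infty}=\sup_Q\frac1{w(Q)}\int_QM(w\chi_Q).$$ $(\alpha)_+=\max\{\alpha,0\}$. $L^p(w)$ and $L^{p,\infty}(w)$ are the Lebesgue and weak Lebesgue spaces with respect to $w\,dx$. *)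

(* Defs.v *)
From HB Require Import structures.
From mathcomp Require Import all_boot all_order all_algebra.
From mathcomp Require Import all_classical all_reals all_analysis.

Set Implicit Arguments.
Unset Strict Implicit.
Unset Printing Implicit Defensive.
Import Order.TTheory GRing.Theory Num.Theory.
Import numFieldNormedType.Exports.
Local Open Scope classical_set_scope.
Local Open Scope ring_scope.
Local Open Scope ereal_scope.

(** R^n is [n.-tuple R] with its product (= Borel) sigma-algebra. Lebesgue
    measure on R^(n+1) is the image of the product of the Lebesgue measures on
    R and R^n under [(x, t) |-> x :: t]; [lebesgue_setX] below characterizes it
    by its values on products of Borel sets. *)
Section lebesgueS.
Context (R : realType) (n : nat).
Variable m : {sigma_finite_measure set (n.-tuple R) -> \bar R}.

Definition consp (xt : measurableTypeR R * n.-tuple R) : n.+1.-tuple R :=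
  [tuple of xt.1 :: xt.2].

Lemma measurable_consp : measurable_fun setT consp.
Proof. exact: (@measurable_cons _ _ _ R). Qed.

Definition lebesgueS : set (n.+1.-tuple R) -> \bar R :=
  pushforward (@lebesgue_measure R \x m) consp.

Let lebesgueS0 : lebesgueS set0 = 0.
Proof. by rewrite /lebesgueS /pushforward preimage_set0 measure0. Qed.

Let lebesgueS_ge0 A : 0 <= lebesgueS A.
Proof. by rewrite /lebesgueS /pushforward measure_ge0. Qed.

Let lebesgueS_sigma_additive : semi_sigma_additive lebesgueS.
Proof. 
move=> F mF tF mUF; rewrite /lebesgueS /pushforward preimage_bigcup.
apply: measure_semi_sigma_additive.
- by move=> k; rewrite -[X in measurable X]setTI; exact: measurable_consp.
- apply/trivIsetP => /= i j _ _ ij; rewrite -preimage_setI.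
  by move/trivIsetP : tF => /(_ _ _ _ _ ij) ->//; rewrite preimage_set0.
- by rewrite -preimage_bigcup -[X in measurable X]setTI; exact: measurable_consp.
Qed.

HB.instance Definition _ := isMeasure.Build _ _ _
  lebesgueS lebesgueS0 lebesgueS_ge0 lebesgueS_sigma_additive.

Let lebesgueS_sigma_finite : sigma_finite setT lebesgueS.
Proof.
have /sigma_finiteP[F [TF ndF Foo]] := sigma_finiteT (@lebesgue_measure R).
have /sigma_finiteP[G [TG ndG Goo]] := sigma_finiteT m.
pose u (x : n.+1.-tuple R) : measurableTypeR R * n.-tuple R :=
  (thead x, [tuple of behead x]).
have mu : measurable_fun setT u.
  apply/measurable_fun_pair => /=.
    exact: (@measurable_tnth _ R).
  exact: measurable_behead.
have uK : cancel consp u.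
  by case=> x t; congr pair; apply: val_inj.
exists (fun k => u @^-1` (F k `*` G k)).
  apply/seteqP; split => // x _.
  have [i _ Fi] : (\bigcup_i F i) (u x).1 by rewrite -TF.
  have [j _ Gj] : (\bigcup_j G j) (u x).2 by rewrite -TG.
  exists (maxn i j) => //; split.
    by move: Fi; exact/subsetPset/ndF/leq_maxl.
  by move: Gj; exact/subsetPset/ndG/leq_maxr.
move=> k; have [mF Fk] := Foo k; have [mG Gk] := Goo k; split.
  by rewrite -[X in measurable X]setTI; apply: mu => //; exact: measurableX.
rewrite /lebesgueS /pushforward -comp_preimage (_ : u \o consp = id).
  by rewrite preimage_id product_measure1E// lte_mul_pinfty// ge0_fin_numE.
by apply/funext => z /=; rewrite uK.
Qed.

HB.instance Definition _ :=
  Measure_isSigmaFinite.Build _ _ _ lebesgueS lebesgueS_sigma_finite.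

End lebesgueS.

(** The base case is the point mass on the one-point space R^0. *)
Fixpoint lebesgue (R : realType) (n : nat) :
    {sigma_finite_measure set (n.-tuple R) -> \bar R} :=
  match n with
  | 0 => [the {sigma_finite_measure set (0.-tuple R) -> \bar R} of
           \d_ [tuple of [::]]]
  | n'.+1 => [the {sigma_finite_measure set (n'.+1.-tuple R) -> \bar R} of
               lebesgueS (lebesgue R n')]
  end.

Lemma lebesgue_setX (R : realType) (n : nat) (A : 'I_n -> set R) :
  (forall i, measurable (A i)) ->
  lebesgue R n [set x | forall i, A i (tnth x i)] =
  \prod_(i < n) lebesgue_measure (A i).
Proof.
elim: n A => [|n IHn] A mA.
  by rewrite big_ord0 /= diracE mem_set //; case.
rewrite big_ord_recl -IHn => [|i]; last exact: mA.
have mB : measurable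
    [set x : n.-tuple R | forall i, A (lift ord0 i) (tnth x i)].
  rewrite (_ : mkset _ = \bigcap_(i in setT)
    ((fun x => tnth x i) @^-1` A (lift ord0 i))); last first.
    by apply/seteqP; split => x /= h => [i _|i]; apply: h.
  apply: fin_bigcap_measurable => [|i _]; first exact: finite_finset.
  by rewrite -[X in measurable X]setTI; exact: measurable_tnth.
rewrite -(@product_measure1E _ _ _ _ _ (@lebesgue_measure R) (lebesgue R n)) //;
  last exact: mA.
rewrite /= /lebesgueS /pushforward; congr (_ _).
apply/seteqP; split => [[x t] /= h|[x t] /= [h0 h] i].
  split; first exact: (h ord0).
  by move=> i; have := h (lift ord0 i); rewrite tnthS.
by case: (unliftP ord0 i) => [j ->|->//]; rewrite tnthS; exact: h.
Qed.

Section weighted.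
Context (R : realType) (n : nat).
Implicit Types (f w sigma : n.-tuple R -> R) (F : n.-tuple R -> \bar R).
Implicit Types (Q A : set (n.-tuple R)) (p q : R).

Local Notation mu := (lebesgue R n).

(** Measurability for the completed (Lebesgue) sigma-algebra. [\int[mu]], being
    a supremum over Borel simple functions, has the expected value on
    nonnegative functions of this kind, even when they are not Borel. *)
Definition lebesgue_measurable f :=
  exists2 g : n.-tuple R -> R,
    measurable_fun setT g & {ae mu, forall x, f x = g x}.

(** Compactness is taken in ['rV[R]_n], which carries the topology of R^n. *)
Definition locally_integrable_Rn f :=
  lebesgue_measurable f /\
  forall A, compact [set \row_i tnth x i | x in A] ->
    \int[mu]_(x in A) `|f x|%:E < +oo.

Definition weight w := (forall x, (0 <= w x)%R) /\ locally_integrable_Rn w.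

Definition is_cube Q := exists (a : n.-tuple R) (l : R), (0 < l)%R /\
  Q = [set x | forall i, (tnth a i <= tnth x i <= tnth a i + l)%R].

Definition average Q f := (mu Q)^-1 * \int[mu]_(x in Q) `|f x|%:E.

Definition maximal f (x : n.-tuple R) : \bar R :=
  ereal_sup [set average Q f | Q in [set Q | is_cube Q /\ Q x]].

Definition lq_norm q (f : nat -> n.-tuple R -> R) (x : n.-tuple R) : \bar R :=
  (\sum_(0 <= j <oo) `|f j x|%:E `^ q) `^ q^-1.

Definition maximal_lq q (f : nat -> n.-tuple R -> R) (x : n.-tuple R) :
    \bar R :=
  (\sum_(0 <= j <oo) maximal (f j) x `^ q) `^ q^-1.

Definition Lp_norm p w F : \bar R :=
  (\int[mu]_x (`|F x| `^ p * (w x)%:E)) `^ p^-1.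

Definition weak_Lp_norm p w F : \bar R :=
  ereal_sup [set t%:E * (\int[mu]_(x in [set x | t%:E < `|F x|]) (w x)%:E)
                         `^ p^-1 | t in [set t : R | (0 < t)%R]].

Definition Ap_constant p w sigma : \bar R :=
  ereal_sup [set average Q w * average Q sigma `^ (p - 1)
            | Q in [set Q | is_cube Q]].

(** [w \_ Q] is the product of [w] with the indicator of [Q]. When w(Q) = 0 the
    integral of the maximal function vanishes, and [0^-1 * 0 = 0] in [\bar R]. *)
Definition Ainfty_constant w : \bar R :=
  ereal_sup [set (\int[mu]_(x in Q) (w x)%:E)^-1 *
                 \int[mu]_(x in Q) maximal (w \_ Q) x
            | Q in [set Q | is_cube Q]].

End weighted.

(* Main.v *)
Require Import Defs.
From mathcomp Require Import all_boot all_order all_algebra.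
From mathcomp Require Import all_classical all_reals all_analysis.
From mathcomp Require Import measurable_realfun.
From mathcomp Require Import ring lra zify.

(** The inequality is first proved for one finite dyadic grid, with constants
    depending only on [n], [p], [q], and is then transported to R^n.

    On a finite laminar family [D] of sets of cells (the cubes of the grid), only
    the masses of [w], [sigma] and [sigma * f j] on the cells matter. Write [psi]
    for the density of [sigma * |f|_q], and <psi>_P for its average on [P].

    Sparse domination ([sparse_domination]). The vector-valued dyadic maximal
    function is of weak type (1,1) ([vector_weak], by a Calderon-Zygmund
    decomposition and Doob's inequality). Stopping at the maximal cubes where the
    l^q-sum of maximal functions first becomes large therefore produces a sparse
    family [T], each member of which is mostly not covered by the smaller ones,
    such that the q-th power of the maximal function is at most a constant times
    the sum of <psi>_P^q over the members [P] of [T] that contain the point. It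
    remains to bound this scalar operator. Sparseness with respect to Lebesgue
    measure together with the A_infty condition gives a Carleson condition for
    the masses of [w] and [sigma] ([sparse_carleson_ainfty]).

    Strong type. If p <= q, then (sum <psi>_P^q)^(p/q) <= sum <psi>_P^p. The A_p
    condition turns the integral of the right-hand side against [w] into a sum of
    p-th powers of sigma-averages weighted by sigma(P), and the Carleson embedding
    theorem concludes; only the A_infty constant of [sigma] enters
    ([sparse_op_strong_le]). If p > q, let U be the sparse sum. The integral of
    U^(p/q) w is a bilinear sum of averages of [Phi] (where psi = Phi sigma) with
    respect to [sigma], and of g = U^(p/q - 1) with respect to [w]. Stopping
    families for both functions split this sum in two ([corona]). In each part one
    function is frozen at its stopping value, so that only testing inequalities are
    needed. They follow from the A_p condition ([sparse_power_sum]), one costing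
    the A_infty constant of [sigma] and the other that of [w]. The terms with [g]
    reproduce the left-hand side with a small factor and are absorbed
    ([sparse_op_strong_gt]).

    Weak type. On the members with <psi>_P about 2^k the sum of the w(P) is at most
    a multiple of 2^(-kp) [w,sigma]_(A_p) times the energy of [Phi], with no
    A_infty constant ([sparse_level_weak]). At height [t], the cubes with
    <psi>_P > t are handled directly; the smaller ones form a geometric series when
    p < q. When p > q they are cut once more, at tau = t W^(-1/q) with [W] the A_infty constant of [w],
    below which a high moment of the sum is used instead of the first one
    ([sparse_op_weak_lt], [sparse_op_weak_gt]).

    Transport. A cube of side [l] lies in a cube of side at most [6 l] of one of
    2^n shifted grids ([one_third]). Hence at each point the maximal function is
    eventually dominated by a sum of 2^n step functions coming from grids that
    exhaust R^n ([maximal_lq_dyadic]). Fatou's lemma for these measurable step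
    functions gives the result for Borel weights ([borel_strong], [borel_weak]); the
    maximal function itself enters only through the monotonicity of its integral,
    which is a lower integral ([ge0_integral_mono]). Changing the data
    on a null set reduces the theorem to Borel weights, and the products 0 * oo on
    its right-hand side are dealt with by showing that the left-hand side vanishes
    when the A_p constant or the norm of [f] does. *)

Set Implicit Arguments.
Unset Strict Implicit.
Unset Printing Implicit Defensive.
Import Order.TTheory GRing.Theory Num.Theory.
Import numFieldNormedType.Exports.
Local Open Scope ring_scope.

(** * Dyadic levels, real powers and finite sums *)

Section Dyadic_levels.
Context {R : realType}.
Implicit Types (u v b : R) (k : int).

(** The integer [k] with 2^k <= u < 2^(k+1). *)
Definition lev u : int := Num.floor (ln u / ln 2).

Lemma pow2D u v : 2 `^ (u + v) = 2 `^ u * 2 `^ v.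
Proof. by rewrite powRD // pnatr_eq0 implybT. Qed.

Lemma pow2_gt0 u : 0 < 2 `^ u.
Proof. by rewrite powR_gt0. Qed.

Lemma pow2_le u v : u <= v -> 2 `^ u <= 2 `^ v.
Proof. by move=> uv; rewrite ler_powR // ler1n. Qed.

Lemma pow2_lt u v : u < v -> 2 `^ u < 2 `^ v.
Proof.
by move=> uv; rewrite /powR pnatr_eq0 /= ltr_expR ltr_pM2r // ln_gt0 // ltr1n.
Qed.

Lemma lev_le u : 0 < u -> 2 `^ (lev u)%:~R <= u.
Proof.
move=> u0.
have l2 : 0 < ln 2 :> R by apply: ln_gt0; lra.
rewrite -{2}(lnK u0) /powR ifF; last by apply/negbTE; rewrite pnatr_eq0.
by rewrite ler_expR -ler_pdivlMr// floor_le_tmp.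
Qed.

Lemma lev_gt u : 0 < u -> u < 2 * 2 `^ (lev u)%:~R.
Proof.
move=> u0.
have l2 : 0 < ln 2 :> R by apply: ln_gt0; lra.
rewrite -[X in X * _]powRr1 // -pow2D -{1}(lnK u0) /powR ifF; last first.
  by apply/negbTE; rewrite pnatr_eq0.
rewrite ltr_expR -ltr_pdivrMr// addrC.
have := floorD1_gt (ln u / ln 2); by rewrite intrD.
Qed.

Lemma le_lev u k : 0 < u -> 2 `^ k%:~R <= u -> k <= lev u.
Proof.
move=> u0 ku; rewrite -ltzD1 -(ltr_int R) ltNge; apply/negP => h.
have := pow2_le h; rewrite intrD addrC pow2D powRr1 // => h'.
by have := lt_le_trans (lev_gt u0) (le_trans h' ku); rewrite ltxx.
Qed.

Lemma lev_mono u v : 0 < u -> u <= v -> lev u <= lev v.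
Proof.
move=> u0 uv; apply: le_lev; first exact: lt_le_trans uv.
exact: le_trans (lev_le u0) uv.
Qed.

(** The sum of the geometric series with ratio 2^(-b). *)
Definition geoC b : R := (1 - 2 `^ (- b))^-1.

Lemma geoC_gt0 b : 0 < b -> 0 < geoC b.
Proof.
move=> b0; rewrite invr_gt0 subr_gt0 -[ltRHS](powRr0 2); apply: pow2_lt; lra.
Qed.

Lemma geoC_eq b : 0 < b -> 1 + geoC b * 2 `^ (- b) = geoC b.
Proof.
move=> b0; have := geoC_gt0 b0; rewrite /geoC invr_gt0 => h.
by field; apply: lt0r_neq0.
Qed.

(** Induction on the set of exponents, removing the largest: [geoC_eq] is the step. *)
Lemma geo_sum b (s : seq int) k0 : 0 < b -> uniq s ->
  (forall k, k \in s -> k <= k0) ->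
  \sum_(k <- s) 2 `^ (b * k%:~R) <= geoC b * 2 `^ (b * k0%:~R).
Proof.
move=> b0; move: {2}(size s) (eqxx (size s)) => n.
elim: n s k0 => [|n IHn] s k0.
  rewrite size_eq0 => /eqP -> _ _; rewrite big_nil.
  by rewrite mulr_ge0 ?powR_ge0 // ltW // geoC_gt0.
move=> /eqP ss us sk.
have [j js jmax] : exists2 j, j \in s & forall k, k \in s -> k <= j.
  have : (0 < size s)%N by rewrite ss.
  rewrite -has_predT => /hasP[x xs _].
  elim: s x xs {ss us sk IHn} => // y s IH x _.
  have [->|/eqP s0] := eqVneq s [::].
    by exists y; rewrite ?mem_head // => k; rewrite inE => /eqP ->.
  have [z zs] : exists z, z \in s by case: s s0 {IH} => // a s _; exists a; exact: mem_head.
  have [j js jm] := IH z zs.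
  have [jy|yj] := leP j y.
    exists y; rewrite ?mem_head // => k; rewrite inE => /orP[/eqP -> //|/jm].
    by move/le_trans; apply.
  exists j; first by rewrite inE js orbT.
  by move=> k; rewrite inE => /orP[/eqP ->|/jm //]; exact: ltW.
rewrite (perm_big _ (perm_to_rem js)) /= big_cons.
have IH : \sum_(k <- rem j s) 2 `^ (b * k%:~R) <= geoC b * 2 `^ (b * (j - 1)%:~R).
  apply: IHn; first by rewrite size_rem // ss.
    exact: rem_uniq.
  move=> k; rewrite mem_rem_uniq // inE => /andP[/= kj ks].
  by have := jmax _ ks; lia.
apply: le_trans (lerD (lexx _) IH) _.
have -> : b * (j - 1)%:~R = - b + b * j%:~R by rewrite intrB; ring.
rewrite pow2D mulrA -[X in X + _]mul1r -mulrDl geoC_eq //.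
rewrite ler_pM2l ?geoC_gt0 //; apply: pow2_le; rewrite ler_pM2l // ler_int.
exact: sk.
Qed.

Lemma geo_sum_neg b (s : seq int) k0 : 0 < b -> uniq s ->
  (forall k, k \in s -> k0 <= k) ->
  \sum_(k <- s) 2 `^ (- b * k%:~R) <= geoC b * 2 `^ (- b * k0%:~R).
Proof.
move=> b0 us sk.
have := @geo_sum b (map -%R s) (- k0) b0; rewrite map_inj_uniq; last exact: oppr_inj.
rewrite big_map => /(_ us); rewrite intrN mulrN -mulNr.
under eq_bigr do rewrite intrN mulrN -mulNr.
by apply => k /mapP[j js ->]; rewrite lerN2; exact: sk.
Qed.
End Dyadic_levels.

Section Real_powers.
Context {R : realType}.
Implicit Types (a b c p q x y : R).

Lemma powR_le x y a : 0 <= a -> 0 <= x -> x <= y -> x `^ a <= y `^ a.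
Proof.
move=> a0 x0 xy; apply: ge0_ler_powR => //; rewrite nnegrE //.
exact: le_trans xy.
Qed.

Lemma powRK x a : 0 <= x -> a != 0 -> (x `^ a) `^ a^-1 = x.
Proof. by move=> x0 a0; rewrite -powRrM mulfV // powRr1. Qed.

Lemma powRVK x a : 0 <= x -> a != 0 -> (x `^ a^-1) `^ a = x.
Proof. by move=> x0 a0; rewrite -powRrM mulVf // powRr1. Qed.

(** The free constant [c] is what later makes a term small enough to be absorbed. *)
Lemma young_eta p q c : 1 < p -> 1 < q -> p^-1 + q^-1 = 1 -> 0 < c ->
  forall a b, 0 <= a -> 0 <= b ->
  a * b <= c `^ (- (q - 1)) * b `^ q + c * a `^ p.
Proof.
move=> p1 q1 pq c0 a b a0 b0.
have p0 : 0 < p by lra.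
have q0 : 0 < q by lra.
have qp : q - 1 = q * p^-1 by rewrite (_ : p^-1 = 1 - q^-1); [field; lra|lra].
have c1 : 0 < c `^ p^-1 by apply: powR_gt0.
have c1n : c `^ p^-1 != 0 by lra.
have -> : a * b = (c `^ p^-1 * a) * ((c `^ p^-1)^-1 * b) by field.
have := conjugate_powR (mulr_ge0 (ltW c1) a0)
  (mulr_ge0 (ltW (_ : 0 < (c `^ p^-1)^-1)) b0) p0 q0 pq.
rewrite invr_gt0 => /(_ c1) /le_trans; apply; rewrite addrC lerD //.
  rewrite powRM ?invr_ge0 ?powR_ge0 // -powRN -powRrM.
  rewrite (_ : - p^-1 * q = - (q - 1)); last by rewrite qp; ring.
  by rewrite ler_piMr ?mulr_ge0 ?powR_ge0 // invf_le1 // ltW.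
rewrite powRM ?powR_ge0 // (powRVK (ltW c0)) ?gt_eqF //.
by rewrite ler_piMr ?mulr_ge0 ?powR_ge0 ?invf_le1 // ltW.
Qed.

(** Concavity: with [a <= 1], each summand [z] satisfies z (x+y)^(a-1) <= z^a. *)
Lemma powR_sum_le (I : Type) (s : seq I) (P : pred I) (F : I -> R) a :
  0 < a -> a <= 1 -> (forall i, 0 <= F i) ->
  (\sum_(i <- s | P i) F i) `^ a <= \sum_(i <- s | P i) F i `^ a.
Proof.
move=> a0 a1 F0.
have add x y : 0 <= x -> 0 <= y -> (x + y) `^ a <= x `^ a + y `^ a.
  move=> x0 y0; have [->|x_neq0] := eqVneq x 0.
    by rewrite add0r lerDr powR_ge0.
  have xy0 : 0 < x + y by rewrite ltr_pwDl // lt0r x_neq0.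
  have e z : 0 <= z -> z <= x + y -> z * (x + y) `^ (a - 1) <= z `^ a.
    move=> z0 zxy; have [->|z_neq0] := eqVneq z 0; first by rewrite mul0r powR_ge0.
    have zp : 0 < z by rewrite lt0r z_neq0.
    rewrite -[leRHS]mulr_powRB1 // ler_pM2l //.
    rewrite -[a - 1]opprB powRN [leRHS]powRN lef_pV2 ?posrE ?powR_gt0 //.
    by apply: powR_le => //; lra.
  rewrite -(mulr_powRB1 (ltW xy0)) // mulrDl lerD //; apply: e => //; lra.
elim: s => [|i s IH]; first by rewrite !big_nil powR0 // gt_eqF.
rewrite !big_cons; case: ifP => // _.
apply: le_trans (add _ _ _ _) _ => //; first exact: sumr_ge0.
by rewrite lerD2l.
Qed.

(** The discrete form of (x^(m+1))' = (m+1) x^m. *)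
Lemma le_bern_nat (m : nat) x : 1 <= x -> 
  x ^+ m.+1 - (x - 1) ^+ m.+1 <= m.+1%:R * x ^+ m.
Proof.
move=> x1; rewrite subrXX opprB addrCA subrr addr0 mul1r.
apply: (@le_trans _ _ (\sum_(i < m.+1) x ^+ m)).
  apply: ler_sum => i _; rewrite -[in leRHS](@subnK i m) ?exprD; last by rewrite -ltnS.
  rewrite /= ler_wpM2l ?exprn_ge0 //; first lra.
  by apply: lerXn2r; rewrite ?nnegrE; lra.
by rewrite sumr_const card_ord mulr_natl.
Qed.

Lemma lev_powR_le (u s : R) : 0 <= s -> 0 < u -> 2 `^ (s * (lev u)%:~R) <= u `^ s.
Proof.
by move=> s0 u0; rewrite mulrC powRrM; apply: powR_le; rewrite ?powR_ge0 ?lev_le.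
Qed.

Lemma lev_powR_ge (u s : R) : 0 <= s -> 0 < u ->
  u `^ s <= 2 `^ s * 2 `^ (s * (lev u)%:~R).
Proof.
move=> s0 u0; rewrite [s * _]mulrC powRrM -powRM ?powR_ge0 //.
by apply: powR_le => //; [exact: ltW | exact/ltW/lev_gt].
Qed.

End Real_powers.

Local Open Scope set_scope.

Section Finite_sums.
Context {R : realType}.

Definition levels (I : finType) (kap : I -> int) : seq int :=
  undup [seq kap i | i <- enum I].

Lemma levels_uniq (I : finType) (kap : I -> int) : uniq (levels kap).
Proof. exact: undup_uniq. Qed.

Lemma mem_levels (I : finType) (kap : I -> int) i : kap i \in levels kap.
Proof. by rewrite mem_undup; apply/mapP; exists i; rewrite ?mem_enum. Qed.

Lemma le_sum_seq (I : eqType) (r : seq I) (P : pred I) (F : I -> R) i :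
  (forall j, 0 <= F j) -> i \in r -> P i -> F i <= \sum_(j <- r | P j) F j.
Proof.
move=> F0 ir Pi; rewrite (perm_big _ (perm_to_rem ir)) /= big_cons Pi.
by rewrite lerDl sumr_ge0.
Qed.

Lemma sum_levels (I : finType) (kap : I -> int) (P : pred I) (F : I -> R) :
  \sum_(i | P i) F i = \sum_(k <- levels kap) \sum_(i | P i && (kap i == k)) F i.
Proof.
under [RHS]eq_bigr => k _ do rewrite big_mkcondr /=.
rewrite exchange_big /=; apply: eq_bigr => i _.
rewrite (perm_big _ (perm_to_rem (mem_levels kap i))) /= big_cons eqxx.
rewrite big_seq_cond big1 ?addr0 // => k /andP[].
by rewrite mem_rem_uniq ?levels_uniq // inE eq_sym => /andP[/negbTE ->].
Qed.

Lemma ler_sum_sub (I : finType) (P Q : pred I) (F : I -> R) :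
  (forall i, P i -> Q i) -> (forall i, Q i -> 0 <= F i) ->
  \sum_(i | P i) F i <= \sum_(i | Q i) F i.
Proof.
move=> PQ F0; rewrite big_mkcond [leRHS]big_mkcond; apply: ler_sum => i _.
by case: ifP => [/PQ -> //|_]; case: ifP => // /F0.
Qed.

End Finite_sums.

(** * Laminar families and Doob's inequality *)

Section Laminar.
Context {R : realType} {X : finType}.
Implicit Types (nu u f : X -> R) (A P Q : {set X}) (S T D : {set {set X}}).

Definition mass nu A : R := \sum_(x in A) nu x.

Definition dens nu u A : R := mass u A / mass nu A.

Definition laminar D := forall P Q, P \in D -> Q \in D ->
  [|| P \subset Q, Q \subset P | [disjoint P & Q]].

Lemma laminar_sub D S : S \subset D -> laminar D -> laminar S.
Proof. by move=> /fintype.subsetP SD lD P Q /SD PD /SD; exact: lD. Qed.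

Lemma laminar_meet D P Q x : laminar D -> P \in D -> Q \in D ->
  x \in P -> x \in Q -> P \subset Q \/ Q \subset P.
Proof.
move=> lD PD QD xP xQ; have /or3P[|| /fintype.disjointFr /(_ xP)] := lD _ _ PD QD.
- by left.
- by right.
- by rewrite xQ.
Qed.

Lemma mass_ge0 nu A : (forall x, 0 <= nu x) -> 0 <= mass nu A.
Proof. by move=> nu0; apply: sumr_ge0. Qed.

Lemma mass_le nu A P : (forall x, 0 <= nu x) -> A \subset P -> mass nu A <= mass nu P.
Proof.
move=> nu0 AP; rewrite /mass [leRHS](big_setID A) /= (finset.setIidPr AP).
by rewrite lerDl sumr_ge0.
Qed.

Lemma dens_ge0 nu u A : (forall x, 0 <= nu x) -> (forall x, 0 <= u x) ->
  0 <= dens nu u A.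
Proof. by move=> n0 u0; rewrite divr_ge0 ?mass_ge0. Qed.

Lemma densK nu u A : 0 < mass nu A -> dens nu u A * mass nu A = mass u A.
Proof. by move=> h; rewrite divfK // gt_eqF. Qed.

Lemma densE nu u A : (forall x, 0 < nu x) -> dens nu u A * mass nu A = mass u A.
Proof.
move=> nu0; have [->|[x xA]] := finset.set_0Vmem A.
  by rewrite /mass !big_set0 mulr0.
apply: densK; rewrite /mass (bigD1 x) //= ltr_pwDl //.
by rewrite sumr_ge0 // => i _; exact: ltW.
Qed.

(** The maximal members of [S]; they are disjoint when [S] is laminar. *)
Definition tops S :=
  [set Q in S | [forall P in S, (Q \subset P) ==> (P == Q)]].

Lemma tops_sub S : tops S \subset S.
Proof. by apply/fintype.subsetP => Q; rewrite inE => /andP[]. Qed.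

Lemma tops_above S Q : Q \in S -> exists2 P, P \in tops S & Q \subset P.
Proof.
move=> QS.
case: (@arg_maxnP _ Q (fun P => (P \in S) && (Q \subset P)) (fun P => #|P|)).
  by rewrite QS /=.
move=> P /andP[PS QP] Pmax; exists P => //; rewrite inE PS /=.
apply/forall_inP => P' P'S; apply/implyP => PP'; rewrite eq_sym eqEcard PP' /=.
by apply: Pmax; rewrite P'S (fintype.subset_trans QP).
Qed.

Lemma tops_trivIset S : laminar S -> finset.trivIset (tops S).
Proof.
move=> lS; apply/finset.trivIsetP => P Q; rewrite !inE => /andP[PS /forall_inP Pm].
move=> /andP[QS /forall_inP Qm] PQ; have /or3P[h|h|//] := lS _ _ PS QS.
  by move: (Pm _ QS); rewrite h eq_sym (negbTE PQ).
by move: (Qm _ PS); rewrite h (negbTE PQ).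
Qed.

Lemma cover_tops S : finset.cover (tops S) = finset.cover S.
Proof.
apply/finset.setP => x; apply/bigcupP/bigcupP => -[Q QS xQ].
  by exists Q => //; move/fintype.subsetP : (tops_sub S); apply.
have [P PS QP] := tops_above QS; exists P => //.
by move/fintype.subsetP : QP; apply.
Qed.

Lemma mass_cover nu S : laminar S ->
  mass nu (finset.cover S) = \sum_(Q in tops S) mass nu Q.
Proof.
by move=> lS; rewrite -cover_tops /mass finset.big_trivIset //; exact: tops_trivIset.
Qed.

Definition dyadic_max T nu u x : R := \big[Num.max/0]_(Q in T | x \in Q) dens nu u Q.

Lemma dyadic_max_ge0 T nu u x : 0 <= dyadic_max T nu u x.
Proof. by rewrite bigmax_ge_id. Qed.

Lemma dyadic_max_ge T nu u x Q : Q \in T -> x \in Q -> dens nu u Q <= dyadic_max T nu u x.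
Proof. by move=> QT xQ; apply: (le_bigmax_cond 0); rewrite QT. Qed.

Lemma dyadic_max_gt0P T nu u x c : 0 < c -> c <= dyadic_max T nu u x ->
  exists2 Q, (Q \in T) && (x \in Q) & c <= dens nu u Q.
Proof.
move=> c0 /bigmax_geP[|[Q h cQ]]; last by exists Q.
by rewrite leNgt c0.
Qed.

Lemma dyadic_max_le T nu u x c : 0 <= c ->
  (forall Q, Q \in T -> x \in Q -> dens nu u Q <= c) -> dyadic_max T nu u x <= c.
Proof.
by move=> c0 h; apply/bigmax_leP; split=> // Q /andP[QT xQ]; exact: h.
Qed.

(** On the maximal sets of density at least [c], the bound is the definition of
    the density; these sets are disjoint and cover the level set. *)
Lemma dyadic_max_weak T nu u c : laminar T -> (forall x, 0 <= nu x) ->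
  (forall x, 0 <= u x) -> 0 < c ->
  c * mass nu [set x | c <= dyadic_max T nu u x] <= mass u [set x | c <= dyadic_max T nu u x].
Proof.
move=> lT nu0 u0 c0.
pose S := [set Q in T | c <= dens nu u Q].
have ST : S \subset T by apply/fintype.subsetP => Q; rewrite inE => /andP[].
have lS : laminar S by exact: laminar_sub lT.
have -> : [set x | c <= dyadic_max T nu u x] = finset.cover S.
  apply/finset.setP => x; rewrite inE; apply/idP/bigcupP => [|[Q]].
    move=> /(dyadic_max_gt0P c0)[Q /andP[QT xQ] cQ].
    by exists Q => //; rewrite inE QT.
  by rewrite inE => /andP[QT cQ] xQ; apply: le_trans cQ _; exact: dyadic_max_ge.
rewrite !mass_cover // mulr_sumr; apply: ler_sum => Q.
move=> /(fintype.subsetP (tops_sub S)); rewrite inE => /andP[QT].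
rewrite /dens; have [->|nuQ] := eqVneq (mass nu Q) 0.
  by rewrite invr0 mulr0 leNgt c0.
by rewrite ler_pdivlMr // lt0r nuQ mass_ge0.
Qed.

Definition doobC s : R := 2 `^ s * 2 `^ s * geoC (s - 1).

Lemma doobC_gt0 s : 1 < s -> 0 < doobC s.
Proof. by move=> s1; rewrite !mulr_gt0 ?powR_gt0 // geoC_gt0 //; lra. Qed.

(** Doob's maximal inequality. The level sets are compared with the part of
    [f] above half the level, and the levels are summed geometrically. *)
Lemma doob T nu f s : laminar T -> (forall x, 0 <= nu x) ->
  (forall x, 0 <= f x) -> 1 < s ->
  \sum_x nu x * dyadic_max T nu (fun y => f y * nu y) x `^ s <=
  doobC s * \sum_x nu x * f x `^ s.
Proof.
move=> lT nu0 f0 s1.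
set u := fun y => f y * nu y.
have u0 x : 0 <= u x by rewrite mulr_ge0.
pose M := dyadic_max T nu u.
have M0 x : 0 <= M x by exact: dyadic_max_ge0.
pose L := levels (fun x => lev (M x)).
pose p2 (k : int) : R := 2 `^ k%:~R.
have p2_gt0 k : 0 < p2 k by exact: pow2_gt0.
have weak k : p2 k * mass nu [set x | p2 k <= M x] <=
    2 * \sum_(x | p2 k <= 2 * f x) u x.
  have := dyadic_max_weak lT nu0 u0 (p2_gt0 k); rewrite -/M => h.
  have h2 : mass u [set x | p2 k <= M x] <=
      \sum_(x | p2 k <= 2 * f x) u x + p2 k / 2 * mass nu [set x | p2 k <= M x].
    rewrite /mass (bigID (fun x => p2 k <= 2 * f x)) /=; apply: lerD.
      by apply: ler_sum_sub => // x /andP[].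
    rewrite mulr_sumr; apply: (@le_trans _ _ (\sum_(i in [set x | p2 k <= M x] | ~~ (p2 k <= 2 * f i)) p2 k / 2 * nu i)).
      apply: ler_sum => x /andP[_]; rewrite -ltNge => fx.
      by rewrite ler_wpM2r //; lra.
    by apply: ler_sum_sub => [x /andP[]|x] //; rewrite mulr_ge0 // divr_ge0 // ltW.
  have h3 := le_trans h h2.
  rewrite -/(mass nu _) in h3; set a := _ * mass _ _ in h3 *; lra.
have pt x : nu x * M x `^ s <=
    \sum_(k <- L) (if p2 k <= M x then nu x * (2 `^ s * 2 `^ (s * k%:~R)) else 0).
  have [->|Mx0] := eqVneq (M x) 0.
    rewrite powR0 ?gt_eqF //; last lra.
    rewrite mulr0 sumr_ge0 // => k _; case: ifP => // _.
    by rewrite !mulr_ge0 ?powR_ge0.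
  have Mp : 0 < M x by rewrite lt0r Mx0 M0.
  apply: le_trans (le_sum_seq _ (mem_levels (fun x => lev (M x)) x) isT) => /=.
    by rewrite /p2 lev_le // ler_wpM2l // lev_powR_ge //; lra.
  by move=> k; case: ifP => // _; rewrite !mulr_ge0 ?powR_ge0.
apply: le_trans (ler_sum _ (fun x _ => pt x)) _.
rewrite exchange_big /=.
have lvl k : \sum_x (if p2 k <= M x then nu x * (2 `^ s * 2 `^ (s * k%:~R)) else 0)
    <= \sum_x (if p2 k <= 2 * f x then u x * (2 * 2 `^ s * 2 `^ ((s - 1) * k%:~R)) else 0).
  rewrite -!big_mkcond /= -!mulr_suml.
  have -> : 2 `^ (s * k%:~R) = p2 k * 2 `^ ((s - 1) * k%:~R) :> R.
    by rewrite /p2 -pow2D; congr powR; ring.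
  have := weak k; rewrite /mass; under eq_bigl do rewrite inE.
  set A := \sum_(_ | _) nu _; set B := \sum_(_ | _) u _ => h.
  have -> : A * (2 `^ s * (p2 k * 2 `^ ((s - 1) * k%:~R))) =
     (p2 k * A) * (2 `^ s * 2 `^ ((s - 1) * k%:~R)) by ring.
  have -> : B * (2 * 2 `^ s * 2 `^ ((s - 1) * k%:~R)) =
     (2 * B) * (2 `^ s * 2 `^ ((s - 1) * k%:~R)) by ring.
  by rewrite ler_wpM2r // mulr_ge0 ?powR_ge0.
apply: le_trans (ler_sum _ (fun k _ => lvl k)) _.
rewrite exchange_big /= mulr_sumr; apply: ler_sum => x _.
rewrite -big_mkcond -!mulr_sumr /= /u.
have [->|fx0] := eqVneq (f x) 0.
  by rewrite !mul0r mulr_ge0 ?(ltW (doobC_gt0 s1)) // mulr_ge0 ?powR_ge0.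
have fp : 0 < f x by rewrite lt0r fx0 f0.
have g : \sum_(k <- L | p2 k <= 2 * f x) 2 `^ ((s - 1) * k%:~R) <=
    geoC (s - 1) * (2 * f x) `^ (s - 1) :> R.
  rewrite -big_filter.
  apply: le_trans (@geo_sum _ _ _ (lev (2 * f x)) _ _ _) _.
  - by lra.
  - by rewrite filter_uniq // levels_uniq.
  - by move=> k; rewrite mem_filter => /andP[h _]; apply: le_lev => //; lra.
  rewrite ler_wpM2l //; first by rewrite ltW // geoC_gt0 //; lra.
  by apply: lev_powR_le; lra.
apply: le_trans (ler_wpM2l _ (ler_wpM2l _ g)) _; rewrite ?mulr_ge0 ?powR_ge0 //.
rewrite le_eqVlt; apply/orP; left; apply/eqP.
rewrite /doobC -(@mulr_powRB1 _ (f x) s) //; last lra.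
rewrite (powRM _ _ (f0 x)) // -(@mulr_powRB1 _ 2 s) //; last lra.
ring.
Qed.
End Laminar.

(** * Sparse families *)

Section Sparse_families.
Context {R : realType} {X : finType}.
Implicit Types (m nu u f w : X -> R) (A P Q : {set X}) (S T D : {set {set X}}).

Definition below T P := \bigcup_(Q in T | Q \proper P) Q.

Definition core T P := P :\: below T P.

(** The ratio 1/5 is small enough for [sparse_level_weak]: even after doubling the
    density, the members below [P] carry at most half of the mass of [psi] on [P]. *)
Definition sparse m T :=
  forall P, P \in T -> mass m (below T P) <= 5^-1 * mass m P.

Definition cone T P := [set Q in T | Q \subset P].

Lemma cone_sub T P : cone T P \subset T.
Proof. by apply/fintype.subsetP => Q; rewrite inE => /andP[]. Qed.

Lemma below_sub T P : below T P \subset P.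
Proof. by apply/finset.bigcupsP => Q /andP[_ /proper_sub]. Qed.

Lemma sub_below S T P : S \subset T -> below S P \subset below T P.
Proof.
move=> ST; apply/finset.bigcupsP => Q /andP[QS QP]; apply: finset.bigcup_sup.
by rewrite (fintype.subsetP ST).
Qed.

Lemma sparse_sub m S T : (forall x, 0 <= m x) -> S \subset T ->
  sparse m T -> sparse m S.
Proof.
move=> m0 ST sT P PS; apply: le_trans (sT _ (fintype.subsetP ST _ PS)).
by apply: mass_le => //; exact: sub_below.
Qed.

Lemma core_inj T P Q x : laminar T -> P \in T -> Q \in T ->
  x \in core T P -> x \in core T Q -> P = Q.
Proof.
move=> lT PT QT; rewrite !inE => /andP[xP' xP] /andP[xQ' xQ].
apply/eqP/negPn/negP => PQ.
have [h|h] := laminar_meet lT PT QT xP xQ.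
  move/negP: xQ'; apply; apply/finset.bigcupP; exists P => //.
  by rewrite PT finset.properEneq PQ h.
move/negP: xP'; apply; apply/finset.bigcupP; exists Q => //.
by rewrite QT finset.properEneq eq_sym PQ h.
Qed.

(** Each point lies in at most one core. *)
Lemma core_sum T (c : pred {set X}) A (F : {set X} -> X -> R) (G : X -> R) :
  laminar T -> (forall x, 0 <= G x) ->
  (forall P, P \in T -> c P -> P \subset A) ->
  (forall P x, P \in T -> c P -> x \in core T P -> F P x <= G x) ->
  \sum_(P in T | c P) \sum_(x in core T P) F P x <= \sum_(x in A) G x.
Proof.
move=> lT G0 cA FG.
apply: (@le_trans _ _ (\sum_(P in T | c P) \sum_(x in core T P) G x)).
  by apply: ler_sum => P /andP[PT cP]; apply: ler_sum => x; exact: FG.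
rewrite (exchange_big_dep (mem A)) /=; last first.
  move=> P x /andP[PT cP]; rewrite inE => /andP[_].
  by apply/fintype.subsetP; exact: cA.
apply: ler_sum => x xA; rewrite sumr_const -[leRHS]mulr1n ler_wpMn2l //.
rewrite (@leq_trans 1%N) //; apply/fintype.card_le1P => P /=.
move=> /andP[/andP[PT cP] xP] Q.
apply/idP/idP => [/andP[/andP[QT cQ] xQ]|/eqP ->].
  by apply/eqP; exact: (core_inj lT QT PT xQ xP).
by apply/andP; split=> //; apply/andP.
Qed.

Lemma core_mass_sum T (c : pred {set X}) A u :
  laminar T -> (forall x, 0 <= u x) ->
  (forall P, P \in T -> c P -> P \subset A) ->
  \sum_(P in T | c P) mass u (core T P) <= mass u A.
Proof. by move=> lT u0 cA; apply: (core_sum lT u0 cA). Qed.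

Lemma sparse_core m T P : sparse m T -> P \in T ->
  mass m P <= 5 / 4 * mass m (core T P).
Proof.
move=> sT PT; have := sT P PT.
have -> : mass m P = mass m (below T P) + mass m (core T P).
  rewrite /mass (big_setID (below T P)) /=.
  by rewrite (finset.setIidPr (below_sub T P)).
by lra.
Qed.

Lemma sparse_carleson m T (c : pred {set X}) A :
  laminar T -> (forall x, 0 <= m x) -> sparse m T ->
  (forall P, P \in T -> c P -> P \subset A) ->
  \sum_(P in T | c P) mass m P <= 5 / 4 * mass m A.
Proof.
move=> lT m0 sT cA.
apply: le_trans (ler_wpM2l _ (core_mass_sum lT m0 cA)); last lra.
rewrite mulr_sumr; apply: ler_sum => P /andP[PT _]; exact: sparse_core.
Qed.

(** The Fujii--Wilson constant turns Lebesgue sparseness into sparseness with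
    respect to [u]: on the core of a subset [P] of [A], the maximal function
    of [u] restricted to [A] is at least the density of [u] on [P]. *)
Lemma sparse_carleson_ainfty m u T D A K :
  laminar T -> T \subset D -> (forall x, 0 < m x) -> (forall x, 0 <= u x) ->
  sparse m T ->
  \sum_(x in A) m x * dyadic_max (cone D A) m u x <= K * mass u A ->
  \sum_(P in cone T A) mass u P <= 2 * K * mass u A.
Proof.
move=> lT TD m0 u0 sT hA; rewrite -mulrA.
have m0' x : 0 <= m x by exact: ltW.
apply: le_trans (ler_wpM2l _ hA); last lra.
rewrite /cone; under eq_bigl do rewrite inE.
apply: (@le_trans _ _ (2 * \sum_(P in T | P \subset A) \sum_(x in core T P)
    m x * dens m u P)).
  rewrite mulr_sumr; apply: ler_sum => P /andP[PT _].
  rewrite -mulr_suml.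
  rewrite -(densE _ _ m0) -[\sum_(i in _) m i]/(mass m _).
  have := sparse_core sT PT.
  have := dens_ge0 P m0' u0; set d := dens _ _ _.
  have := mass_ge0 (core T P) m0'; set a := mass m (core T P); set b := mass m P.
  by move=> a0 d0 h; apply: (@le_trans _ _ (d * (5 / 4 * a))); [exact: ler_wpM2l|nra].
rewrite ler_wpM2l //; apply: core_sum => // [x|P x PT PA].
  by rewrite mulr_ge0 // dyadic_max_ge0.
rewrite inE => /andP[_ xP]; rewrite ler_wpM2l // dyadic_max_ge // inE PA andbT.
by rewrite (fintype.subsetP TD).
Qed.

(** Jensen's inequality for the average of [f] over [A] against [u], multiplied out
    so that it also holds when [u] has no mass on [A]. *)
Lemma jensen_sum u f A p : 1 < p -> (forall x, 0 <= u x) -> (forall x, 0 <= f x) ->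
  mass (fun x => f x * u x) A `^ p <=
  (\sum_(x in A) f x `^ p * u x) * mass u A `^ (p - 1).
Proof.
move=> p1 u0 f0.
set F := mass _ A; set V := mass u A; set E := \sum_(x in A) _.
have F0 : 0 <= F by apply: mass_ge0 => x; exact: mulr_ge0.
have V0 : 0 <= V by exact: mass_ge0.
have [Fz|Fnz] := eqVneq F 0.
  rewrite Fz powR0; last lra.
  by rewrite mulr_ge0 ?powR_ge0 // sumr_ge0 // => x _; rewrite mulr_ge0 ?powR_ge0.
have Fp : 0 < F by rewrite lt0r Fnz.
have Vp : 0 < V.
  rewrite lt0r V0 andbT; apply: contra_neq Fnz => Vz.
  rewrite /F /mass big1 // => x xA.
  suff -> : u x = 0 by rewrite mulr0.
  apply/eqP; rewrite eq_le u0 andbT -Vz /V /mass (bigD1 x) //= lerDl.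
  exact: sumr_ge0.
pose q := p / (p - 1).
have pq : p^-1 + q^-1 = 1 by rewrite /q invf_div; field; lra.
have q1 : 0 < q by rewrite divr_gt0; lra.
pose a := F / V.
have ap : 0 < a by rewrite divr_gt0.
have young x : f x * a `^ (p - 1) * u x <= (f x `^ p / p + a `^ p / q) * u x.
  rewrite ler_wpM2r //; apply: le_trans (conjugate_powR _ _ _ _ pq) _ => //.
  - by rewrite powR_ge0.
  - by lra.
  - rewrite -powRrM (_ : (p - 1) * q = p) // /q; field; lra.
have : a `^ (p - 1) * F <= E / p + a `^ p / q * V.
  rewrite /F /E /V /mass !mulr_sumr mulr_suml -big_split /=.
  apply: ler_sum => x _; have := young x; lra.
have -> : a `^ (p - 1) * F = a `^ p * V.
  rewrite -(@mulr_powRB1 _ a p) //; [|lra|lra].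
  by rewrite /a; field; lra.
have -> : q^-1 = 1 - p^-1 by lra.
have p0 : 0 < p^-1 by rewrite invr_gt0; lra.
move=> h; have {h} h : a `^ p * V <= E.
  have : a `^ p * V * p^-1 <= E * p^-1 by lra.
  by rewrite ler_pM2r.
have -> : F = a * V by rewrite /a divfK // gt_eqF.
rewrite powRM //; last exact: ltW.
rewrite -(@mulr_powRB1 _ V p) //; last lra.
by rewrite mulrA ler_wpM2r ?powR_ge0.
Qed.

(** If all members of a sparse family have [psi]-density about [c], then at
    least half of the mass of [psi] on each of them sits on its core. On the
    disjoint cores, Hoelder's inequality and the two-weight condition give a
    bound by the energy of [Phi], in which no A_infty constant appears. *)
Lemma sparse_level_weak m w (sigma Phi : X -> R) T (K c p : R) : 1 < p -> 0 < c -> 0 <= K ->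
  laminar T -> (forall x, 0 < m x) -> (forall x, 0 <= w x) ->
  (forall x, 0 <= sigma x) -> (forall x, 0 <= Phi x) -> sparse m T ->
  (forall P, P \in T -> dens m w P * dens m sigma P `^ (p - 1) <= K) ->
  (forall P, P \in T -> c <= dens m (fun x => Phi x * sigma x) P < 2 * c) ->
  c `^ p * \sum_(P in T) mass w P <=
  2 `^ p * K * \sum_x Phi x `^ p * sigma x.
Proof.
move=> p1 c0 K0 lT m0 w0 s0 P0 sT hA hc.
set psi := fun x => Phi x * sigma x.
have psi0 x : 0 <= psi x by exact: mulr_ge0.
have m0' x : 0 <= m x by exact: ltW.
have one P : P \in T -> c `^ p * mass w P <=
    2 `^ p * K * \sum_(x in core T P) Phi x `^ p * sigma x.
  move=> PT; have /andP[c1 c2] := hc _ PT.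
  have bel : mass psi (below T P) <= c / 2 * mass m P.
    apply: (@le_trans _ _ (\sum_(Q in T | Q \proper P) mass psi Q)).
      rewrite /mass /below.
      apply: (@le_trans _ _ (\sum_(x in X) \sum_(Q in T | (Q \proper P) && (x \in Q)) psi x)).
        rewrite big_mkcond /=; apply: ler_sum => x _; case: ifP => [|_].
          move=> /finset.bigcupP[Q /andP[QT QP] xQ].
          by rewrite (bigD1 Q) ?QT ?QP //= lerDl sumr_ge0.
        exact: sumr_ge0.
      rewrite [leRHS](exchange_big_dep xpredT) //=; apply: ler_sum => x _.
      by under eq_bigl do rewrite andbA.
    apply: (@le_trans _ _ (2 * c * \sum_(Q in T | Q \proper P) mass m Q)).
      rewrite mulr_sumr; apply: ler_sum => Q /andP[QT _].
      rewrite -(densE _ _ m0) ler_wpM2r ?mass_ge0 // ltW //.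
      by have /andP[] := hc _ QT.
    have car := sparse_carleson lT m0' sT (c := fun Q => Q \proper P) (A := below T P).
    have {}car := car (fun Q QT QP => finset.bigcup_sup Q (introT andP (conj QT QP))).
    have := sT _ PT; have := mass_ge0 P m0'.
    set a := \sum_(_ in _ | _) _ in car *; set b := mass m (below _ _) in car *.
    set d := mass m P; move=> d0 bd; nra.
  have mP : c * mass m P <= 2 * mass psi (core T P).
    have e : mass psi P = mass psi (below T P) + mass psi (core T P).
      rewrite /mass (big_setID (below T P)) /=.
      by rewrite (finset.setIidPr (below_sub T P)).
    have := densE psi P m0; have := mass_ge0 P m0'.
    set d := mass m P in bel *; move=> d0 h; rewrite -/psi in c1.
    have : c * d <= dens m psi P * d by rewrite ler_wpM2r.
    rewrite h e; lra.
  have [Pe|[x0 x0P]] := finset.set_0Vmem P.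
    rewrite {1}Pe /mass big_set0 mulr0 mulr_ge0 ?mulr_ge0 ?powR_ge0 ?sumr_ge0 // => x _.
    by rewrite mulr_ge0 ?powR_ge0.
  have mp : 0 < mass m P.
    by rewrite /mass (bigD1 x0) //= ltr_pwDl // sumr_ge0.
  have J := jensen_sum (core T P) p1 s0 P0; rewrite -/psi in J.
  set E := \sum_(x in core T P) _ in J *.
  have E0 : 0 <= E by apply: sumr_ge0 => x _; rewrite mulr_ge0 ?powR_ge0.
  have sc : mass sigma (core T P) `^ (p - 1) <= mass sigma P `^ (p - 1).
    apply: powR_le; [by rewrite subr_ge0 ltW|exact: mass_ge0|].
    by apply: mass_le => //; exact: finset.subsetDl.
  have cm : (c * mass m P) `^ p <= 2 `^ p * (E * mass sigma P `^ (p - 1)).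
    apply: (@le_trans _ _ ((2 * mass psi (core T P)) `^ p)).
      by apply: powR_le; rewrite ?mulr_ge0 ?(ltW c0) // ?(ltW mp) //; lra.
    rewrite powRM ?mass_ge0 // ler_wpM2l ?powR_ge0 // (le_trans J) // ler_wpM2l //.
  rewrite powRM ?(ltW c0) ?(ltW mp) // in cm.
  have mpp : 0 < mass m P `^ p by rewrite powR_gt0.
  rewrite -(ler_pM2r mpp).
  have -> : c `^ p * mass w P * mass m P `^ p = c `^ p * mass m P `^ p * mass w P by ring.
  apply: le_trans (ler_wpM2r (mass_ge0 P w0) cm) _.
  have -> : mass sigma P = dens m sigma P * mass m P by rewrite densE.
  have -> : mass w P = dens m w P * mass m P by rewrite densE.
  rewrite powRM ?dens_ge0 ?(ltW mp) // -[X in _ <= _ * X](@mulr_powRB1 _ _ p) ?(ltW mp) //; last lra.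
  have := hA _ PT; set a := dens _ _ _; set b := _ `^ _; set d := mass m P; set e := d `^ (p - 1) => ab.
  have -> : 2 `^ p * (E * (b * e)) * (a * d) = (2 `^ p * E * (d * e)) * (a * b) by ring.
  have -> : 2 `^ p * K * E * (d * e) = (2 `^ p * E * (d * e)) * K by ring.
  by rewrite ler_wpM2l // !mulr_ge0 ?powR_ge0 // ltW.
rewrite [leLHS]mulr_sumr; apply: le_trans (ler_sum _ one) _.
rewrite -mulr_sumr ler_wpM2l ?mulr_ge0 ?powR_ge0 //.
have := @core_sum T predT [set: X] (fun _ x => Phi x `^ p * sigma x)
  (fun x => Phi x `^ p * sigma x) lT.
under [X in _ -> _ -> _ -> X <= _]eq_bigl do rewrite andbT.
under [X in _ -> _ -> _ -> _ <= X]eq_bigl do rewrite inE.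
by apply=> // x; rewrite ?mulr_ge0 ?powR_ge0.
Qed.

End Sparse_families.

(** * Overlap moments and powers of sparse sums *)

Section Overlap_moments.
Context {R : realType} {X : finType}.
Implicit Types (m nu u f w : X -> R) (P Q : {set X}) (S T D : {set {set X}}).

Definition overlap T x : R := \sum_(P in T | x \in P) 1.

Lemma overlap_ge0 T x : 0 <= overlap T x.
Proof. exact: sumr_ge0. Qed.

Lemma overlap_sub S T x : S \subset T -> overlap S x <= overlap T x.
Proof.
by move=> /fintype.subsetP ST; apply: ler_sum_sub => // P /andP[/ST -> ->].
Qed.

(** The members of [T] containing [x] form a chain; the [i]-th from the inside
    contributes i^k, and the sum of these is at least N^(k+1) / (k+1). *)
Lemma overlap_pow_le T x (k : nat) : laminar T ->
  overlap T x ^+ k.+1 <= k.+1%:R * \sum_(P in T | x \in P) overlap (cone T P) x ^+ k.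
Proof.
move: {2}#|T| (leqnn #|T|) => n; elim: n T => [|n IHn] T.
  rewrite leqn0 cards_eq0 => /eqP -> _; rewrite /overlap !big1 ?expr0n ?mulr0 // => P.
    by rewrite finset.in_set0.
  by rewrite finset.in_set0.
move=> Tn lT.
have [/fintype.existsP[P0 /andP[P0T xP0]]|/fintype.existsPn h] := boolP [exists P, (P \in T) && (x \in P)]; last first.
  rewrite /overlap !big1 ?expr0n ?mulr0 // => P PT; by have := h P; rewrite PT.
case: (@arg_maxnP _ P0 (fun P => (P \in T) && (x \in P)) (fun P => #|P|)).
  by rewrite P0T.
move=> P /andP[PT xP] Pmax {P0 P0T xP0}.
have below_P Q : Q \in T -> x \in Q -> Q \subset P.
  move=> QT xQ; have [//|PQ] := laminar_meet lT QT PT xQ xP.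
  suff /eqP -> : P == Q by [].
  by rewrite eqEcard PQ; apply: Pmax; rewrite QT.
pose T' := T :\ P.
have T'T : T' \subset T by exact: finset.subD1set.
have T'n : (#|T'| <= n)%N by move: Tn; rewrite (cardsD1 P) PT.
have := IHn T' T'n (laminar_sub T'T lT).
have cT : overlap T x = overlap T' x + 1.
  rewrite /overlap (bigD1 P) ?PT //= addrC; congr (_ + _); apply: eq_bigl => Q.
  by rewrite !inE; case: (Q \in T); rewrite ?andbF //= andbT andbC.
have cP : overlap (cone T P) x = overlap T x.
  rewrite /overlap; apply: eq_bigl => Q; rewrite inE.
  by case: (boolP (Q \in T)) => //= QT; case: (boolP (x \in Q)) => xQ; rewrite ?andbF // below_P.
rewrite [X in _ -> _ <= _ * X](bigD1 P) ?PT //= cP mulrDr.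
have x1 : 1 <= overlap T x by rewrite cT lerDr overlap_ge0.
have := le_bern_nat k x1; rewrite [X in (X - 1) ^+ _]cT addrK => h1 h2.
rewrite -lerBlDl; apply: le_trans (_ : overlap T' x ^+ k.+1 <= _).
  by rewrite lerBlDr -lerBlDl.
apply: le_trans h2 _; rewrite ler_wpM2l //.
apply: (@le_trans _ _ (\sum_(Q in T' | x \in Q) overlap (cone T Q) x ^+ k)).
  apply: ler_sum => Q _; apply: lerXn2r; rewrite ?nnegrE ?overlap_ge0 //.
  apply: overlap_sub; apply/fintype.subsetP => Q'; rewrite !inE => /andP[/andP[_ ->]].
  by [].
by apply: ler_sum_sub => Q; rewrite ?exprn_ge0 ?overlap_ge0 // !inE => /andP[/andP[-> ->] ->].
Qed.

Lemma cone_cone T P Q : Q \subset P -> cone (cone T P) Q = cone T Q.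
Proof.
move=> QP; apply/finset.setP => A; rewrite !inE; case: (A \in T) => //=.
by case: (boolP (A \subset Q)) => [AQ|]; rewrite ?andbF // (fintype.subset_trans AQ).
Qed.

(** The (k+1)-st power of the overlap is controlled by the k-th powers of the
    overlaps inside the members of [T]. Each use of this costs one constant [B] of the
    Carleson condition for [nb], a majorant of the masses of [nu]. *)
Lemma moments nu (nb : {set X} -> R) B T (k : nat) : laminar T ->
  (forall x, 0 <= nu x) -> 0 <= B -> 
  (forall P, P \in T -> mass nu P <= nb P) ->
  (forall P, P \in T -> \sum_(Q in cone T P) nb Q <= B * nb P) ->
  \sum_x nu x * overlap T x ^+ k.+1 <= (k.+1)`!%:R * B ^+ k * \sum_(P in T) nb P.
Proof.
move=> + nu0 B0; elim: k T => [|k IHk] T lT hn hB.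
  rewrite expr0 factS mulr1 mul1r.
  apply: le_trans (ler_sum _ hn); rewrite /mass /overlap.
  under eq_bigr do rewrite expr1 mulr_sumr big_mkcondr /=.
  rewrite exchange_big /=; apply: ler_sum => P PT; rewrite -big_mkcond /=.
  by under eq_bigr do rewrite mulr1.
apply: (@le_trans _ _ (\sum_(P in T) k.+2%:R * \sum_x nu x * overlap (cone T P) x ^+ k.+1)).
  apply: (@le_trans _ _ (\sum_x \sum_(P in T) k.+2%:R * (nu x * overlap (cone T P) x ^+ k.+1))).
    apply: ler_sum => x _.
    apply: le_trans (ler_wpM2l (nu0 x) (overlap_pow_le x k.+1 lT)) _.
    rewrite mulrCA -mulr_sumr ler_wpM2l // mulr_sumr; apply: ler_sum_sub => [P /andP[]//|P _].
    by rewrite mulr_ge0 ?exprn_ge0 ?overlap_ge0.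
  by rewrite exchange_big /=; apply: ler_sum => P _; rewrite mulr_sumr.
rewrite [leRHS]mulr_sumr; apply: ler_sum => P PT.
have IH := IHk (cone T P) (laminar_sub (cone_sub T P) lT).
rewrite factS natrM exprS.
apply: (@le_trans _ _ (k.+2%:R * ((k.+1)`!%:R * B ^+ k * (B * nb P)))); last first.
  by rewrite le_eqVlt; apply/orP; left; apply/eqP; ring.
rewrite ler_wpM2l //; apply: le_trans (IH _ _) _.
- by move=> Q; rewrite inE => /andP[QT _]; exact: hn.
- by move=> Q; rewrite inE => /andP[QT QP]; rewrite cone_cone //; exact: hB.
- by rewrite ler_wpM2l ?hB // mulr_ge0 ?exprn_ge0.
Qed.

Definition level T (kap : {set X} -> int) k := [set P in T | kap P == k].

Lemma level_sub T kap k : level T kap k \subset T.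
Proof. by apply/fintype.subsetP => P; rewrite inE => /andP[]. Qed.

Lemma sum_level T (kap : {set X} -> int) j (F : {set X} -> R) :
  \sum_(P in level T kap j) F P = \sum_(P in T | kap P == j) F P.
Proof. by apply: eq_bigl => P; rewrite inE. Qed.

(** Level [j] contributes [2 ^ (b j)] times its overlap. If [Y] is the sum on the
    right, this is at most the (k+1)-st root of [Y] times [2 ^ (d j)] with
    [d = b - t / (k+1) > 0]; the levels then form a geometric series dominated
    by the top one, [k0]. *)
Lemma sum_levels_pow T (kap : {set X} -> int) x (b t : R) (k : nat) k0 :
  t < b * k.+1%:R -> (forall P, P \in T -> x \in P -> kap P <= k0) ->
  (\sum_(P in T | x \in P) 2 `^ (b * (kap P)%:~R)) ^+ k.+1 <=
  geoC (b - t / k.+1%:R) ^+ k.+1 * 2 `^ ((b * k.+1%:R - t) * k0%:~R) *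
  \sum_(j <- levels kap) 2 `^ (t * j%:~R) * overlap (level T kap j) x ^+ k.+1.
Proof.
move=> tb hk0.
set M : R := k.+1%:R in tb *; have M0 : 0 < M by rewrite ltr0n.
set Y := \sum_(j <- _) _.
have Y0 : 0 <= Y by apply: sumr_ge0 => j _; rewrite mulr_ge0 ?powR_ge0 ?exprn_ge0 ?overlap_ge0.
set d := b - t / M.
have d0 : 0 < d by rewrite /d subr_gt0 ltr_pdivrMr.
rewrite (sum_levels kap).
pose L := [seq j <- levels kap | j <= k0].
have step : \sum_(j <- levels kap) \sum_(P | (P \in T) && (x \in P) && (kap P == j)) 2 `^ (b * (kap P)%:~R) <=
    Y `^ M^-1 * \sum_(j <- L) 2 `^ (d * j%:~R).
  rewrite big_filter mulr_sumr [leRHS]big_mkcond /=.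
  rewrite big_seq [leRHS]big_seq; apply: ler_sum => j jL.
  have -> : \sum_(P | (P \in T) && (x \in P) && (kap P == j)) 2 `^ (b * (kap P)%:~R) =
      2 `^ (b * j%:~R) * overlap (level T kap j) x.
    rewrite /overlap mulr_sumr; apply: eq_big => P.
      by rewrite inE; case: (P \in T); case: (x \in P); rewrite ?andbF ?andbT.
    by move=> /andP[_ /eqP ->]; rewrite mulr1.
  have [jk|jk] := leP j k0; last first.
    rewrite /overlap big1 ?mulr0 // => P; rewrite inE => /andP[/andP[PT /eqP kP] xP].
    by have := hk0 _ PT xP; rewrite kP leNgt jk.
  have -> : b * j%:~R = t * j%:~R / M + d * j%:~R by rewrite /d; field; lra.
  rewrite pow2D mulrAC ler_wpM2r ?powR_ge0 //.
  have -> : 2 `^ (t * j%:~R / M) * overlap (level T kap j) x =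
     (2 `^ (t * j%:~R) * overlap (level T kap j) x ^+ k.+1) `^ M^-1.
    rewrite powRM ?powR_ge0 ?exprn_ge0 ?overlap_ge0 // -powRrM -powR_mulrn ?overlap_ge0 //.
    by rewrite powRK ?overlap_ge0 // gt_eqF.
  apply: powR_le; rewrite ?invr_ge0 ?(ltW M0) //.
    by rewrite mulr_ge0 ?powR_ge0 ?exprn_ge0 ?overlap_ge0.
  rewrite /Y (perm_big _ (perm_to_rem jL)) /= big_cons lerDl sumr_ge0 // => i _.
  by rewrite mulr_ge0 ?powR_ge0 ?exprn_ge0 ?overlap_ge0.
have gs : \sum_(j <- L) 2 `^ (d * j%:~R) <= geoC d * 2 `^ (d * k0%:~R).
  apply: geo_sum => //; first by rewrite filter_uniq // levels_uniq.
  by move=> j; rewrite mem_filter => /andP[].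
apply: (@le_trans _ _ ((Y `^ M^-1 * (geoC d * 2 `^ (d * k0%:~R))) ^+ k.+1)).
  apply: lerXn2r; rewrite ?nnegrE.
  - by apply: sumr_ge0 => j _; apply: sumr_ge0 => P _; rewrite powR_ge0.
  - by rewrite !mulr_ge0 ?powR_ge0 // ltW // geoC_gt0.
  - apply: le_trans step _; rewrite ler_wpM2l ?powR_ge0 //.
rewrite -!powR_mulrn ?mulr_ge0 ?powR_ge0 //; try by rewrite ltW // geoC_gt0.
rewrite powRM ?powR_ge0 ?mulr_ge0 ?powR_ge0 //; try by rewrite ltW // geoC_gt0.
rewrite powRVK // ?gt_eqF // powRM ?powR_ge0 //; try by rewrite ltW // geoC_gt0.
rewrite -powRrM (_ : d * k0%:~R * M = (b * M - t) * k0%:~R); last first.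
  by rewrite /d; field; lra.
by rewrite mulrC.
Qed.

End Overlap_moments.

Section Testing.
Context {R : realType} {X : finType}.
Implicit Types (m nu u f w : X -> R) (P Q F G : {set X}) (S T D : {set {set X}}).

(** [k] is the integer part of [r], so that the moment of order [k + 1] is
    higher than the power [r = (g + 1) / b] to be estimated. *)
Definition powC (b g : R) : R :=
  let r := (g + 1) / b in let k := Num.truncn r in
  2 `^ (g + 1) * geoC (b - (g + 1) / k.+1%:R) `^ r * ((k.+1)`!%:R * 2 ^+ k).

Lemma powC_ge0 (b g : R) : 0 <= powC b g.
Proof. by rewrite /powC !mulr_ge0 ?powR_ge0 ?exprn_ge0. Qed.

(** A testing inequality that costs no A_infty constant of [nu]. On the members
    of [T] with [u]-density about 2^j, the masses of [nu] are at most
    d 2^(-g j) times those of [m], for which sparseness gives a Carleson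
    condition. The moments of [nu] on this level are thus bounded by
    d 2^(-(g+1) j) times the mass of [u], which compensates the weight
    2^((g+1) j) that [sum_levels_pow] gives to the level. *)
Lemma sparse_power_sum m nu u T (b g d : R) : 0 < b -> 0 < g -> 0 <= d ->
  laminar T -> (forall x, 0 < m x) -> (forall x, 0 <= nu x) ->
  (forall x, 0 <= u x) -> sparse m T -> (forall P, P \in T -> 0 < dens m u P) ->
  (forall P, P \in T -> mass nu P <= d * dens m u P `^ (- g) * mass m P) ->
  \sum_x nu x * (\sum_(P in T | x \in P) dens m u P `^ b) `^ ((g + 1) / b) <=
  powC b g * d * \sum_(P in T) mass u P.
Proof.
move=> b0 g0 d0 lT m0 nu0 u0 sT up hnu.
set r := (g + 1) / b; rewrite /powC -/r; set k := Num.truncn r.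
have r0 : 0 < r by rewrite divr_gt0 // addr_gt0.
have m0' x : 0 <= m x by exact: ltW.
pose M : R := k.+1%:R; have M0 : 0 < M by rewrite ltr0n.
have rM : r < M by rewrite /M /k truncnS_gt.
have t0 : 0 < g + 1 by rewrite addr_gt0.
have tb : g + 1 < b * M by rewrite mulrC -ltr_pdivrMr.
pose kap P := lev (dens m u P).
have k1 P : P \in T -> 2 `^ (kap P)%:~R <= dens m u P by move=> PT; rewrite lev_le ?up.
pose Y x := \sum_(j <- levels kap) 2 `^ ((g + 1) * j%:~R) * overlap (level T kap j) x ^+ k.+1.
set c := geoC _.
have c0 : 0 <= c.
  by rewrite ltW // geoC_gt0 // subr_gt0 ltr_pdivrMr.
have Y0 x : 0 <= Y x.
  by apply: sumr_ge0 => j _; rewrite mulr_ge0 ?powR_ge0 ?exprn_ge0 ?overlap_ge0.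
have pt x : (\sum_(P in T | x \in P) dens m u P `^ b) `^ r <= 2 `^ (g + 1) * c `^ r * Y x.
  have [/fintype.existsP[P0 P0x]|/fintype.existsPn h] := boolP [exists P, (P \in T) && (x \in P)]; last first.
    rewrite big1 => [|P PT]; last by have := h P; rewrite PT.
    by rewrite powR0 ?gt_eqF // !mulr_ge0 ?powR_ge0.
  have [P /andP[PT xP] Pm] : exists2 P, (P \in T) && (x \in P) & forall Q, Q \in T -> x \in Q -> kap Q <= kap P.
    case: (@Order.TotalTheory.arg_maxP _ _ _ P0 (fun P => (P \in T) && (x \in P)) kap P0x) => P Px Pm.
    by exists P => // Q QT xQ; apply: Pm; rewrite QT.
  set Z := \sum_(P in T | x \in P) 2 `^ (b * (kap P)%:~R).
  have Z0 : 0 <= Z by apply: sumr_ge0 => Q _; rewrite powR_ge0.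
  have XZ : \sum_(P in T | x \in P) dens m u P `^ b <= 2 `^ b * Z.
    by rewrite mulr_sumr; apply: ler_sum => Q /andP[QT _]; rewrite lev_powR_ge ?up // ltW.
  apply: (@le_trans _ _ ((2 `^ b * Z) `^ r)).
    apply: powR_le => //; first exact: ltW.
    by apply: sumr_ge0 => Q _; rewrite powR_ge0.
  rewrite powRM ?powR_ge0 // -powRrM (_ : b * r = g + 1); last by rewrite /r; field; lra.
  rewrite -mulrA ler_wpM2l ?powR_ge0 //.
  have := sum_levels_pow tb Pm; rewrite -/Z -/c -/(Y x) => hZ.
  have YP : 2 `^ ((g + 1) * (kap P)%:~R) <= Y x.
    rewrite /Y (perm_big _ (perm_to_rem (mem_levels kap P))) /= big_cons.
    rewrite -[leLHS]addr0 lerD //; last first.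
      by apply: sumr_ge0 => j _; rewrite mulr_ge0 ?powR_ge0 ?exprn_ge0 ?overlap_ge0.
    rewrite ler_peMr ?powR_ge0 // exprn_ege1 // /overlap (bigD1 P) /=.
      by rewrite lerDl sumr_ge0.
    by rewrite inE PT eqxx xP.
  have Yp : 0 < Y x by apply: lt_le_trans YP; exact: pow2_gt0.
  have {}hZ : Z `^ M <= c `^ M * Y x `^ (b * M / (g + 1)).
    rewrite /M powR_mulrn // powR_mulrn //.
    apply: le_trans hZ _; rewrite -mulrA ler_wpM2l ?exprn_ge0 //.
    have -> : (b * k.+1%:R - (g + 1)) * (kap P)%:~R =
       ((g + 1) * (kap P)%:~R) * ((b * M - (g + 1)) / (g + 1)) by rewrite /M; field; lra.
    rewrite [X in X * _]powRrM.
    have -> : b * k.+1%:R / (g + 1) = (b * M - (g + 1)) / (g + 1) + 1 by rewrite /M; field; lra.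
    rewrite powRD ?(gt_eqF Yp) ?implybT // powRr1 // ler_wpM2r //.
    apply: powR_le; rewrite ?powR_ge0 // divr_ge0 ?(ltW t0) //; lra.
  have := powR_le (ltW (divr_gt0 r0 M0)) (powR_ge0 _ _) hZ.
  rewrite powRM ?powR_ge0 // -!powRrM.
  have -> : M * (r / M) = r by field; lra.
  have -> : b * M / (g + 1) * (r / M) = 1 by rewrite /r; field; lra.
  by rewrite powRr1.
apply: (@le_trans _ _ (2 `^ (g + 1) * c `^ r * \sum_x nu x * Y x)).
  rewrite mulr_sumr; apply: ler_sum => x _.
  by rewrite mulrCA ler_wpM2l.
rewrite -!mulrA ler_wpM2l ?powR_ge0 // ler_wpM2l ?powR_ge0 //.
under eq_bigr do rewrite mulr_sumr.
rewrite exchange_big /= (sum_levels kap).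
rewrite !mulr_sumr; apply: ler_sum => j _.
have lj : laminar (level T kap j) := laminar_sub (level_sub T kap j) lT.
have dj0 : 0 <= d * 2 `^ (- g * j%:~R) by rewrite mulr_ge0 ?powR_ge0.
have mom := @moments _ _ nu (fun P => d * 2 `^ (- g * j%:~R) * mass m P) 2 (level T kap j) k lj nu0.
apply: (@le_trans _ _ (2 `^ ((g + 1) * j%:~R) * ((k.+1)`!%:R * 2 ^+ k * \sum_(P in level T kap j) d * 2 `^ (- g * j%:~R) * mass m P))).
  under eq_bigr do rewrite mulrCA.
  rewrite -[leLHS]mulr_sumr ler_wpM2l ?powR_ge0 //; apply: mom => //.
    move=> P; rewrite inE => /andP[PT /eqP kP]; apply: le_trans (hnu _ PT) _.
    rewrite ler_wpM2r ?mass_ge0 // ler_wpM2l //.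
    rewrite -kP mulNr [X in _ <= X]powRN powRN lef_pV2 ?posrE ?powR_gt0 ?up //.
    by apply: lev_powR_le; rewrite ?up // ltW.
  move=> P _; rewrite -mulr_sumr mulrCA ler_wpM2l //.
  rewrite /cone; under eq_bigl do rewrite inE.
  have := @sparse_carleson _ _ m (level T kap j) (fun Q => Q \subset P) P lj m0'.
  move=> /(_ (sparse_sub m0' (level_sub _ _ _) sT) (fun Q _ h => h)) h.
  by have := mass_ge0 P m0'; lra.
rewrite !mulr_sumr.
rewrite sum_level; apply: ler_sum => P /andP[PT /eqP kP].
rewrite -(densE u P m0).
have -> : (g + 1) * j%:~R = g * j%:~R + j%:~R by ring.
have e : 2 `^ (g * j%:~R) * 2 `^ (- g * j%:~R) = 1 :> R.
  by rewrite -pow2D (_ : _ + _ = 0) ?powRr0 //; ring.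
rewrite pow2D; move: e; set a := 2 `^ (g * _); set a' := 2 `^ (- g * _) => e.
set q := _`!%:R; set q2 := 2 ^+ k.
have -> : a * 2 `^ j%:~R * (q * q2 * (d * a' * mass m P)) = (a * a') * (q * (q2 * (d * (2 `^ j%:~R * mass m P)))) by ring.
rewrite e mul1r ler_wpM2l // ler_wpM2l ?exprn_ge0 // ler_wpM2l // ler_wpM2r ?mass_ge0 //.
by rewrite -kP k1.
Qed.

End Testing.

(** * Stopping heads and the parallel corona decomposition *)

Section Heads.
Context {R : realType} {X : finType}.
Implicit Types (m nu u f w : X -> R) (P Q F G : {set X}) (S T D : {set {set X}}).
Implicit Types (kap : {set X} -> int).

(** The largest member of [T] above [P] on the same level of [kap] as [P]; for a
    monotone [kap] this is the stopping set of the principal cubes of [T] in which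
    [P] lies. *)
Definition headof T kap P :=
  [arg max_(Q > P | [&& Q \in T, P \subset Q & kap Q == kap P]) #|Q|].

Definition heads T kap := [set P in T | headof T kap P == P].

Definition level_mono T kap := forall P Q, P \in T -> Q \in T ->
  P \subset Q -> kap Q <= kap P.

Lemma headP T kap P : laminar T -> finset.set0 \notin T -> P \in T ->
  [/\ headof T kap P \in T, P \subset headof T kap P, kap (headof T kap P) = kap P &
    forall Q, Q \in T -> P \subset Q -> kap Q = kap P -> Q \subset headof T kap P].
Proof.
move=> lT T0 PT; rewrite /headof; case: arg_maxnP => [|F /and3P[FT PF /eqP kF] Fm].
  by rewrite PT eqxx fintype.subxx.
split=> // Q QT PQ kQ.
have [|[x xP]] := finset.set_0Vmem P; first by move=> P0; rewrite -P0 PT in T0.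
have [//|FQ] := laminar_meet lT QT FT (fintype.subsetP PQ _ xP) (fintype.subsetP PF _ xP).
suff /eqP -> : F == Q by [].
by rewrite eqEcard FQ; apply: Fm; rewrite QT PQ kQ eqxx.
Qed.

(** [kap] is constant between [P] and its head. *)
Lemma head_between T kap P G : laminar T -> finset.set0 \notin T -> level_mono T kap ->
  P \in T -> G \in T -> P \subset G -> G \subset headof T kap P ->
  kap G = kap P /\ headof T kap G = headof T kap P.
Proof.
move=> lT T0 mT PT GT PG GF.
have [FT PF kF Fm] := headP kap lT T0 PT.
have [HT GH kH Hm] := headP kap lT T0 GT.
have kG : kap G = kap P.
  by apply/eqP; rewrite eq_le (mT _ _ PT GT PG) -{1}kF (mT _ _ GT FT GF).
split=> //; apply/eqP; rewrite finset.eqEsubset.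
rewrite Fm ?(fintype.subset_trans PG GH) ?kH //=.
by apply: Hm => //; rewrite kF.
Qed.

Lemma head_heads T kap P : laminar T -> finset.set0 \notin T -> level_mono T kap ->
  P \in T -> headof T kap P \in heads T kap.
Proof.
move=> lT T0 mT PT; have [FT PF kF Fm] := headP kap lT T0 PT.
by rewrite inE FT /=; have [_ ->] := head_between lT T0 mT PT FT PF (fintype.subxx _).
Qed.

Lemma heads_inj T kap F G x : laminar T -> finset.set0 \notin T ->
  F \in heads T kap -> G \in heads T kap -> x \in F -> x \in G ->
  kap F = kap G -> F = G.
Proof.
move=> lT T0; rewrite !inE => /andP[FT /eqP hF] /andP[GT /eqP hG] xF xG k.
have [_ _ _ Fm] := headP kap lT T0 FT.
have [_ _ _ Gm] := headP kap lT T0 GT.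
apply/eqP; rewrite finset.eqEsubset.
have [h|h] := laminar_meet lT FT GT xF xG; rewrite h ?andbT /=.
  by rewrite hF in Fm; exact: Fm.
by rewrite hG in Gm; exact: Gm.
Qed.

(** The heads containing a point have distinct levels, hence a geometric sum. *)
Lemma heads_sum_at T kap x (s : R) k0 : 0 < s -> laminar T -> finset.set0 \notin T ->
  (forall F, F \in T -> x \in F -> kap F <= k0) ->
  \sum_(F in heads T kap | x \in F) 2 `^ (s * (kap F)%:~R) <=
  geoC s * 2 `^ (s * k0%:~R).
Proof.
move=> s0 lT T0 hk.
pose H := [set F in heads T kap | x \in F].
under eq_bigl => F do rewrite (_ : _ && _ = (F \in H)) ?[RHS]inE //.
rewrite -big_enum -(big_map kap xpredT (fun k => 2 `^ (s * k%:~R))).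
apply: geo_sum => //.
  rewrite map_inj_in_uniq ?enum_uniq // => F G; rewrite !mem_enum !inE.
  move=> /andP[/andP[FT hF] xF] /andP[/andP[GT hG] xG] k.
  by apply: (@heads_inj T kap F G x); rewrite ?inE ?FT ?GT.
move=> k /mapP[F]; rewrite mem_enum !inE => /andP[/andP[FT _] xF] ->.
exact: hk.
Qed.

(** The maximum of the densities over the ancestors of [P]; unlike the density
    itself it is monotone in [P], so that its levels have heads. *)
Definition amax T nu u P : R :=
  \big[Num.max/0]_(Q in T | P \subset Q) dens nu u Q.

Lemma dens_amax T nu u P : P \in T -> dens nu u P <= amax T nu u P.
Proof. by move=> PT; apply: (le_bigmax_cond 0); rewrite PT fintype.subxx. Qed.

Lemma amax_dyadic_max T nu u P x : x \in P -> amax T nu u P <= dyadic_max T nu u x.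
Proof.
move=> xP; apply/bigmax_leP; split=> [|Q /andP[QT PQ]]; first exact: dyadic_max_ge0.
by apply: dyadic_max_ge => //; exact: (fintype.subsetP PQ).
Qed.

Lemma amax_mono T nu u P Q : P \subset Q -> amax T nu u Q <= amax T nu u P.
Proof.
move=> PQ; apply/bigmax_leP; split=> [|A /andP[AT QA]]; first exact: bigmax_ge_id.
by apply: (le_bigmax_cond 0); rewrite AT (fintype.subset_trans PQ QA).
Qed.

Definition alev T nu u P := lev (amax T nu u P).

Lemma alev_mono T nu u : (forall P, P \in T -> 0 < dens nu u P) ->
  level_mono T (alev T nu u).
Proof.
move=> up P Q PT QT PQ; apply: lev_mono (amax_mono _ _ _ PQ).
exact: lt_le_trans (up _ QT) (dens_amax _ _ QT).
Qed.

(** At each point the heads contribute a geometric sum dominated by the maximal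
    function, to which Doob's inequality applies. *)
Lemma heads_sum T nu f (s : R) : 1 < s -> laminar T -> finset.set0 \notin T ->
  (forall x, 0 <= nu x) -> (forall x, 0 <= f x) ->
  (forall P, P \in T -> 0 < dens nu (fun x => f x * nu x) P) ->
  \sum_(F in heads T (alev T nu (fun x => f x * nu x)))
     2 `^ (s * (alev T nu (fun x => f x * nu x) F)%:~R) * mass nu F <=
  geoC s * doobC s * \sum_x nu x * f x `^ s.
Proof.
move=> s1 lT T0 nu0 f0 up; set u := (fun x => f x * nu x); set kap := alev T nu u.
have s0 : 0 < s by lra.
rewrite -mulrA; apply: le_trans (ler_wpM2l _ (doob lT nu0 f0 s1)); last first.
  by rewrite ltW // geoC_gt0.
rewrite mulr_sumr /mass.
under eq_bigr do rewrite mulr_sumr big_mkcond /=.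
rewrite exchange_big /=; apply: ler_sum => x _.
rewrite -big_mkcondr /= -mulr_suml mulrC mulrCA ler_wpM2l //.
have [/fintype.existsP[P0 /andP[P0T xP0]]|/fintype.existsPn h] := boolP [exists P, (P \in T) && (x \in P)]; last first.
  rewrite big1 ?mulr_ge0 ?powR_ge0 ?(ltW (geoC_gt0 s0)) // => P; rewrite inE.
  by move=> /andP[/andP[PT _] xP]; have := h P; rewrite PT xP.
have M0 : 0 < dyadic_max T nu u x.
  by apply: lt_le_trans (dyadic_max_ge _ _ P0T xP0); exact: up.
apply: le_trans (@heads_sum_at T kap x s (lev (dyadic_max T nu u x)) s0 lT T0 _) _.
  move=> F FT xF; apply: lev_mono (amax_dyadic_max _ _ _ xF).
  exact: lt_le_trans (up _ FT) (dens_amax _ _ FT).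
by rewrite ler_wpM2l ?(ltW (geoC_gt0 s0)) // lev_powR_le // ltW.
Qed.

End Heads.

Section Corona.
Context {R : realType} {X : finType}.
Implicit Types (m nu u f w : X -> R) (P Q F G : {set X}) (S T D : {set {set X}}).

Lemma sum_mass T (om : X -> R) (h : {set X} -> R) :
  \sum_x om x * \sum_(P in T | x \in P) h P = \sum_(P in T) h P * mass om P.
Proof.
under eq_bigr do rewrite big_mkcondr /= mulr_sumr.
rewrite exchange_big /=; apply: eq_bigr => P _.
rewrite /mass mulr_sumr [RHS]big_mkcond /=; apply: eq_bigr => x _.
by case: ifP; rewrite ?mulr0 // mulrC.
Qed.

(** One half of the parallel corona decomposition: the part of a bilinear sum
    over the members of [T] whose [kG]-head lies inside their [kF]-head. Grouping
    the members by their [kF]-head [F] freezes the factor [a]; the other factor is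
    replaced by its maximum [N F] on the group, and Young's inequality separates
    the two. A [kG]-head between a member and its [kF]-head determines that
    [kF]-head, so the [N F] are attained on disjoint groups of [kG]-heads and
    the sum of their powers is at most a sum over all [kG]-heads. *)
Lemma corona T (kF kG : {set X} -> int) (om : X -> R) (a e : int -> R)
    (c : {set X} -> R) (r s eta : R) :
  1 < r -> 1 < s -> r^-1 + s^-1 = 1 -> 0 < eta ->
  laminar T -> finset.set0 \notin T -> level_mono T kF -> level_mono T kG ->
  (forall x, 0 <= om x) -> (forall k, 0 <= a k) -> (forall k, 0 <= e k) ->
  (forall P, 0 <= c P) ->
  \sum_(P in T | headof T kG P \subset headof T kF P)
     a (kF P) * e (kG P) * c P * mass om P <=
  eta `^ (- (r - 1)) * \sum_(F in heads T kF) a (kF F) `^ r *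
     (\sum_x om x * (\sum_(P in cone T F | x \in P) c P) `^ r) +
  eta * \sum_(G in heads T kG) e (kG G) `^ s * mass om G.
Proof.
move=> r1 s1 rs eta0 lT T0 mF mG om0 a0 e0 c0.
pose T1 := [set P in T | headof T kG P \subset headof T kF P].
under eq_bigl => P do rewrite (_ : _ && _ = (P \in T1)) ?[RHS]inE //.
rewrite -sum_mass -sum_mass.
have T1T P : P \in T1 -> P \in T by rewrite inE => /andP[].
pose N F x := \big[Num.max/0]_(P in T1 | (x \in P) && (headof T kF P == F)) e (kG P).
have N0 F x : 0 <= N F x by rewrite bigmax_ge_id.
pose B F x := \sum_(P in cone T F | x \in P) c P.
have B0 F x : 0 <= B F x by exact: sumr_ge0.
have s0 : 0 < s by lra.
have pt x : \sum_(P in T1 | x \in P) a (kF P) * e (kG P) * c P <=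
    \sum_(F in heads T kF) (eta `^ (- (r - 1)) * (a (kF F) * B F x) `^ r + eta * N F x `^ s).
  rewrite (partition_big (headof T kF) (mem (heads T kF))) /=; last first.
    by move=> P /andP[/T1T PT _]; exact: head_heads.
  apply: ler_sum => F FH.
  apply: le_trans (young_eta s1 r1 _ eta0 (N0 F x) (mulr_ge0 (a0 _) (B0 F x))); last first.
    by rewrite addrC.
  rewrite mulrCA /B !mulr_sumr.
  apply: (@le_trans _ _ (\sum_(P in T1 | (x \in P) && (headof T kF P == F)) a (kF F) * (N F x * c P))).
    under eq_bigl do rewrite -andbA.
    apply: ler_sum => P /andP[PT1 /andP[xP hP]].
    have [_ _ <- _] := headP kF lT T0 (T1T _ PT1).
    rewrite (eqP hP) -mulrA ler_wpM2l // ler_wpM2r //.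
    by apply: (le_bigmax_cond 0); rewrite PT1 xP hP.
  apply: ler_sum_sub => P; last by rewrite !mulr_ge0.
  move=> /andP[PT1 /andP[-> /eqP <-]]; rewrite andbT inE (T1T _ PT1).
  by have [_ ->] := headP kF lT T0 (T1T _ PT1).
have ptN x : \sum_(F in heads T kF) N F x `^ s <=
    \sum_(G in heads T kG | x \in G) e (kG G) `^ s.
  have one F : F \in heads T kF -> N F x `^ s <=
      \sum_(G in heads T kG | (x \in G) && (headof T kF G == F)) e (kG G) `^ s.
    move=> FH; have [->|N_neq0] := eqVneq (N F x) 0.
      by rewrite powR0 ?gt_eqF // sumr_ge0 // => G _; rewrite powR_ge0.
    have Np : 0 < N F x by rewrite lt0r N_neq0 N0.
    have [|[P /andP[PT1 /andP[xP /eqP hP]] NP]] := bigmax_geP _ _ _ _ (lexx (N F x)).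
      by rewrite leNgt Np.
    have PT := T1T _ PT1.
    have [GT PG kGG _] := headP kG lT T0 PT.
    have GF : headof T kG P \subset headof T kF P by move: PT1; rewrite inE => /andP[].
    have [_ hG] := head_between lT T0 mF PT GT PG GF.
    apply: (@le_trans _ _ (e (kG (headof T kG P)) `^ s)).
      by apply: powR_le; rewrite ?kGG ?(ltW s0).
    rewrite (bigD1 (headof T kG P)) /=.
      by rewrite lerDl sumr_ge0 // => G _; rewrite powR_ge0.
    by rewrite head_heads // hG hP eqxx (fintype.subsetP PG).
  apply: le_trans (ler_sum _ one) _.
  rewrite [leRHS](partition_big (headof T kF) (mem (heads T kF))) /=; last first.
    by move=> G /andP[]; rewrite inE => /andP[GT _] _; exact: head_heads.
  by apply: ler_sum => F _; under eq_bigl do rewrite andbA.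
have -> : \sum_(F in heads T kF) a (kF F) `^ r * \sum_x om x * B F x `^ r =
    \sum_x om x * \sum_(F in heads T kF) (a (kF F) * B F x) `^ r.
  under eq_bigr do rewrite mulr_sumr.
  rewrite exchange_big /=; apply: eq_bigr => x _; rewrite mulr_sumr.
  by apply: eq_bigr => F _; rewrite powRM // mulrCA.
rewrite !mulr_sumr -big_split /=; apply: ler_sum => x _.
rewrite [X in _ <= X + _]mulrCA [X in _ <= _ + X]mulrCA -mulrDr ler_wpM2l //.
apply: le_trans (pt x) _; rewrite big_split /= -!mulr_sumr lerD2l.
by rewrite ler_wpM2l // ltW.
Qed.

End Corona.

(** * Strong bounds for the sparse operator *)

Section Sparse_operator.
Context {R : realType} {X : finType}.
Implicit Types (P Q F G : {set X}) (S T D : {set {set X}}).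

Definition sparse_op (m u : X -> R) T (q : R) x : R :=
  \sum_(P in T | x \in P) dens m u P `^ q.

Definition gtC1 (p q : R) : R := geoC (p / (p - q)) * doobC (p / (p - q)).
Definition gtC2 (p q : R) : R := powC ((p - q) / (p - 1)) (p - 1)^-1 + 1.
Definition gtC3 (p q : R) : R := 2 * 2 `^ q.
Definition gtC p q : R :=
  2 * gtC3 p q * (geoC p * doobC p) *
  ((4 * gtC3 p q * gtC1 p q) `^ (p / q - 1) * powC q (p - 1) +
   (4 * gtC3 p q * gtC1 p q * gtC2 p q) `^ (p / q - 1)).

(** The integral [I] on the left is a bilinear sum of the sigma-averages of [Phi] and
    the w-averages of [g = U ^ (p/q - 1)]; note that g^(r') w integrates to [I] for the
    exponent [r'] conjugate to [p/q]. The two halves given by [corona] are tested by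
    [test1], which costs [K], and by [test2], which costs [W]; the coefficients
    [eta] and [eta2] of Young's inequality are chosen so that [I] comes back with a
    total factor of one half. *)
Lemma sparse_op_strong_gt (m w sigma Phi : X -> R) T (A K W p q : R) :
  1 < q -> q < p -> 0 < A -> 0 <= K -> 1 <= W ->
  laminar T -> finset.set0 \notin T ->
  (forall x, 0 < m x) -> (forall x, 0 <= w x) ->
  (forall x, 0 <= sigma x) -> (forall x, 0 <= Phi x) -> sparse m T ->
  (forall P, P \in T -> dens m w P * dens m sigma P `^ (p - 1) <= A) ->
  (forall P, P \in T -> \sum_(Q in cone T P) mass sigma Q <= K * mass sigma P) ->
  (forall P, P \in T -> \sum_(Q in cone T P) mass w Q <= W * mass w P) ->
  (forall P, P \in T -> 0 < mass (fun x => Phi x * sigma x) P) ->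
  (forall P, P \in T -> 0 < mass w P) ->
  \sum_x w x * sparse_op m (fun x => Phi x * sigma x) T q x `^ (p / q) <=
  gtC p q * A * (K + W `^ (p / q - 1)) * \sum_x sigma x * Phi x `^ p.
Proof.
move=> q1 qp A0 K0 W1 lT T0 m0 w0 s0 P0 sT hA hK hW psiP wP.
set psi := (fun x => Phi x * sigma x).
have psi0 x : 0 <= psi x by exact: mulr_ge0.
have m0' x : 0 <= m x by exact: ltW.
have p1 : 1 < p by exact: lt_trans qp.
have q0 : 0 < q by exact: lt_trans q1.
have p10 : 0 < p - 1 by rewrite subr_gt0.
have pq0 : 0 < p - q by rewrite subr_gt0.
have nempty P : P \in T -> exists x, x \in P.
  move=> PT; have [Pz|[x xP]] := finset.set_0Vmem P; last by exists x.
  by move/negP : T0; rewrite -Pz.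
have mP P : P \in T -> 0 < mass m P.
  move=> /nempty[x xP]; rewrite /mass (bigD1 x) //= ltr_pwDl // sumr_ge0 //.
have sP P : P \in T -> 0 < mass sigma P.
  move=> PT; rewrite lt0r mass_ge0 // andbT; apply/eqP => sP.
  have := psiP _ PT; rewrite /mass big1 ?ltxx // => x xP.
  suff -> : sigma x = 0 by rewrite mulr0.
  apply/eqP; rewrite eq_le s0 andbT -sP /mass (bigD1 x) //= lerDl.
  exact: sumr_ge0.
pose r := p / q; pose r' := p / (p - q).
have r1 : 1 < r by rewrite /r ltr_pdivlMr ?mul1r //; lra.
have r'1 : 1 < r' by rewrite /r' ltr_pdivlMr ?mul1r //; lra.
have rr : r^-1 + r'^-1 = 1 by rewrite /r /r' !invf_div; field; lra.
have rr' : r'^-1 + r^-1 = 1 by rewrite addrC.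
pose U := sparse_op m psi T q.
have U0 x : 0 <= U x by apply: sumr_ge0 => P _; rewrite powR_ge0.
pose g x := U x `^ (r - 1).
have g0 x : 0 <= g x by rewrite powR_ge0.
pose I := \sum_x w x * U x `^ r.
have I0 : 0 <= I by apply: sumr_ge0 => x _; rewrite mulr_ge0 ?powR_ge0.
pose E := \sum_x sigma x * Phi x `^ p.
have E0 : 0 <= E by apply: sumr_ge0 => x _; rewrite mulr_ge0 ?powR_ge0.
rewrite -/(sparse_op _ _ _ _) -/E.
change (I <= gtC p q * A * (K + W `^ (r - 1)) * E).
pose gw x := g x * w x.
have gw0 x : 0 <= gw x by exact: mulr_ge0.
have gwP P : P \in T -> 0 < dens w gw P.
  move=> PT; rewrite divr_gt0 ?wP // lt0r mass_ge0 => [|x]; last by rewrite mulr_ge0.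
  rewrite andbT; apply/eqP => gwz; have := wP _ PT; rewrite /mass big1 ?ltxx // => x xP.
  have gx : 0 < g x.
    rewrite powR_gt0 // /U /sparse_op (bigD1 P) ?PT //= ltr_pwDl //.
      by rewrite powR_gt0 // divr_gt0 ?psiP ?mP.
    by apply: sumr_ge0 => Q _; rewrite powR_ge0.
  have /eqP : gw x = 0.
    apply/eqP; rewrite eq_le mulr_ge0 // andbT -gwz /mass (bigD1 x) //= lerDl.
    by apply: sumr_ge0 => y _; rewrite mulr_ge0.
  by rewrite mulf_eq0 (gt_eqF gx) => /eqP.
have phP P : P \in T -> 0 < dens sigma psi P by move=> PT; rewrite divr_gt0 ?psiP ?sP.
pose kF := alev T sigma psi; pose kG := alev T w gw.
have mF : level_mono T kF by exact: alev_mono.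
have mG : level_mono T kG by exact: alev_mono.
pose p2 (k : int) : R := 2 `^ k%:~R.
have p20 k : 0 <= p2 k by exact: powR_ge0.
have kF_gt P : P \in T -> dens sigma psi P <= 2 * p2 (kF P).
  move=> PT; apply: le_trans (dens_amax _ _ PT) _; rewrite ltW // lev_gt //.
  exact: lt_le_trans (phP _ PT) (dens_amax _ _ PT).
have kG_gt P : P \in T -> dens w gw P <= 2 * p2 (kG P).
  move=> PT; apply: le_trans (dens_amax _ _ PT) _; rewrite ltW // lev_gt //.
  exact: lt_le_trans (gwP _ PT) (dens_amax _ _ PT).
pose a (k : int) : R := 2 `^ (q * k%:~R).
have a0 k : 0 <= a k by exact: powR_ge0.
(* [c1] and [c2] are the coefficient of [P] relative to [w] and to [sigma]:
   c1 P * mass w P = c2 P * mass sigma P. *)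
pose c1 P := dens m sigma P `^ q.
pose c2 P := dens m sigma P `^ (q - 1) * dens m w P.
have c10 P : 0 <= c1 P by exact: powR_ge0.
have c20 P : 0 <= c2 P by rewrite mulr_ge0 ?powR_ge0 ?dens_ge0.
have Igw : I = \sum_(P in T) dens m psi P `^ q * mass gw P.
  rewrite -sum_mass; apply: eq_bigr => x _.
  rewrite -/(sparse_op _ _ _ _ x) -/(U x) /gw /g.
  by rewrite -(@mulr_powRB1 _ (U x) r) //; [ring|lra].
have Ile : I <= gtC3 p q * (\sum_(P in T) a (kF P) * p2 (kG P) * c1 P * mass w P).
  rewrite Igw mulr_sumr; apply: ler_sum => P PT.
  have -> : dens m psi P = dens sigma psi P * dens m sigma P.
    by rewrite /dens; field; rewrite ?gt_eqF ?sP ?mP.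
  rewrite -(densK gw (wP _ PT)) powRM ?dens_ge0 //.
  have h1 : dens sigma psi P `^ q <= 2 `^ q * a (kF P).
    rewrite /a [q * _]mulrC powRrM -powRM ?powR_ge0 //.
    by apply: powR_le; [lra|exact: dens_ge0|exact: kF_gt].
  rewrite /gtC3 /c1.
  apply: (@le_trans _ _ ((2 `^ q * a (kF P)) * dens m sigma P `^ q * (2 * p2 (kG P) * mass w P))).
    apply: ler_pM.
    - by rewrite mulr_ge0 ?powR_ge0.
    - by apply: mulr_ge0; [exact: dens_ge0|exact: mass_ge0].
    - by rewrite ler_wpM2r ?powR_ge0.
    - by rewrite ler_wpM2r ?mass_ge0 // kG_gt.
  by rewrite le_eqVlt; apply/orP; left; apply/eqP; ring.
have split : \sum_(P in T) a (kF P) * p2 (kG P) * c1 P * mass w P <=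
    \sum_(P in T | headof T kG P \subset headof T kF P) a (kF P) * p2 (kG P) * c1 P * mass w P +
    \sum_(P in T | headof T kF P \subset headof T kG P) p2 (kG P) * a (kF P) * c2 P * mass sigma P.
  rewrite (bigID (fun P => headof T kG P \subset headof T kF P)) /= lerD2l.
  apply: (@le_trans _ _ (\sum_(P in T | headof T kF P \subset headof T kG P) a (kF P) * p2 (kG P) * c1 P * mass w P)).
    apply: ler_sum_sub => [P /andP[PT h]|P _]; last by rewrite !mulr_ge0 ?mass_ge0.
    rewrite PT; have [x xP] := nempty _ PT.
    have [FT PF _ _] := headP kF lT T0 PT; have [GT PG _ _] := headP kG lT T0 PT.
    have [//|h'] := laminar_meet lT FT GT (fintype.subsetP PF _ xP) (fintype.subsetP PG _ xP).
    by rewrite h' in h.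
  apply: ler_sum => P /andP[PT _].
  rewrite /c1 /c2 -(densE w P m0) -(densE sigma P m0).
  rewrite -(@mulr_powRB1 _ (dens m sigma P) q) ?dens_ge0 //.
  by rewrite le_eqVlt; apply/orP; left; apply/eqP; ring.
pose C1 := gtC1 p q; pose C2 := gtC2 p q; pose C3 := gtC3 p q.
have C1p : 0 < C1 by rewrite mulr_gt0 ?doobC_gt0 ?geoC_gt0 //; rewrite -/r'; lra.
have C2p : 0 < C2 by rewrite ltr_wpDl // powC_ge0.
have C3p : 0 < C3 by rewrite mulr_gt0 ?pow2_gt0.
have C0p : 0 < geoC p * doobC p by rewrite mulr_gt0 ?doobC_gt0 ?geoC_gt0 //; lra.
pose C0 := geoC p * doobC p; rewrite -/C0 in C0p.
pose D := powC q (p - 1); have D0 : 0 <= D by exact: powC_ge0.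
have W0 : 0 < W by lra.
have hsF : \sum_(F in heads T kF) a (kF F) `^ r * mass sigma F <= C0 * E.
  apply: le_trans (heads_sum p1 lT T0 s0 P0 phP).
  rewrite le_eqVlt; apply/orP; left; apply/eqP; apply: eq_bigr => F _.
  rewrite /a -powRrM (_ : q * (kF F)%:~R * r = p * (kF F)%:~R) //.
  by rewrite /r; field; lra.
have hsG : \sum_(G in heads T kG) p2 (kG G) `^ r' * mass w G <= C1 * I.
  have := heads_sum r'1 lT T0 w0 g0 gwP.
  have -> : \sum_x w x * g x `^ r' = I.
    apply: eq_bigr => x _; rewrite /g -powRrM; congr (_ * _ `^ _).
    by rewrite /r /r'; field; lra.
  apply: le_trans; rewrite le_eqVlt; apply/orP; left; apply/eqP; apply: eq_bigr => G _.
  by rewrite /p2 -powRrM [r' * _]mulrC.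
have sp P : P \in T -> 0 < dens m sigma P by move=> PT; rewrite divr_gt0 ?sP ?mP.
have wp P : P \in T -> 0 < dens m w P by move=> PT; rewrite divr_gt0 ?wP ?mP.
have coneT P Q : Q \in cone T P -> Q \in T by rewrite inE => /andP[].
have test1 F : F \in T -> \sum_x w x * (\sum_(P in cone T F | x \in P) c1 P) `^ r <=
    D * A * (K * mass sigma F).
  move=> FT; apply: (@le_trans _ _ (D * A * \sum_(P in cone T F) mass sigma P)); last first.
    by rewrite ler_wpM2l ?hK // mulr_ge0 // ltW.
  have -> : r = (p - 1 + 1) / q by rewrite subrK.
  apply: (sparse_power_sum q0 p10 (ltW A0) (laminar_sub (cone_sub T F) lT)
    m0 w0 s0 (sparse_sub m0' (cone_sub T F) sT)).
  - by move=> P /coneT /sp.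
  - move=> P /coneT PT; rewrite -(densE w P m0) ler_wpM2r ?mass_ge0 //.
    by rewrite powRN -ler_pdivrMr ?powR_gt0 ?invr_gt0 ?powR_gt0 ?sp // invrK hA.
(* The A_p condition removes [sigma] from [c2]: with the exponent [al], the power
   q - 1 of its density is a power of the A_p product. *)
pose al := (q - 1) / (p - 1).
have test2 G : G \in T -> \sum_x sigma x * (\sum_(P in cone T G | x \in P) c2 P) `^ r' <=
    C2 * A `^ (r' / r) * (W * mass w G).
  move=> GT.
  pose b := (p - q) / (p - 1).
  have b0 : 0 < b by rewrite divr_gt0.
  have c2b P : P \in T -> c2 P <= A `^ al * dens m w P `^ b.
    move=> PT; apply: (@le_trans _ _ ((dens m w P * dens m sigma P `^ (p - 1)) `^ al * dens m w P `^ b)).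
      rewrite powRM ?powR_ge0 ?dens_ge0 // -powRrM.
      have -> : (p - 1) * al = q - 1 by rewrite /al; field; lra.
      rewrite mulrAC -powRD ?(gt_eqF (wp _ PT)) ?implybT //.
      have -> : al + b = 1 by rewrite /al /b; field; lra.
      by rewrite powRr1 ?dens_ge0 // mulrC.
    rewrite ler_wpM2r ?powR_ge0 //; apply: powR_le; last exact: hA.
      by rewrite divr_ge0 // ltW // subr_gt0.
    by rewrite mulr_ge0 ?powR_ge0 ?dens_ge0.
  apply: (@le_trans _ _ (A `^ (al * r') * \sum_x sigma x * (\sum_(P in cone T G | x \in P) dens m w P `^ b) `^ r')).
    rewrite [leRHS]mulr_sumr; apply: ler_sum => x _; rewrite mulrCA ler_wpM2l //.
    rewrite powRrM -powRM ?powR_ge0 //; last by apply: sumr_ge0 => P _; exact: powR_ge0.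
    apply: powR_le; [lra|by apply: sumr_ge0|].
    by rewrite mulr_sumr; apply: ler_sum => P /andP[/coneT PT _]; exact: c2b.
  have -> : r' / r = al * r' + (p - 1)^-1.
    by rewrite /r /r' /al; field; lra.
  rewrite powRD ?(gt_eqF A0) ?implybT //.
  have -> : C2 * (A `^ (al * r') * A `^ (p - 1)^-1) * (W * mass w G) =
     A `^ (al * r') * (C2 * A `^ (p - 1)^-1 * (W * mass w G)) by ring.
  rewrite ler_wpM2l ?powR_ge0 //.
  apply: (@le_trans _ _ (powC b (p - 1)^-1 * A `^ (p - 1)^-1 * \sum_(P in cone T G) mass w P)); last first.
    apply: ler_pM; rewrite ?mulr_ge0 ?powC_ge0 ?powR_ge0 ?hW //.
      by apply: sumr_ge0 => P _; exact: mass_ge0.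
    by rewrite ler_wpM2r ?powR_ge0 // lerDl.
  have -> : r' = ((p - 1)^-1 + 1) / b by rewrite /r' /b; field; lra.
  have p1V : 0 < (p - 1)^-1 by rewrite invr_gt0.
  apply: (sparse_power_sum b0 p1V (powR_ge0 _ _) (laminar_sub (cone_sub T G) lT)
    m0 s0 w0 (sparse_sub m0' (cone_sub T G) sT)).
  - by move=> P /coneT /wp.
  - move=> P /coneT PT; rewrite -(densE sigma P m0) ler_wpM2r ?mass_ge0 //.
    rewrite powRN -ler_pdivrMr ?invr_gt0 ?powR_gt0 ?wp // invrK.
    rewrite -[X in X * _](@powRK _ _ (p - 1)) ?dens_ge0 ?gt_eqF //.
    rewrite -powRM ?powR_ge0 ?dens_ge0 // mulrC; apply: powR_le; last exact: hA.
      by rewrite invr_ge0 ltW.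
    by rewrite mulr_ge0 ?powR_ge0 ?dens_ge0.
rewrite -/C3 in Ile; rewrite /gtC -/C1 -/C2 -/C3 -/C0 -/D -/r.
clearbody C1 C2 C3 C0 D.
pose eta := (4 * C3 * C1)^-1.
have CC : 0 < 4 * C3 * C1 by rewrite !mulr_gt0.
have eta0 : 0 < eta by rewrite invr_gt0.
have T1le : \sum_(P in T | headof T kG P \subset headof T kF P) a (kF P) * p2 (kG P) * c1 P * mass w P <=
    (4 * C3 * C1) `^ (r - 1) * (D * A * K * (C0 * E)) + eta * (C1 * I).
  apply: le_trans (corona r1 r'1 rr eta0 lT T0 mF mG w0 a0 p20 c10) _.
  apply: lerD; last by rewrite ler_wpM2l // ltW.
  rewrite /eta -powR_inv1 ?(ltW CC) // -powRrM mulN1r opprK ler_wpM2l ?powR_ge0 //.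
  apply: (@le_trans _ _ (D * A * K * \sum_(F in heads T kF) a (kF F) `^ r * mass sigma F)).
    rewrite mulr_sumr; apply: ler_sum => F; rewrite inE => /andP[FT _].
    by rewrite [leRHS]mulrCA ler_wpM2l ?powR_ge0 // -[leRHS]mulrA test1.
  by rewrite ler_wpM2l // !mulr_ge0 // ltW.
pose kk := 4 * C3 * C1 * C2 * (A `^ (r' / r) * W).
have Ap : 0 < A `^ (r' / r) by rewrite powR_gt0.
have kk0 : 0 < kk by rewrite !mulr_gt0.
pose eta2 := kk `^ (r - 1).
have eta20 : 0 < eta2 by rewrite powR_gt0.
have e2 : eta2 `^ (- (r' - 1)) = kk^-1.
  rewrite /eta2 -powRrM -powR_inv1 ?(ltW kk0) //; congr (_ `^ _).
  by rewrite /r /r'; field; lra.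
have e3 : eta2 = (4 * C3 * C1 * C2) `^ (r - 1) * (A * W `^ (r - 1)).
  have h : 0 <= 4 * C3 * C1 * C2 by rewrite ltW // !mulr_gt0.
  have h' : 0 <= A `^ (r' / r) * W by rewrite mulr_ge0 // ltW.
  rewrite /eta2 /kk (powRM _ h h'); congr (_ * _).
  rewrite powRM ?powR_ge0 ?(ltW W0) // -powRrM.
  have -> : r' / r * (r - 1) = 1 by rewrite /r /r'; field; lra.
  by rewrite powRr1 // ltW.
have T2le : \sum_(P in T | headof T kF P \subset headof T kG P) p2 (kG P) * a (kF P) * c2 P * mass sigma P <=
    kk^-1 * (C2 * A `^ (r' / r) * W * (C1 * I)) + eta2 * (C0 * E).
  apply: le_trans (corona r'1 r1 rr' eta20 lT T0 mG mF s0 p20 a0 c20) _.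
  apply: lerD; last by rewrite ler_wpM2l // ltW.
  rewrite e2 ler_wpM2l ?invr_ge0 ?(ltW kk0) //.
  apply: (@le_trans _ _ (C2 * A `^ (r' / r) * W * \sum_(G in heads T kG) p2 (kG G) `^ r' * mass w G)).
    rewrite mulr_sumr; apply: ler_sum => G; rewrite inE => /andP[GT _].
    by rewrite [leRHS]mulrCA ler_wpM2l ?powR_ge0 // -[leRHS]mulrA test2.
  by rewrite ler_wpM2l // !mulr_ge0 // ltW.
have e4 : kk^-1 * (C2 * A `^ (r' / r) * W * (C1 * I)) = I / (4 * C3).
  by rewrite /kk; field; rewrite !gt_eqF.
have e5 : eta * (C1 * I) = I / (4 * C3) by rewrite /eta; field; rewrite !gt_eqF.
rewrite e4 e3 in T2le; rewrite e5 in T1le.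
have {Ile split T1le T2le} h : I <= C3 * ((4 * C3 * C1) `^ (r - 1) * (D * A * K * (C0 * E)) +
   (4 * C3 * C1 * C2) `^ (r - 1) * (A * W `^ (r - 1)) * (C0 * E)) + I / 2.
  apply: le_trans Ile _; apply: le_trans (ler_wpM2l (ltW C3p) (le_trans split (lerD T1le T2le))) _.
  by rewrite le_eqVlt; apply/orP; left; apply/eqP; field; rewrite !gt_eqF.
move: h; set x := _ `^ (r - 1); set y := (4 * C3 * C1 * C2) `^ (r - 1); set z := W `^ _ => h.
have x0 : 0 <= x by exact: powR_ge0.
have y0 : 0 <= y by exact: powR_ge0.
have z0 : 0 <= z by exact: powR_ge0.
have {}h : I <= 2 * C3 * C0 * A * E * (x * D * K + y * z) by lra.
apply: le_trans h _.
have -> : 2 * C3 * C0 * (x * D + y) * A * (K + z) * E =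
  2 * C3 * C0 * A * E * ((x * D + y) * (K + z)) by ring.
rewrite ler_wpM2l //; first by rewrite !mulr_ge0 // ltW.
have xD : 0 <= x * D by exact: mulr_ge0.
nra.
Qed.

End Sparse_operator.

Section Sparse_operator_bounds.
Context {R : realType} {X : finType}.
Implicit Types (P Q F G : {set X}) (S T D : {set {set X}}).

Lemma mass_gt0 (nu : X -> R) P x : (forall x, 0 <= nu x) -> x \in P -> 0 < nu x ->
  0 < mass nu P.
Proof.
by move=> nu0 xP nux; rewrite /mass (bigD1 x) //= ltr_pwDl // sumr_ge0.
Qed.

Lemma mass_eq0 (nu : X -> R) P x : (forall x, 0 <= nu x) -> x \in P ->
  mass nu P = 0 -> nu x = 0.
Proof.
move=> nu0 xP e; apply/eqP; rewrite eq_le nu0 andbT leNgt; apply/negP => h.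
by have := mass_gt0 nu0 xP h; rewrite e ltxx.
Qed.

(** Since [p <= q], the power [p/q] may be moved inside the sum; then the
    condition A_p gives (sigma-average of Phi)^p sigma(P), and the Carleson
    condition for [sigma] is summed over the members below each head. *)
Lemma sparse_op_strong_le (m w sigma Phi : X -> R) T (A K p q : R) :
  1 < p -> p <= q -> 0 <= A -> 0 <= K ->
  laminar T -> finset.set0 \notin T ->
  (forall x, 0 < m x) -> (forall x, 0 <= w x) ->
  (forall x, 0 <= sigma x) -> (forall x, 0 <= Phi x) ->
  (forall P, P \in T -> dens m w P * dens m sigma P `^ (p - 1) <= A) ->
  (forall P, P \in T -> \sum_(Q in cone T P) mass sigma Q <= K * mass sigma P) ->
  (forall P, P \in T -> 0 < mass (fun x => Phi x * sigma x) P) ->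
  \sum_x w x * sparse_op m (fun x => Phi x * sigma x) T q x `^ (p / q) <=
  2 `^ p * (geoC p * doobC p) * A * K * \sum_x sigma x * Phi x `^ p.
Proof.
move=> p1 pq A0 K0 lT T0 m0 w0 s0 P0 hA hK psiP.
set psi := (fun x => Phi x * sigma x).
have p0 : 0 < p by exact: lt_trans p1.
have q0 : 0 < q by exact: lt_le_trans pq.
have psi0 x : 0 <= psi x by exact: mulr_ge0.
have m0' x : 0 <= m x by exact: ltW.
have sP P : P \in T -> 0 < mass sigma P.
  move=> PT; rewrite lt0r mass_ge0 // andbT; apply/eqP => sP.
  have := psiP _ PT; rewrite /mass big1 ?ltxx // => x xP.
  by rewrite (mass_eq0 s0 xP sP) mulr0.
have phP P : P \in T -> 0 < dens sigma psi P by move=> PT; rewrite divr_gt0 ?psiP ?sP.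
have mP P : P \in T -> 0 < mass m P.
  move=> PT; have [Pz|[x xP]] := finset.set_0Vmem P; last exact: mass_gt0 xP _.
  by move/negP : T0; rewrite -Pz.
pose kF := alev T sigma psi.
have mF : level_mono T kF by exact: alev_mono.
apply: (@le_trans _ _ (\sum_(P in T) dens m psi P `^ p * mass w P)).
  rewrite -sum_mass; apply: ler_sum => x _; rewrite ler_wpM2l //.
  apply: le_trans (powR_sum_le _ _ _ _ _) _.
  - by rewrite divr_gt0.
  - by rewrite ler_pdivrMr // mul1r.
  - by move=> P; exact: powR_ge0.
  rewrite le_eqVlt; apply/orP; left; apply/eqP; apply: eq_bigr => P _.
  by rewrite -powRrM mulrC divfK // gt_eqF.
apply: (@le_trans _ _ (\sum_(P in T) A * 2 `^ p * (2 `^ (p * (kF P)%:~R) * mass sigma P))).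
  apply: ler_sum => P PT.
  have -> : dens m psi P = dens sigma psi P * dens m sigma P.
    by rewrite /dens; field; rewrite ?gt_eqF ?sP ?mP.
  have h1 : dens sigma psi P `^ p <= 2 `^ p * 2 `^ (p * (kF P)%:~R).
    rewrite [p * _]mulrC powRrM -powRM ?powR_ge0 //.
    apply: powR_le; [exact: ltW|exact: dens_ge0|].
    apply: le_trans (dens_amax _ _ PT) _; rewrite ltW // lev_gt //.
    exact: lt_le_trans (phP _ PT) (dens_amax _ _ PT).
  rewrite powRM ?dens_ge0 // -(densE w P m0) -(densE sigma P m0).
  rewrite -(@mulr_powRB1 _ (dens m sigma P) p) ?dens_ge0 //.
  have -> : dens sigma psi P `^ p * (dens m sigma P * dens m sigma P `^ (p - 1)) * (dens m w P * mass m P) =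
    dens sigma psi P `^ p * (dens m w P * dens m sigma P `^ (p - 1)) * (dens m sigma P * mass m P) by ring.
  have -> : A * 2 `^ p * (2 `^ (p * (kF P)%:~R) * (dens m sigma P * mass m P)) =
     (2 `^ p * 2 `^ (p * (kF P)%:~R)) * A * (dens m sigma P * mass m P) by ring.
  rewrite ler_wpM2r //; first by apply: mulr_ge0; [exact: dens_ge0|exact: mass_ge0].
  apply: ler_pM => //; first exact: powR_ge0.
    by apply: mulr_ge0; [exact: dens_ge0|exact: powR_ge0].
  exact: hA.
rewrite -mulr_sumr.
have -> : 2 `^ p * (geoC p * doobC p) * A * K * (\sum_x sigma x * Phi x `^ p) =
  A * 2 `^ p * (K * (geoC p * doobC p * \sum_x sigma x * Phi x `^ p)) by ring.
rewrite ler_wpM2l ?mulr_ge0 ?powR_ge0 //.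
apply: le_trans (ler_wpM2l K0 (heads_sum p1 lT T0 s0 P0 phP)).
rewrite (partition_big (headof T kF) (mem (heads T kF))) /=; last first.
  by move=> P PT; exact: head_heads.
rewrite mulr_sumr; apply: ler_sum => F; rewrite inE => /andP[FT _].
rewrite mulrCA; apply: (@le_trans _ _ (2 `^ (p * (kF F)%:~R) * \sum_(P in cone T F) mass sigma P)); last first.
  by rewrite ler_wpM2l ?powR_ge0 // hK.
rewrite mulr_sumr.
apply: (@le_trans _ _ (\sum_(P in T | headof T kF P == F) 2 `^ (p * (kF F)%:~R) * mass sigma P)).
  apply: ler_sum => P /andP[PT /eqP <-].
  by have [_ _ -> _] := headP kF lT T0 PT.
apply: ler_sum_sub => P; last by rewrite mulr_ge0 ?powR_ge0 ?mass_ge0.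
move=> /andP[PT /eqP <-]; rewrite inE PT.
by have [_ ->] := headP kF lT T0 PT.
Qed.

(** On the members without mass of [u] or of [w], the sparse operator
    contributes nothing w-almost everywhere; removing them makes all averages
    positive, as the dyadic levels require. *)
Definition posfam (u w : X -> R) T := [set P in T | (0 < mass u P) && (0 < mass w P)].

Lemma posfam_sub u w T : posfam u w T \subset T.
Proof. by apply/fintype.subsetP => P; rewrite inE => /andP[]. Qed.

Lemma sparse_op_posfam (m u w : X -> R) T q x : 0 < q -> (forall x, 0 <= u x) ->
  (forall x, 0 <= w x) -> 0 < w x ->
  sparse_op m u T q x = sparse_op m u (posfam u w T) q x.
Proof.
move=> q0 u0 w0 wx; rewrite /sparse_op (bigID (fun P => 0 < mass u P)) /=.
rewrite [X in _ + X]big1 ?addr0 => [|P /andP[_]].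
  apply: eq_bigl => P; rewrite inE; case: (boolP (x \in P)) => xP; rewrite ?andbF //.
  by rewrite (mass_gt0 w0 xP wx) !andbT.
rewrite lt0r mass_ge0 // andbT negbK => /eqP uP.
by rewrite /dens uP mul0r powR0 // gt_eqF.
Qed.

Lemma cone_mono S T P : S \subset T -> cone S P \subset cone T P.
Proof.
move=> /fintype.subsetP ST; apply/fintype.subsetP => Q; rewrite !inE.
by move=> /andP[/ST -> ->].
Qed.

Lemma geoC_doobC_ge0 p : 1 < p -> 0 <= geoC p * doobC p :> R.
Proof.
by move=> p1; rewrite ltW // mulr_gt0 ?geoC_gt0 ?doobC_gt0 // (lt_trans ltr01).
Qed.

Lemma gtC_ge0 p q : 1 < q -> q < p -> 0 <= gtC p q :> R.
Proof.
move=> q1 qp; have p1 : 1 < p := lt_trans q1 qp.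
have p0 : 0 < p := lt_trans ltr01 p1.
rewrite /gtC mulr_ge0 //; last by rewrite addr_ge0 ?mulr_ge0 ?powR_ge0 ?powC_ge0.
rewrite mulr_ge0 //; first by rewrite /gtC3 !mulr_ge0 ?powR_ge0.
by rewrite mulr_ge0 // ltW ?geoC_gt0 ?doobC_gt0.
Qed.

Lemma sparse_op_strong (m w sigma Phi : X -> R) T (A K W p q : R) :
  1 < p -> 1 < q -> 0 <= A -> 0 <= K -> 1 <= W ->
  laminar T -> finset.set0 \notin T ->
  (forall x, 0 < m x) -> (forall x, 0 <= w x) ->
  (forall x, 0 <= sigma x) -> (forall x, 0 <= Phi x) -> sparse m T ->
  (forall P, P \in T -> dens m w P * dens m sigma P `^ (p - 1) <= A) ->
  (forall P, P \in T -> \sum_(Q in cone T P) mass sigma Q <= K * mass sigma P) ->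
  (forall P, P \in T -> \sum_(Q in cone T P) mass w Q <= W * mass w P) ->
  \sum_x w x * sparse_op m (fun x => Phi x * sigma x) T q x `^ (p / q) <=
  Num.max (gtC p q) (2 `^ p * (geoC p * doobC p)) * A *
    (K + W `^ Num.max (p / q - 1) 0) * \sum_x sigma x * Phi x `^ p.
Proof.
move=> p1 q1 A0 K0 W1 lT T0 m0 w0 s0 P0 sT hA hK hW.
set psi := (fun x => Phi x * sigma x).
have p0 : 0 < p by exact: lt_trans p1.
have q0 : 0 < q by exact: lt_trans q1.
have psi0 x : 0 <= psi x by exact: mulr_ge0.
have m0' x : 0 <= m x by exact: ltW.
pose S := posfam psi w T.
have ST : S \subset T by exact: posfam_sub.
have ST' P : P \in S -> P \in T by exact: (fintype.subsetP ST).
have S0 : finset.set0 \notin S by apply: contra T0; exact: ST'.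
have lS : laminar S := laminar_sub ST lT.
have sS : sparse m S := sparse_sub m0' ST sT.
have -> : \sum_x w x * sparse_op m psi T q x `^ (p / q) =
    \sum_x w x * sparse_op m psi S q x `^ (p / q).
  apply: eq_bigr => x _; have [->|wx] := eqVneq (w x) 0; first by rewrite !mul0r.
  by rewrite -sparse_op_posfam // lt0r wx w0.
have E0 : 0 <= \sum_x sigma x * Phi x `^ p.
  by apply: sumr_ge0 => x _; rewrite mulr_ge0 ?powR_ge0.
have hK' P : P \in S -> \sum_(Q in cone S P) mass sigma Q <= K * mass sigma P.
  move=> /ST' PT; apply: le_trans (hK _ PT).
  by apply: ler_sum_sub => Q; rewrite ?mass_ge0 //; apply/fintype.subsetP/cone_mono.
have hW' P : P \in S -> \sum_(Q in cone S P) mass w Q <= W * mass w P.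
  move=> /ST' PT; apply: le_trans (hW _ PT).
  by apply: ler_sum_sub => Q; rewrite ?mass_ge0 //; apply/fintype.subsetP/cone_mono.
have hA' P : P \in S -> dens m w P * dens m sigma P `^ (p - 1) <= A by move/ST'/hA.
have psiP P : P \in S -> 0 < mass psi P by rewrite inE => /and3P[].
have wP P : P \in S -> 0 < mass w P by rewrite inE => /and3P[].
have W0 : 0 <= W `^ Num.max (p / q - 1) 0 by exact: powR_ge0.
have C0 : 0 <= 2 `^ p * (geoC p * doobC p).
  by apply: mulr_ge0; [exact: powR_ge0|exact: geoC_doobC_ge0].
have [pq|qp] := leP p q.
  apply: le_trans (sparse_op_strong_le p1 pq A0 K0 lS S0 m0 w0 s0 P0 hA' hK' psiP) _.
  rewrite ler_wpM2r //; apply: ler_pM => //.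
  - exact: mulr_ge0.
  - by rewrite ler_wpM2r // le_max lexx orbT.
  - by rewrite lerDl.
have gC := gtC_ge0 q1 qp.
have [[P PS]|Se] := pselect (exists P, P \in S); last first.
  rewrite big1 => [|x _].
    by rewrite !mulr_ge0 ?addr_ge0 // le_max gC.
  rewrite /sparse_op big1 ?powR0 ?mulr0 // ?mulf_neq0 ?invr_neq0 ?gt_eqF // => P /andP[PS _].
  by case: Se; exists P.
have Ap : 0 < A.
  apply: lt_le_trans (hA' _ PS); have wp := wP _ PS; have sp := psiP _ PS.
  have mp : 0 < mass m P.
    have [Pz|[x xP]] := finset.set_0Vmem P; last exact: mass_gt0 xP _.
    by move/negP : S0; rewrite -Pz.
  rewrite mulr_gt0 ?powR_gt0 // divr_gt0 // lt0r mass_ge0 // andbT.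
  apply/eqP => sP; move: sp; rewrite /mass big1 ?ltxx // => x xP.
  by rewrite /psi (mass_eq0 s0 xP sP) mulr0.
apply: le_trans (sparse_op_strong_gt q1 qp Ap K0 W1 lS S0 m0 w0 s0 P0 sS hA' hK' hW' psiP wP) _.
have pq1 : 0 <= p / q - 1 by rewrite subr_ge0 ler_pdivlMr // mul1r ltW.
rewrite (max_idPl pq1) ler_wpM2r // ler_wpM2r //; first by rewrite addr_ge0 // powR_ge0.
by rewrite ler_wpM2r // le_max lexx.
Qed.

End Sparse_operator_bounds.

(** * Weak bounds for the sparse operator *)

Section Sparse_weak.
Context {R : realType} {X : finType}.
Implicit Types (P Q F G : {set X}) (S T D : {set {set X}}).
Variables (m w sigma Phi : X -> R) (T : {set {set X}}) (A p : R).
Hypotheses (p1 : 1 < p) (A0 : 0 <= A).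
Hypotheses (lT : laminar T) (m0 : forall x, 0 < m x) (w0 : forall x, 0 <= w x).
Hypotheses (s0 : forall x, 0 <= sigma x) (P0 : forall x, 0 <= Phi x).
Hypotheses (sT : sparse m T).
Hypotheses (hA : forall P, P \in T -> dens m w P * dens m sigma P `^ (p - 1) <= A).
Let psi := fun x => Phi x * sigma x.
Let b P := dens m psi P.
Hypotheses (bp : forall P, P \in T -> 0 < b P).
Let E := \sum_x Phi x `^ p * sigma x.
Let kap P := lev (b P).

Let m0' x : 0 <= m x. Proof. exact: ltW. Qed.
Let p0 : 0 < p. Proof. exact: lt_trans p1. Qed.
Let AE0 : 0 <= 2 `^ p * A * E.
Proof.
by rewrite !mulr_ge0 ?powR_ge0 // sumr_ge0 // => x _; rewrite mulr_ge0 ?powR_ge0.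
Qed.

Lemma level_mass k : \sum_(P in level T kap k) mass w P <=
  2 `^ p * A * E * 2 `^ (- p * k%:~R).
Proof.
have k0 := @pow2_gt0 R k%:~R.
have := @sparse_level_weak _ _ m w sigma Phi (level T kap k) A (2 `^ k%:~R) p
  p1 k0 A0 (laminar_sub (level_sub T kap k) lT) m0 w0 s0 P0
  (sparse_sub m0' (level_sub T kap k) sT).
rewrite -powRrM mulNr powRN ler_pdivlMr ?pow2_gt0 //.
rewrite [p * k%:~R]mulrC [X in _ -> X <= _]mulrC; apply.
  by move=> P /(fintype.subsetP (level_sub T kap k)); exact: hA.
move=> P; rewrite inE => /andP[PT /eqP <-].
by rewrite lev_le ?bp //= lev_gt ?bp.
Qed.

(** Level by level: [level_mass] beats the power [s < p], and the levels above
    [tau] decay geometrically. *)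
Lemma above_mass (tau s : R) : 0 < tau -> 0 <= s -> s < p ->
  \sum_(P in T | tau < b P) b P `^ s * mass w P <=
  2 `^ s * 2 `^ (p - s) * geoC (p - s) * (2 `^ p * A * E) * tau `^ (s - p).
Proof.
move=> tau0 s_ge0 sp; rewrite (sum_levels kap).
pose L := [seq j <- levels kap | lev tau <= j].
apply: (@le_trans _ _ (\sum_(j <- L) 2 `^ s * (2 `^ p * A * E) * 2 `^ (- (p - s) * j%:~R))).
  rewrite big_filter [leRHS]big_mkcond /=; apply: ler_sum => j _.
  have [jl|jl] := leP (lev tau) j; last first.
    rewrite big1 // => P /andP[/andP[PT tb] /eqP kP].
    have := lev_mono tau0 (ltW tb); rewrite -/(kap P) kP => /(lt_le_trans jl).
    by rewrite ltxx.
  apply: (@le_trans _ _ (2 `^ s * 2 `^ (s * j%:~R) * \sum_(P in level T kap j) mass w P)).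
    rewrite mulr_sumr sum_level.
    apply: (@le_trans _ _ (\sum_(P in T | kap P == j) b P `^ s * mass w P)).
      apply: ler_sum_sub => P; last by rewrite mulr_ge0 ?powR_ge0 ?mass_ge0.
      by move=> /andP[/andP[-> _] ->].
    apply: ler_sum => P /andP[PT /eqP <-].
    by rewrite ler_wpM2r ?mass_ge0 // lev_powR_ge ?bp.
  apply: le_trans (ler_wpM2l _ (level_mass j)) _; first by rewrite mulr_ge0 ?powR_ge0.
  have -> : - (p - s) * j%:~R = s * j%:~R + - p * j%:~R by ring.
  by rewrite pow2D le_eqVlt; apply/orP; left; apply/eqP; ring.
have ps : 0 < p - s by rewrite subr_gt0.
rewrite -mulr_sumr.
apply: (@le_trans _ _ (2 `^ s * (2 `^ p * A * E) * (geoC (p - s) * 2 `^ (- (p - s) * (lev tau)%:~R)))).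
  apply: ler_wpM2l (mulr_ge0 (powR_ge0 _ _) AE0) _ _ _; apply: geo_sum_neg => //.
    by rewrite filter_uniq // levels_uniq.
  by move=> j; rewrite mem_filter => /andP[].
have h : 2 `^ (- (p - s) * (lev tau)%:~R) <= 2 `^ (p - s) * tau `^ (s - p).
  rewrite -[s - p]opprB mulNr !powRN ler_pdivlMr ?powR_gt0 // mulrC ler_pdivrMr ?powR_gt0 //.
  by apply: lev_powR_ge => //; exact: ltW.
apply: (@le_trans _ _ (2 `^ s * (2 `^ p * A * E) * (geoC (p - s) * (2 `^ (p - s) * tau `^ (s - p))))).
  apply: ler_wpM2l (mulr_ge0 (powR_ge0 _ _) AE0) _ _ _.
  by rewrite ler_wpM2l // ltW // geoC_gt0.
by rewrite le_eqVlt; apply/orP; left; apply/eqP; ring.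
Qed.

Lemma below_mass (tau s : R) : 0 < tau -> p < s ->
  \sum_(P in T | b P <= tau) b P `^ s * mass w P <=
  2 `^ s * geoC (s - p) * (2 `^ p * A * E) * tau `^ (s - p).
Proof.
move=> tau0 sp; have s_gt0 : 0 < s by exact: lt_trans sp.
rewrite (sum_levels kap).
pose L := [seq j <- levels kap | j <= lev tau].
apply: (@le_trans _ _ (\sum_(j <- L) 2 `^ s * (2 `^ p * A * E) * 2 `^ ((s - p) * j%:~R))).
  rewrite big_filter [leRHS]big_mkcond /=; apply: ler_sum => j _.
  have [jl|jl] := leP j (lev tau); last first.
    rewrite big1 // => P /andP[/andP[PT tb] /eqP kP].
    have := lev_mono (bp PT) tb; rewrite -/(kap P) kP => /(lt_le_trans jl).
    by rewrite ltxx.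
  apply: (@le_trans _ _ (2 `^ s * 2 `^ (s * j%:~R) * \sum_(P in level T kap j) mass w P)).
    rewrite mulr_sumr sum_level.
    apply: (@le_trans _ _ (\sum_(P in T | kap P == j) b P `^ s * mass w P)).
      apply: ler_sum_sub => P; last by rewrite mulr_ge0 ?powR_ge0 ?mass_ge0.
      by move=> /andP[/andP[-> _] ->].
    apply: ler_sum => P /andP[PT /eqP <-].
    by rewrite ler_wpM2r ?mass_ge0 // lev_powR_ge ?bp // ltW.
  apply: le_trans (ler_wpM2l _ (level_mass j)) _; first by rewrite mulr_ge0 ?powR_ge0.
  have -> : (s - p) * j%:~R = s * j%:~R + - p * j%:~R by ring.
  by rewrite pow2D le_eqVlt; apply/orP; left; apply/eqP; ring.
have ps : 0 < s - p by rewrite subr_gt0.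
rewrite -mulr_sumr.
apply: (@le_trans _ _ (2 `^ s * (2 `^ p * A * E) * (geoC (s - p) * 2 `^ ((s - p) * (lev tau)%:~R)))).
  apply: ler_wpM2l (mulr_ge0 (powR_ge0 _ _) AE0) _ _ _; apply: geo_sum => //.
    by rewrite filter_uniq // levels_uniq.
  by move=> j; rewrite mem_filter => /andP[].
apply: (@le_trans _ _ (2 `^ s * (2 `^ p * A * E) * (geoC (s - p) * tau `^ (s - p)))).
  apply: ler_wpM2l (mulr_ge0 (powR_ge0 _ _) AE0) _ _ _.
  rewrite ler_wpM2l //; first by rewrite ltW // geoC_gt0.
  by apply: lev_powR_le => //; exact: ltW.
by rewrite le_eqVlt; apply/orP; left; apply/eqP; ring.
Qed.

Definition lowC (q : R) (k : nat) : R :=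
  let t := (p + q * k.+1%:R) / 2 in
  (2 `^ q) ^+ k.+1 * geoC (q - t / k.+1%:R) ^+ k.+1 * (k.+1)`!%:R * geoC (t - p).

(** A high moment of the sum over the cubes of density at most [tau]: the
    exponent [q (k + 1)] exceeds [p], so the levels form a geometric series
    dominated by [tau]. Each factor of the overlap after the first costs one
    Carleson constant of [w]. The intermediate exponent [t] is the midpoint of [p]
    and [q (k + 1)]. *)
Lemma below_moment (tau q W : R) (k : nat) : 0 < tau -> 0 < q -> p < q * k.+1%:R ->
  0 <= W ->
  (forall P, P \in T -> \sum_(Q in cone T P) mass w Q <= W * mass w P) ->
  \sum_x w x * (\sum_(P in T | (x \in P) && (b P <= tau)) b P `^ q) ^+ k.+1 <=
  lowC q k * W ^+ k * (2 `^ p * A * E) * tau `^ (q * k.+1%:R - p).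
Proof.
move=> tau0 q0 pq W0 hW; rewrite /lowC; set M : R := k.+1%:R.
set t := (p + q * M) / 2.
have M0 : 0 < M by rewrite ltr0n.
have tp : p < t by rewrite /t; lra.
have tq : t < q * M by rewrite /t; lra.
set g := geoC (q - t / M).
have g0 : 0 <= g by rewrite ltW // geoC_gt0 // subr_gt0 ltr_pdivrMr.
pose S := [set P in T | b P <= tau].
have ST : S \subset T by apply/fintype.subsetP => P; rewrite inE => /andP[].
have lS := laminar_sub ST lT.
pose c0 := (2 `^ q) ^+ k.+1 * g ^+ k.+1 * 2 `^ ((q * M - t) * (lev tau)%:~R).
have c00 : 0 <= c0 by rewrite !mulr_ge0 ?exprn_ge0 ?powR_ge0.
have pt x : (\sum_(P in T | (x \in P) && (b P <= tau)) b P `^ q) ^+ k.+1 <=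
    c0 * \sum_(j <- levels kap) 2 `^ (t * j%:~R) * overlap (level S kap j) x ^+ k.+1.
  have hS P : P \in S -> x \in P -> kap P <= lev tau.
    by rewrite inE => /andP[PT bt] _; apply: lev_mono bt; exact: bp.
  rewrite /c0 -!mulrA; apply: le_trans (ler_wpM2l _ _); last first.
  - by rewrite mulrA; exact: (sum_levels_pow tq hS).
  - by rewrite exprn_ge0 ?powR_ge0.
  rewrite -exprMn; apply: lerXn2r; rewrite ?nnegrE.
  - by apply: sumr_ge0 => P _; exact: powR_ge0.
  - by rewrite mulr_ge0 ?powR_ge0 // sumr_ge0 // => P _; exact: powR_ge0.
  rewrite mulr_sumr; under [leRHS]eq_bigl => P do rewrite inE.
  under [leRHS]eq_bigl => P do rewrite -andbA (andbC (b P <= tau)).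
  apply: ler_sum => P /andP[PT _]; apply: lev_powR_ge; [exact: ltW|exact: bp].
apply: (@le_trans _ _ (c0 * \sum_(j <- levels kap) 2 `^ (t * j%:~R) * \sum_x w x * overlap (level S kap j) x ^+ k.+1)).
  apply: (@le_trans _ _ (\sum_x w x * (c0 * \sum_(j <- levels kap) 2 `^ (t * j%:~R) * overlap (level S kap j) x ^+ k.+1))).
    by apply: ler_sum => x _; rewrite ler_wpM2l.
  under eq_bigr do rewrite mulrCA.
  rewrite -[leLHS]mulr_sumr ler_wpM2l //.
  under eq_bigr do rewrite mulr_sumr.
  rewrite exchange_big /=; apply: ler_sum => j _.
  under eq_bigr do rewrite mulrCA.
  by rewrite -[leLHS]mulr_sumr.
pose L := [seq j <- levels kap | j <= lev tau].
pose c1 := (k.+1)`!%:R * W ^+ k * (2 `^ p * A * E).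
have c10 : 0 <= c1.
  by apply: mulr_ge0 AE0; rewrite mulr_ge0 ?exprn_ge0.
apply: (@le_trans _ _ (c0 * \sum_(j <- L) c1 * 2 `^ ((t - p) * j%:~R))).
  rewrite ler_wpM2l // big_filter [leRHS]big_mkcond /=; apply: ler_sum => j _.
  have lev0 : 0 <= \sum_(P in level S kap j) mass w P.
    by apply: sumr_ge0 => P _; exact: mass_ge0.
  have mom : \sum_x w x * overlap (level S kap j) x ^+ k.+1 <=
      (k.+1)`!%:R * W ^+ k * \sum_(P in level S kap j) mass w P.
    apply: moments => //; first exact: laminar_sub (level_sub S kap j) lS.
    move=> P /(fintype.subsetP (level_sub S kap j)) /(fintype.subsetP ST) PT.
    apply: le_trans (hW _ PT); apply: ler_sum_sub => Q; rewrite ?mass_ge0 //.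
    apply/fintype.subsetP/cone_mono; apply: fintype.subset_trans ST.
    exact: level_sub.
  have [jl|jl] := leP j (lev tau); last first.
    rewrite mulr_ge0_le0 ?powR_ge0 //; apply: le_trans mom _.
    rewrite big1 ?mulr0 // => P; rewrite !inE => /andP[/andP[PT tb] /eqP kP].
    have := lev_mono (bp PT) tb; rewrite -/(kap P) kP => /(lt_le_trans jl).
    by rewrite ltxx.
  apply: le_trans (ler_wpM2l (powR_ge0 _ _) mom) _.
  have lm : \sum_(P in level S kap j) mass w P <= 2 `^ p * A * E * 2 `^ (- p * j%:~R).
    apply: le_trans (level_mass j); apply: ler_sum_sub => P; rewrite ?mass_ge0 //.
    by rewrite !inE => /andP[/andP[-> _] ->].
  apply: le_trans (ler_wpM2l (powR_ge0 _ _) (ler_wpM2l _ lm)) _.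
    by rewrite mulr_ge0 ?exprn_ge0.
  have -> : (t - p) * j%:~R = t * j%:~R + - p * j%:~R by ring.
  by rewrite pow2D /c1 le_eqVlt; apply/orP; left; apply/eqP; ring.
have gs : \sum_(j <- L) 2 `^ ((t - p) * j%:~R) <= geoC (t - p) * 2 `^ ((t - p) * (lev tau)%:~R).
  apply: geo_sum; rewrite ?subr_gt0 // ?filter_uniq ?levels_uniq //.
  by move=> j; rewrite mem_filter => /andP[].
rewrite -mulr_sumr.
apply: le_trans (ler_wpM2l c00 (ler_wpM2l c10 gs)) _.
have tl : 2 `^ ((q * M - p) * (lev tau)%:~R) <= tau `^ (q * M - p).
  by apply: lev_powR_le => //; rewrite subr_ge0 ltW.
have gt0 : 0 <= geoC (t - p) by rewrite ltW // geoC_gt0 // subr_gt0.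
apply: (@le_trans _ _ (((2 `^ q) ^+ k.+1 * g ^+ k.+1) * (c1 * (geoC (t - p) * 2 `^ ((q * M - p) * (lev tau)%:~R))))).
  have -> : (q * M - p) * (lev tau)%:~R = (q * M - t) * (lev tau)%:~R + (t - p) * (lev tau)%:~R by ring.
  by rewrite pow2D /c0 le_eqVlt; apply/orP; left; apply/eqP; ring.
apply: le_trans (ler_wpM2l _ (ler_wpM2l c10 (ler_wpM2l gt0 tl))) _.
  by rewrite mulr_ge0 ?exprn_ge0 ?powR_ge0.
by rewrite /c1 le_eqVlt; apply/orP; left; apply/eqP; ring.
Qed.

Lemma mass_setU_le (nu : X -> R) P Q : (forall x, 0 <= nu x) ->
  mass nu (P :|: Q) <= mass nu P + mass nu Q.
Proof.
move=> nu0; rewrite /mass (big_setID P) /= (finset.setIidPr (finset.subsetUl P Q)) lerD2l.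
by apply: mass_le => //; rewrite finset.setDUl finset.setDv finset.set0U finset.subsetDl.
Qed.

Lemma mass_lt_le (U : X -> R) c : 0 < c -> (forall x, 0 <= U x) ->
  c * mass w [set x | c < U x] <= \sum_x w x * U x.
Proof.
move=> c0 U0; rewrite /mass mulr_sumr big_mkcond /=; apply: ler_sum => x _.
rewrite inE; case: ifP => [cU|_]; last by rewrite mulr_ge0.
by rewrite mulrC ler_wpM2l // ltW.
Qed.

Let part (c : pred {set X}) q x := \sum_(P in T | (x \in P) && c P) b P `^ q.

Let part_ge0 c q x : 0 <= part c q x.
Proof. by apply: sumr_ge0 => P _; exact: powR_ge0. Qed.

Let sum_part c q : \sum_x w x * part c q x = \sum_(P in T | c P) b P `^ q * mass w P.
Proof.
have := sum_mass [set P in T | c P] w (fun P => b P `^ q).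
rewrite (eq_bigl (fun P => (P \in T) && c P)) => [<-|P]; last by rewrite inE.
apply: eq_bigr => x _; congr (_ * _); apply: eq_bigl => P; rewrite inE.
by case: (P \in T) => //=; rewrite andbC.
Qed.

Let Omega (t : R) := [set x | [exists P, [&& P \in T, x \in P & t < b P]]].

(** The case [s = 0] of [above_mass]. *)
Lemma mass_Omega t : 0 < t -> mass w (Omega t) <=
  2 `^ p * geoC p * (2 `^ p * A * E) * t `^ (- p).
Proof.
move=> t0; have := above_mass t0 (lexx 0) p0.
rewrite !subr0 sub0r powRr0 mul1r; apply: le_trans.
under [leRHS]eq_bigr do rewrite powRr0 mul1r.
apply: (@le_trans _ _ (\sum_(P in T | t < b P) 1 * mass w P)); last first.
  by apply: ler_sum => P _; rewrite mul1r.
have := sum_mass [set P in T | t < b P] w (fun => 1).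
rewrite (eq_bigl (fun P => (P \in T) && (t < b P))) => [<-|P]; last by rewrite inE.
rewrite /mass big_mkcond /=; apply: ler_sum => x _; rewrite inE; case: ifP => [|_].
  move=> /fintype.existsP[P /and3P[PT xP tb]].
  rewrite (bigD1 P) /=; last by rewrite inE PT tb xP.
  by rewrite mulrDr mulr1 lerDl mulr_ge0 // sumr_ge0.
by rewrite mulr_ge0 // sumr_ge0.
Qed.

Lemma sparse_op_weak_lt (q t : R) : p < q -> 0 < t ->
  t `^ p * mass w [set x | 2 * t `^ q < sparse_op m psi T q x] <=
  (2 `^ p * geoC p + 2 `^ q * geoC (q - p)) * (2 `^ p * A * E).
Proof.
move=> pq t0; have q0 : 0 < q by exact: lt_trans pq.
have tq : 0 < t `^ q by rewrite powR_gt0.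
have sub : [set x | 2 * t `^ q < sparse_op m psi T q x] \subset
    Omega t :|: [set x | t `^ q < part (fun P => b P <= t) q x].
  apply/fintype.subsetP => x; rewrite !inE => h; apply/orP.
  have [e|/fintype.existsPn e] := boolP [exists P, [&& P \in T, x \in P & t < b P]]; [by left|right].
  suff <- : sparse_op m psi T q x = part (fun P => b P <= t) q x by lra.
  apply: eq_bigl => P; case: (boolP (P \in T)) => //= PT.
  case: (boolP (x \in P)) => //= xP; have := e P; rewrite PT xP /= -leNgt.
  by move=> ->.
have := mass_le w0 sub => hm.
have := mass_lt_le tq (part_ge0 (fun P => b P <= t) q); rewrite sum_part => h1.
have h2 := below_mass t0 pq.
have h3 := mass_Omega t0.
have {hm} hm := le_trans hm (mass_setU_le _ _ w0).
have tp : 0 < t `^ p by rewrite powR_gt0.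
apply: le_trans (ler_wpM2l (ltW tp) hm) _; rewrite mulrDr mulrDl; apply: lerD.
  apply: le_trans (ler_wpM2l (ltW tp) h3) _.
  rewrite powRN mulrCA divff ?mulr1 //; exact: lt0r_neq0.
have -> : t `^ p = t `^ (p - q) * t `^ q.
  by rewrite -powRD ?subrK // (gt_eqF t0) implybT.
rewrite -[leLHS]mulrA; apply: le_trans (ler_wpM2l (powR_ge0 _ _) (le_trans h1 h2)) _.
rewrite mulrCA -powRD ?(gt_eqF t0) ?implybT // (_ : p - q + (q - p) = 0); last by ring.
by rewrite powRr0 mulr1.
Qed.

Definition weak_gtC (q : R) :=
  2 `^ p * geoC p + 2 `^ q * 2 `^ (p - q) * geoC (p - q) +
  lowC q (Num.truncn (p / q)).

(** Three ranges of densities. Above [t] the cubes cover a set of the right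
    measure. Between [tau] and [t], Chebyshev's inequality for the first moment
    costs (t / tau)^(p - q). Below [tau], Chebyshev's inequality for the moment of
    order [k + 1] costs [W ^ k] and gains a power of tau / t. The choice
    tau = t W^(-1/q) makes both costs equal to W^(p/q - 1). *)
Lemma sparse_op_weak_gt (q t W : R) : 0 < q -> q < p -> 0 < t -> 1 <= W ->
  (forall P, P \in T -> \sum_(Q in cone T P) mass w Q <= W * mass w P) ->
  t `^ p * mass w [set x | 2 * t `^ q < sparse_op m psi T q x] <=
  weak_gtC q * W `^ (p / q - 1) * (2 `^ p * A * E).
Proof.
move=> q0 qp t0 W1 hW.
have tq : 0 < t `^ q by rewrite powR_gt0.
have tp : 0 < t `^ p by rewrite powR_gt0.
have W0 : 0 < W by exact: lt_le_trans W1.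
pose tau := t * W `^ (- q^-1).
have tau0 : 0 < tau by rewrite mulr_gt0 ?powR_gt0.
have taut : tau <= t.
  rewrite /tau ler_piMr ?(ltW t0) // -[leRHS](powRr0 W) ler_powR // oppr_le0.
  by rewrite invr_ge0 ltW.
have tauE (a : R) : tau `^ a = t `^ a * W `^ (- (a / q)).
  by rewrite /tau powRM ?powR_ge0 ?(ltW t0) // -powRrM; congr (_ * _ `^ _); ring.
pose mid := part (fun P => tau < b P) q.
pose low := part (fun P => b P <= tau) q.
have sub : [set x | 2 * t `^ q < sparse_op m psi T q x] \subset
    Omega t :|: ([set x | t `^ q < mid x] :|: [set x | t `^ q < low x]).
  apply/fintype.subsetP => x; rewrite !inE => h.
  have [e|/fintype.existsPn e] := boolP [exists P, [&& P \in T, x \in P & t < b P]]; [by []|].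
  suff e' : sparse_op m psi T q x = mid x + low x.
    by rewrite e' in h; apply/orP; have [] := ltP (t `^ q) (mid x); lra.
  rewrite /sparse_op (bigID (fun P => tau < b P)) /= /mid /low /part.
  congr (_ + _); apply: eq_bigl => P; rewrite -?leNgt.
    by rewrite andbA.
  by rewrite andbA.
have hm := mass_le w0 sub.
have {}hm := le_trans hm (mass_setU_le _ _ w0).
have {}hm := le_trans hm (lerD (lexx _) (mass_setU_le _ _ w0)).
have h3 := mass_Omega t0.
have h1 := mass_lt_le tq (part_ge0 (fun P => tau < b P) q).
rewrite sum_part in h1.
have {}h1 := le_trans h1 (above_mass tau0 (ltW q0) qp).
set k := Num.truncn (p / q).
have pk : p < q * k.+1%:R by rewrite mulrC -ltr_pdivrMr // truncnS_gt.
have h2 := below_moment tau0 q0 pk (ltW W0) hW.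
have h4 : (t `^ q) ^+ k.+1 * mass w [set x | t `^ q < low x] <=
   lowC q k * W ^+ k * (2 `^ p * A * E) * tau `^ (q * k.+1%:R - p).
  apply: le_trans h2.
  have -> : [set x | t `^ q < low x] = [set x | (t `^ q) ^+ k.+1 < low x ^+ k.+1].
    by apply/finset.setP => x; rewrite !inE ltr_pXn2r // ?nnegrE ?powR_ge0 ?part_ge0.
  by apply: mass_lt_le; [rewrite exprn_gt0|move=> x; rewrite exprn_ge0 ?part_ge0].
have tD (x y : R) : x + y = 0 -> t `^ x * t `^ y = 1.
  by move=> e; rewrite -powRD ?e ?powRr0 // (gt_eqF t0) implybT.
have Wr : 1 <= W `^ (p / q - 1).
  rewrite -[leLHS](powRr0 W) ler_powR // subr_ge0 ler_pdivlMr // mul1r.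
  exact: ltW.
apply: le_trans (ler_wpM2l (ltW tp) hm) _; rewrite /weak_gtC -/k !mulrDr !mulrDl addrA.
apply: lerD; first apply: lerD.
- apply: le_trans (ler_wpM2l (ltW tp) h3) _.
  rewrite powRN mulrCA divff ?mulr1; last exact: lt0r_neq0.
  rewrite ler_wpM2r // ler_peMr // mulr_ge0 ?powR_ge0 // ltW // geoC_gt0 //.
- have -> : t `^ p = t `^ (p - q) * t `^ q.
    by rewrite -powRD ?subrK // (gt_eqF t0) implybT.
  rewrite -[leLHS]mulrA; apply: le_trans (ler_wpM2l (powR_ge0 _ _) h1) _.
  rewrite tauE mulrCA [t `^ (p - q) * _]mulrA tD ?mul1r; last by ring.
  rewrite (_ : - ((q - p) / q) = p / q - 1); last by field; exact: lt0r_neq0.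
  by rewrite le_eqVlt; apply/orP; left; apply/eqP; ring.
- have -> : t `^ p = t `^ (p - q * k.+1%:R) * (t `^ q) ^+ k.+1.
    rewrite -powR_mulrn ?powR_ge0 // -powRrM -powRD ?subrK // (gt_eqF t0) implybT //.
  rewrite -[leLHS]mulrA; apply: le_trans (ler_wpM2l (powR_ge0 _ _) h4) _.
  rewrite tauE mulrCA [t `^ (p - _) * _]mulrA tD ?mul1r; last by ring.
  have -> : W `^ (p / q - 1) = W ^+ k * W `^ (- ((q * k.+1%:R - p) / q)).
    rewrite -powR_mulrn ?(ltW W0) // -powRD ?(gt_eqF W0) ?implybT //; congr (_ `^ _).
    by rewrite -natr1; field; exact: lt0r_neq0.
  by rewrite le_eqVlt; apply/orP; left; apply/eqP; ring.
Qed.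

End Sparse_weak.

(** * Sparse domination of the vector-valued maximal function *)

Section Sparse_domination.
Context {R : realType} {X J : finType}.
Implicit Types (P Q : {set X}) (S T : {set {set X}}).

(** Jensen's inequality for [b / s] against the weights [s j ^ q]; where [s j]
    vanishes, the corresponding term of the left-hand side is zero. *)
Lemma holder_sum (q : R) (s b : J -> R) (F : R) : (1 < q) ->
  (forall j, 0 <= s j) -> (forall j, 0 <= b j) -> (0 <= F) ->
  (\sum_j b j `^ q <= F `^ q) ->
  (\sum_j s j `^ (q - 1) * b j <= (\sum_j s j `^ q) `^ ((q - 1) / q) * F).
Proof.
move=> q1 s0 b0 F0 bF; have q0 : (0 < q) by exact: lt_trans q1.
have q1' : (0 < q - 1) by rewrite subr_gt0.
have := @jensen_sum _ _ (fun j => s j `^ q) (fun j => b j / s j) (finset.setTfor J) q q1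
     (fun j => powR_ge0 _ _) (fun j => divr_ge0 (b0 j) (s0 j)).
have e (G : J -> R) : (\sum_(j in finset.setTfor J) G j = \sum_j G j).
  by apply: eq_bigl => j; rewrite inE.
rewrite /mass !e.
have -> : (\sum_j b j / s j * s j `^ q = \sum_j s j `^ (q - 1) * b j).
  apply: eq_bigr => j _; have [->|sn] := eqVneq (s j) 0.
    by rewrite invr0 mulr0 mul0r powR0 ?mul0r // gt_eqF.
  by rewrite -(@mulr_powRB1 _ (s j) q) //; field.
have le2 : (\sum_j (b j / s j) `^ q * s j `^ q <= F `^ q).
  apply: le_trans bF; apply: ler_sum => j _; have [->|sn] := eqVneq (s j) 0.
    by rewrite invr0 mulr0 powR0 ?gt_eqF // mul0r powR_ge0.
  by rewrite -powRM ?divr_ge0 // divfK.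
move=> h; have {}h := le_trans h (ler_wpM2r (powR_ge0 _ _) le2).
set G := (\sum_j s j `^ q) in h *.
have G0 : (0 <= G) by apply: sumr_ge0 => j _; exact: powR_ge0.
have qV : (0 <= q^-1) by rewrite invr_ge0 ltW.
have L0 : (0 <= \sum_j s j `^ (q - 1) * b j).
  by apply: sumr_ge0 => j _; rewrite mulr_ge0 ?powR_ge0.
have := powR_le qV (powR_ge0 _ _) h.
rewrite powRM ?powR_ge0 // -!powRrM divff ?gt_eqF // !powRr1 //.
by rewrite mulrC.
Qed.

(** Duality with the vector of the [s j ^ (q - 1)], where [s] is the vector of
    sums: pairing [a x] with it costs at most [b x] by Hoelder's inequality. *)
Lemma minkowski_sum (q : R) (A : {set X}) (a : J -> X -> R) (b : X -> R) : 1 < q ->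
  (forall j x, 0 <= a j x) -> (forall x, 0 <= b x) ->
  (forall x, \sum_j a j x `^ q <= b x `^ q) ->
  \sum_j mass (a j) A `^ q <= mass b A `^ q.
Proof.
move=> q1 a0 b0 ab; have q0 : 0 < q by exact: lt_trans q1.
pose s j := mass (a j) A.
have s0 j : 0 <= s j by exact: mass_ge0.
pose S := \sum_j s j `^ q.
have S0 : 0 <= S by apply: sumr_ge0 => j _; exact: powR_ge0.
have [Sz|Sn] := eqVneq S 0; first by rewrite -/S Sz powR_ge0.
have Sp : 0 < S by rewrite lt0r Sn.
have hol x : \sum_j s j `^ (q - 1) * a j x <= S `^ ((q - 1) / q) * b x.
  exact: holder_sum q1 s0 (a0^~ x) (b0 x) (ab x).
have key : S <= S `^ ((q - 1) / q) * mass b A.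
  apply: (@le_trans _ _ (\sum_(x in A) \sum_j s j `^ (q - 1) * a j x)).
    rewrite exchange_big /=; apply: ler_sum => j _.
    by rewrite -mulr_sumr -(@mulr_powRB1 _ (s j) q) // mulrC.
  by rewrite /mass mulr_sumr; apply: ler_sum => x _; exact: hol.
have Sb : S `^ q^-1 <= mass b A.
  have Sq : 0 < S `^ ((q - 1) / q) by rewrite powR_gt0.
  rewrite -(ler_pM2l Sq) -powRD ?(gt_eqF Sp) ?implybT //.
  rewrite (_ : (q - 1) / q + q^-1 = 1) ?powRr1 //.
  by field; rewrite gt_eqF.
rewrite -/S -[leLHS](@powRVK _ _ q) ?gt_eqF //.
by apply: powR_le => //; rewrite ?powR_ge0 ?(ltW q0).
Qed.

Lemma dens_minkowski (m : X -> R) (q : R) (A : {set X}) (psi : J -> X -> R) (Psi : X -> R) :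
  1 < q -> (forall x, 0 < m x) ->
  (forall j x, 0 <= psi j x) -> (forall x, 0 <= Psi x) ->
  (forall x, \sum_j psi j x `^ q <= Psi x `^ q) ->
  \sum_j dens m (fun x => psi j x * m x) A `^ q <=
    dens m (fun x => Psi x * m x) A `^ q.
Proof.
move=> q1 m0 psi0 Psi0 h; have m0' x : 0 <= m x by exact: ltW.
have mA0 := mass_ge0 A m0'.
rewrite /dens powRM ?invr_ge0 ?mass_ge0 // => [|x]; last exact: mulr_ge0.
under eq_bigr => j _.
  rewrite powRM ?invr_ge0 ?mass_ge0 // => [|x]; last exact: mulr_ge0.
  over.
rewrite -mulr_suml ler_wpM2r ?powR_ge0 //.
apply: (@minkowski_sum q A (fun j x => psi j x * m x) (fun x => Psi x * m x)) => //.
- by move=> j x; exact: mulr_ge0.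
- by move=> x; exact: mulr_ge0.
move=> x; rewrite powRM //; under eq_bigr do rewrite powRM //.
by rewrite -mulr_suml ler_wpM2r ?powR_ge0.
Qed.

Variables (m : X -> R) (D : {set {set X}}) (Kd q : R).
Variables (psi : J -> X -> R) (Psi : X -> R).
Hypotheses (q1 : 1 < q) (Kd1 : 1 <= Kd) (m0 : forall x, 0 < m x).
Hypotheses (lD : laminar D) (D0 : finset.set0 \notin D).
Hypothesis (D1 : forall x, finset.set1 x \in D).
Hypothesis (doubling : forall P Q, P \in D -> Q \in D -> Q \proper P ->
  exists Q', [/\ Q' \in D, Q \proper Q', Q' \subset P & mass m Q' <= Kd * mass m Q]).
Hypotheses (psi0 : forall j x, 0 <= psi j x) (Psi0 : forall x, 0 <= Psi x).
Hypothesis (psiPsi : forall x, \sum_j psi j x `^ q <= Psi x `^ q).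

Let u j x := psi j x * m x.
Let v x := Psi x * m x.
Let m0' x : 0 <= m x. Proof. exact: ltW. Qed.
Let u0 j x : 0 <= u j x. Proof. exact: mulr_ge0. Qed.
Let v0 x : 0 <= v x. Proof. exact: mulr_ge0. Qed.
Let q0 : 0 < q. Proof. exact: lt_trans q1. Qed.

Definition Uq P x := \sum_j dyadic_max (cone D P) m (u j) x `^ q.

Definition domC (K r : R) := 10 * (1 + doobC r) * (10 * K) `^ r.

Lemma domC_ge1 : 1 <= domC Kd q.
Proof.
rewrite /domC; have d0 := ltW (doobC_gt0 q1).
have : 1 <= (10 * Kd) `^ q.
  have K10 : 1 <= 10 * Kd by move: Kd1; lra.
  by rewrite -[leLHS](powRr0 (10 * Kd)); exact: ler_powR K10 _ _ (ltW q0).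
by move=> /le_trans; apply; rewrite ler_peMl ?powR_ge0 //; lra.
Qed.

Let nonempty P : P \in D -> exists x, x \in P.
Proof.
move=> PD; have [Pz|[x xP]] := finset.set_0Vmem P; last by exists x.
by move: D0; rewrite -Pz PD.
Qed.

Let mass_m_gt0 P : P \in D -> 0 < mass m P.
Proof. by move=> /nonempty[x xP]; exact: mass_gt0 xP _. Qed.

(** A Calderon-Zygmund decomposition: on the maximal cubes where the average of
    [Psi] exceeds 10 times its average on [P], each [psi j] is replaced by its
    average. Off these cubes the maximal functions do not decrease, and the new
    vector [h] is bounded in l^q, on these cubes by doubling, so that Doob's
    inequality in L^q gives the bound for it. *)
Lemma vector_weak P : P \in D ->
  mass m [set x in P | domC Kd q * dens m v P `^ q < Uq P x] <= 5^-1 * mass m P.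
Proof.
move=> PD; set lam := dens m v P.
have mP := mass_m_gt0 PD.
have lam0 : 0 <= lam by exact: dens_ge0.
have C0 : 0 <= domC Kd q by apply: le_trans domC_ge1.
have [lz|ln] := eqVneq lam 0.
  rewrite lz powR0 ?mulr0 ?gt_eqF // (_ : [set x in P | _] = finset.set0).
    by rewrite /mass big_set0 mulr_ge0 // mass_ge0.
  apply/finset.setP => x; rewrite !inE; case: (boolP (x \in P)) => //= xP.
  have vz y : y \in P -> v y = 0.
    move=> yP; apply: (mass_eq0 v0 yP).
    by move/eqP : lz; rewrite /lam /dens mulf_eq0 invr_eq0 (gt_eqF mP) orbF => /eqP.
  have uz j y : y \in P -> u j y = 0.
    move=> yP; rewrite /u; suff -> : psi j y = 0 by rewrite mul0r.
    have /eqP := vz _ yP; rewrite /v mulf_eq0 (gt_eqF (m0 y)) orbF => /eqP Pz.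
    have := psiPsi y; rewrite Pz powR0 ?gt_eqF // => h.
    have : psi j y `^ q <= 0.
      by apply: le_trans h; rewrite (bigD1 j) //= lerDl sumr_ge0 // => i _; exact: powR_ge0.
    rewrite le_eqVlt ltNge powR_ge0 orbF => /eqP /eqP; rewrite powR_eq0.
    by move=> /andP[/eqP ->].
  rewrite /Uq big1 ?ltxx // => j _; rewrite (_ : dyadic_max _ _ _ _ = 0) ?powR0 ?gt_eqF //.
  apply/eqP; rewrite eq_le dyadic_max_ge0 andbT; apply: dyadic_max_le => // Q.
  rewrite inE => /andP[QD QP] xQ; rewrite /dens /mass big1 ?mul0r // => y yQ.
  by apply: uz; exact: (fintype.subsetP QP).
have lp : 0 < lam by rewrite lt0r ln.
pose S := [set Q in cone D P | 10 * lam < dens m v Q].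
have SD Q : Q \in S -> Q \in D by rewrite !inE => /andP[/andP[]].
have SP Q : Q \in S -> Q \subset P by rewrite !inE => /andP[/andP[]].
have lS : laminar S by apply: laminar_sub lD; apply/fintype.subsetP.
pose Om := finset.cover S.
have OmE x : reflect (exists2 Q, Q \in tops S & x \in Q) (x \in Om).
  by rewrite /Om -cover_tops; exact: finset.bigcupP.
have topsS Q : Q \in tops S -> Q \in S by exact: (fintype.subsetP (tops_sub S)).
have mOm : mass m Om <= 10^-1 * mass m P.
  have : 10 * lam * mass m Om <= mass v P.
    apply: (@le_trans _ _ (mass v Om)).
      rewrite /Om !mass_cover // mulr_sumr; apply: ler_sum => Q /topsS; rewrite inE => /andP[_ h].
      by rewrite -(densE v Q m0) ler_wpM2r ?mass_ge0 // ltW.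
    by apply: mass_le => //; apply/finset.bigcupsP.
  rewrite -(densE v P m0) -/lam -mulrA [lam * _]mulrC mulrA [lam * _]mulrC ler_pM2r //.
  by lra.
pose h j x := \sum_(Q in tops S | x \in Q) dens m (u j) Q +
   (if x \in P :\: Om then psi j x else 0).
have h0 j x : 0 <= h j x.
  rewrite addr_ge0 //; first by apply: sumr_ge0 => Q _; exact: dens_ge0.
  by case: ifP.
have massle j Q x : Q \in cone D P -> x \in Q -> x \notin Om ->
    mass (u j) Q <= mass (fun y => h j y * m y) Q.
  rewrite inE => /andP[QD QP] xQ xOm.
  rewrite /mass; under [leRHS]eq_bigr do rewrite mulrDl.
  rewrite big_split /= [leLHS](big_setID Om) /=; apply: lerD; last first.
    rewrite [leRHS](big_setID Om) /= -[leLHS]add0r; apply: lerD.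
      by apply: sumr_ge0 => y _; case: ifP => _; rewrite ?mul0r ?mulr_ge0.
    apply: ler_sum => y; rewrite !inE => /andP[-> yQ] /=.
    by rewrite (fintype.subsetP QP).
  apply: (@le_trans _ _ (\sum_(T in tops S | T \subset Q) mass (u j) T)).
    apply: (@le_trans _ _ (\sum_y \sum_(T in tops S | (T \subset Q) && (y \in T)) u j y)).
      rewrite big_mkcond /=; apply: ler_sum => y _; rewrite inE; case: ifP => [/andP[yQ]|_].
        move=> /OmE[T Tt yT]; rewrite (bigD1 T) /=; first by rewrite lerDl sumr_ge0.
        rewrite Tt yT andbT; have [|//] := laminar_meet lD QD (SD _ (topsS _ Tt)) yQ yT.
        move=> /fintype.subsetP QT; case/negP: xOm; apply/OmE; exists T => //.
        exact: QT.
      exact: sumr_ge0.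
    rewrite (exchange_big_dep (fun T : {set X} => (T \in tops S) && (T \subset Q))) /=; last first.
      by move=> y T _ /andP[-> /andP[->]].
    apply: ler_sum => T /andP[Tt TQ]; rewrite /mass; apply: ler_sum_sub => // y.
    by rewrite Tt TQ.
  under [leRHS]eq_bigr do rewrite mulr_suml.
  rewrite (exchange_big_dep (mem (tops S))) /=; last by move=> y T _ /andP[].
  rewrite [leRHS](bigID (fun T : {set X} => T \subset Q)) /= -[leLHS]addr0; apply: lerD; last first.
    apply: sumr_ge0 => T _; apply: sumr_ge0 => y _; rewrite mulr_ge0 //; exact: dens_ge0.
  apply: ler_sum => T /andP[Tt TQ]; rewrite -(densE (u j) T m0) /mass mulr_sumr.
  apply: ler_sum_sub => y; last by rewrite mulr_ge0 // dens_ge0.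
  by move=> yT; rewrite Tt yT (fintype.subsetP TQ).
pose B := 10 * Kd * lam.
have Kd0 : 0 <= Kd by exact: le_trans Kd1.
have B0 : 0 <= B by exact: mulr_ge0 (mulr_ge0 _ Kd0) lam0.
have hB x : \sum_j h j x `^ q <= (if x \in P then B `^ q else 0).
  have [xOm|xOm] := boolP (x \in Om).
    have /OmE[Q Qt xQ] := xOm.
    have QS := topsS _ Qt; have QP := SP _ QS; have QD := SD _ QS.
    rewrite (fintype.subsetP QP _ xQ).
    have hE j : h j x = dens m (u j) Q.
      rewrite /h !inE xOm /= addr0 (bigD1 Q) ?Qt //= big1 ?addr0 // => T /andP[/andP[Tt xT] TQ].
      have := finset.trivIsetP (tops_trivIset lS) _ _ Tt Qt TQ.
      by move=> /fintype.disjointFr /(_ xT); rewrite xQ.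
    under eq_bigr do rewrite hE.
    apply: le_trans (dens_minkowski Q q1 m0 psi0 Psi0 psiPsi) _.
    apply: powR_le; [exact: ltW|exact: dens_ge0|].
    have QproperP : Q \proper P.
      rewrite finset.properEneq QP andbT; apply/eqP => QeP.
      move: QS; rewrite !inE QeP -/lam => /andP[_]; lra.
    have [Q' [Q'D QQ' Q'P mQ']] := doubling PD QD QproperP.
    have Q'S : Q' \notin S.
      apply/negP => Q'S; move: Qt; rewrite inE => /andP[_ /forall_inP /(_ _ Q'S)].
      rewrite (proper_sub QQ') /= => /eqP e; move: QQ'; rewrite e.
      by rewrite finset.properEneq eqxx.
    have dQ' : dens m v Q' <= 10 * lam.
      by move: Q'S; rewrite !inE Q'D Q'P /= -leNgt.
    rewrite /dens ler_pdivrMr ?mass_m_gt0 //.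
    apply: (@le_trans _ _ (mass v Q')); first exact: mass_le v0 (proper_sub QQ').
    rewrite -(densE v Q' m0).
    apply: (@le_trans _ _ (10 * lam * (Kd * mass m Q))).
      by apply: ler_pM => //; [exact: dens_ge0|exact: mass_ge0].
    by rewrite /B le_eqVlt; apply/orP; left; apply/eqP; ring.
  have z j : \sum_(Q in tops S | x \in Q) dens m (u j) Q = 0.
    rewrite big1 // => Q /andP[Qt xQ]; case/negP: xOm; apply/OmE; by exists Q.
  case: ifP => xP; last first.
    rewrite big1 // => j _; rewrite /h z !inE xP andbF addr0 powR0 // gt_eqF //.
  have hE j : h j x = psi j x by rewrite /h z add0r !inE xOm xP.
  under eq_bigr do rewrite hE.
  apply: le_trans (psiPsi x) _; apply: powR_le => //; first exact: ltW.
  have : finset.set1 x \notin S.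
    apply/negP => xS; case/negP: xOm; apply/finset.bigcupP; exists (finset.set1 x) => //.
    by rewrite inE.
  rewrite !inE D1 finset.sub1set xP /= -leNgt /dens /mass !big_set1 /v mulfK ?gt_eqF //.
  by move=> /le_trans; apply; rewrite /B ler_wpM2r // ler_peMr.
have dh j := doob (laminar_sub (cone_sub D P) lD) m0' (h0 j) q1.
pose V x := \sum_j dyadic_max (cone D P) m (fun y => h j y * m y) x `^ q.
have V0 x : 0 <= V x by apply: sumr_ge0 => j _; exact: powR_ge0.
have UV x : x \notin Om -> Uq P x <= V x.
  move=> xOm; apply: ler_sum => j _; apply: powR_le; [exact: ltW|exact: dyadic_max_ge0|].
  apply: dyadic_max_le => [|Q QP xQ]; first exact: dyadic_max_ge0.
  apply: le_trans (dyadic_max_ge _ _ QP xQ); rewrite /dens ler_wpM2r ?invr_ge0 ?mass_ge0 //.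
  exact: massle QP xQ xOm.
set c := domC Kd q * lam `^ q.
have c0 : 0 < c by rewrite mulr_gt0 ?powR_gt0 // (lt_le_trans ltr01) // domC_ge1.
have Vint : \sum_x m x * V x <= doobC q * (B `^ q * mass m P).
  under eq_bigr do rewrite mulr_sumr.
  rewrite exchange_big /=; apply: le_trans (ler_sum _ (fun j _ => dh j)) _.
  rewrite -mulr_sumr ler_wpM2l ?(ltW (doobC_gt0 q1)) // exchange_big /=.
  rewrite /mass mulr_sumr [leRHS]big_mkcond /=; apply: ler_sum => x _.
  rewrite -mulr_sumr; apply: le_trans (ler_wpM2l (m0' x) (hB x)) _.
  by case: ifP; rewrite ?mulr0 // mulrC.
have key : c * mass m [set x | c < V x] <= doobC q * (B `^ q * mass m P).
  by apply: le_trans Vint; exact: mass_lt_le.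
have sub : [set x in P | c < Uq P x] \subset Om :|: [set x | c < V x].
  apply/fintype.subsetP => x; rewrite !inE => /andP[_ cU].
  have [//|xOm] := boolP (x \in Om); exact: lt_le_trans (UV _ xOm).
apply: le_trans (mass_le m0' sub) _; apply: le_trans (mass_setU_le _ _ m0') _.
suff : mass m [set x | c < V x] <= 10^-1 * mass m P by lra.
rewrite -(ler_pM2l c0); apply: le_trans key _.
rewrite /c /B /domC powRM ?(ltW lp) //; last by lra.
have dq := ltW (doobC_gt0 q1).
have K1 : 0 <= (10 * Kd) `^ q * lam `^ q * mass m P by rewrite !mulr_ge0 ?powR_ge0 // ltW.
have -> : 10 * (1 + doobC q) * (10 * Kd) `^ q * lam `^ q * (10^-1 * mass m P) =
  (1 + doobC q) * ((10 * Kd) `^ q * lam `^ q * mass m P) by field.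
by rewrite ler_wpM2r // lerDr.
Qed.

(** Stated with the ancestors of [Q] only, so that [bad P Q] forces the maximal
    function to be large on all of [Q]. *)
Let bad P Q := domC Kd q * dens m v P `^ q < \sum_j amax (cone D P) m (u j) Q `^ q.

Let amax_Uq P Q x : x \in Q -> \sum_j amax (cone D P) m (u j) Q `^ q <= Uq P x.
Proof.
move=> xQ; apply: ler_sum => j _; apply: powR_le; first exact: ltW.
  exact: bigmax_ge_id.
exact: amax_dyadic_max.
Qed.

Let stops P := tops [set Q in cone D P | bad P Q].

Let stopsP P Q : Q \in stops P -> [/\ Q \in D, Q \subset P & bad P Q].
Proof.
by move=> /(fintype.subsetP (tops_sub _)); rewrite !inE => /andP[/andP[]].
Qed.

Let self_not_bad P : P \in D -> ~~ bad P P.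
Proof.
move=> PD; rewrite -leNgt; apply: (@le_trans _ _ (dens m v P `^ q)); last first.
  by rewrite ler_peMl ?powR_ge0 // domC_ge1.
apply: le_trans (dens_minkowski P q1 m0 psi0 Psi0 psiPsi); apply: ler_sum => j _.
apply: powR_le; [exact: ltW|exact: bigmax_ge_id|].
apply/bigmax_leP; split; first by apply: dens_ge0 => // x; exact: mulr_ge0.
move=> Q /andP[]; rewrite inE => /andP[QD QP] PQ.
suff -> : Q = P by [].
by apply/eqP; rewrite finset.eqEsubset QP.
Qed.

Let stops_proper P Q : P \in D -> Q \in stops P -> Q \proper P.
Proof.
move=> PD /stopsP[QD QP bQ]; rewrite finset.properEneq QP andbT.
by apply: contraTneq bQ => ->; exact: self_not_bad.
Qed.

(** Let [Z] be the parent of [Q]: cubes containing [x] and not contained in [Q]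
    contain [Z], and [Z] is not bad because [Q] is maximal. *)
Let stop_step P Q x : P \in D -> Q \in stops P -> x \in Q ->
  Uq P x <= domC Kd q * dens m v P `^ q + Uq Q x.
Proof.
move=> PD Qs xQ; have [QD QP bQ] := stopsP Qs; have QpP := stops_proper PD Qs.
have ex : [&& P \in D, Q \proper P & P \subset P] by rewrite PD QpP fintype.subxx.
case: (@arg_minnP _ P (fun Z => [&& Z \in D, Q \proper Z & Z \subset P]) (fun Z => #|Z|) ex).
move=> Z /and3P[ZD QZ ZP] Zmin.
have nbZ : ~~ bad P Z.
  apply/negP => bZ; move: Qs; rewrite inE => /andP[_ /forall_inP /(_ Z)].
  rewrite !inE ZD ZP bZ (proper_sub QZ) => /(_ isT) /eqP e.
  by move: QZ; rewrite e finset.properEneq eqxx.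
rewrite -leNgt in nbZ; apply: le_trans (lerD nbZ (lexx _)).
rewrite /Uq -big_split /=; apply: ler_sum => j _.
have aZ : 0 <= amax (cone D P) m (u j) Z by exact: bigmax_ge_id.
have MQ : 0 <= dyadic_max (cone D Q) m (u j) x by exact: dyadic_max_ge0.
have : dyadic_max (cone D P) m (u j) x <= Num.max (amax (cone D P) m (u j) Z) (dyadic_max (cone D Q) m (u j) x).
  apply: dyadic_max_le => [|A]; first by rewrite le_max aZ.
  rewrite inE => /andP[AD AP] xA; rewrite le_max.
  have [AQ|QA] := laminar_meet lD AD QD xA xQ.
    by apply/orP; right; apply: dyadic_max_ge => //; rewrite inE AD.
  have [->|AneQ] := eqVneq A Q.
    by apply/orP; right; apply: dyadic_max_ge => //; rewrite inE QD fintype.subxx.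
  apply/orP; left; apply: (le_bigmax_cond 0); rewrite inE AD AP /=.
  have QpA : Q \proper A by rewrite finset.properEneq eq_sym AneQ.
  have [|AZ] := laminar_meet lD ZD AD (fintype.subsetP (proper_sub QZ) _ xQ) xA; first by [].
  suff /eqP -> : A == Z by [].
  by rewrite eqEcard AZ; apply: Zmin; rewrite AD QpA.
move=> /(powR_le (ltW q0) (dyadic_max_ge0 _ _ _ _)) /le_trans; apply.
set c := amax _ _ _ _; set d := dyadic_max _ _ _ _; case: (leP c d) => _.
  by rewrite lerDr powR_ge0.
by rewrite lerDl powR_ge0.
Qed.

(** Induction on the number of points of [P]. The stopping cubes of [P] are the
    maximal bad ones; by the weak bound they cover at most one fifth of [P], and
    the families obtained for them are collected below [P]. A point outside all
    of them is not bad as a singleton. *)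
Lemma sparse_domination P : P \in D -> exists T : {set {set X}},
  [/\ T \subset cone D P, P \in T, sparse m T &
   forall x, x \in P -> Uq P x <= domC Kd q * sparse_op m v T q x].
Proof.
move: {2}#|P| (leqnn #|P|) => n; elim: n P => [|n IHn] P Pn PD.
  by have [x xP] := nonempty PD; move: Pn; rewrite leqn0 cards_eq0 => /eqP Pz; rewrite Pz inE in xP.
have /choice[F HF] : forall Q, exists T : {set {set X}}, Q \in stops P ->
   [/\ T \subset cone D Q, Q \in T, sparse m T &
   forall x, x \in Q -> Uq Q x <= domC Kd q * sparse_op m v T q x].
  move=> Q; have [Qs|Qs] := boolP (Q \in stops P); last by exists finset.set0.
  have [QD _ _] := stopsP Qs.
  have Qn : (#|Q| <= n)%N.
    by rewrite -ltnS; apply: leq_trans Pn; apply: proper_card; exact: stops_proper.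
  by have [T HT] := IHn Q Qn QD; exists T.
pose T := P |: \bigcup_(Q in stops P) F Q.
have C1 := domC_ge1.
have TE Z : Z \in T -> Z = P \/ exists2 Q, Q \in stops P & Z \in F Q.
  by rewrite !inE => /orP[/eqP ->|/finset.bigcupP[Q Qs ZF]]; [left|right; exists Q].
have FD Q Z : Q \in stops P -> Z \in F Q -> Z \in D /\ Z \subset Q.
  move=> Qs ZF; have [/fintype.subsetP /(_ _ ZF)] := HF _ Qs.
  by rewrite inE => /andP[].
have TD : T \subset cone D P.
  apply/fintype.subsetP => Z /TE[->|[Q Qs ZF]]; rewrite inE ?PD ?fintype.subxx //.
  have [-> ZQ] := FD _ _ Qs ZF; have [_ QP _] := stopsP Qs.
  exact: fintype.subset_trans ZQ QP.
have PT : P \in T by rewrite !inE eqxx.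
exists T; split => //.
- move=> Z /TE[->|[Q Qs ZF]].
    apply: le_trans (vector_weak PD); apply: mass_le => //.
    apply/finset.bigcupsP => Z' /andP[/TE[->|[Q Qs ZF]]].
      by rewrite finset.properEneq eqxx.
    move=> _; have [_ ZQ] := FD _ _ Qs ZF; apply: fintype.subset_trans ZQ _.
    have [_ QP bQ] := stopsP Qs; apply/fintype.subsetP => x xQ; rewrite inE.
    by rewrite (fintype.subsetP QP) //=; apply: lt_le_trans bQ (amax_Uq P xQ).
  have [FQ QF sF _] := HF _ Qs; apply: le_trans (sF _ ZF); apply: mass_le => //.
  have [ZD ZQ] := FD _ _ Qs ZF; have QpP := stops_proper PD Qs.
  apply/finset.bigcupsP => Z' /andP[/TE[->|[Q' Qs' ZF']] Z'Z].
    have := proper_card (proper_sub_trans Z'Z ZQ).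
    by rewrite ltnNge subset_leq_card // proper_sub.
  apply: finset.bigcup_sup; rewrite Z'Z andbT.
  suff -> : Q = Q' by [].
  apply/eqP/negPn/negP => QQ'.
  have [Z'D Z'Q'] := FD _ _ Qs' ZF'; have [x xZ'] := nonempty Z'D.
  have SD : [set Q0 in cone D P | bad P Q0] \subset D.
    by apply/fintype.subsetP => A; rewrite !inE => /andP[/andP[]].
  have := finset.trivIsetP (tops_trivIset (laminar_sub SD lD)) _ _ Qs Qs' QQ'.
  have xQ := fintype.subsetP ZQ _ (fintype.subsetP (proper_sub Z'Z) _ xZ').
  move=> /fintype.disjointFr /(_ xQ).
  by rewrite (fintype.subsetP Z'Q').
- move=> x xP; have opP : dens m v P `^ q <= sparse_op m v T q x.
    by rewrite /sparse_op (bigD1 P) /= ?PT // lerDl sumr_ge0 // => Q _; exact: powR_ge0.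
  have [/fintype.existsP[Q /andP[Qs xQ]]|/fintype.existsPn none] := boolP [exists Q, (Q \in stops P) && (x \in Q)].
    apply: le_trans (stop_step PD Qs xQ) _.
    have [_ _ _ /(_ _ xQ) h] := HF _ Qs.
    apply: le_trans (lerD (lexx _) h) _; rewrite -mulrDr ler_wpM2l ?(le_trans ler01) //.
    rewrite /sparse_op [leRHS](bigD1 P) /= ?PT // lerD2l; apply: ler_sum_sub => [Z|Z _]; last exact: powR_ge0.
    move=> /andP[ZF ->]; have [_ ZQ] := FD _ _ Qs ZF.
    have -> : Z \in T by rewrite !inE; apply/orP; right; apply/finset.bigcupP; exists Q.
    apply/eqP => ZP; have := stops_proper PD Qs; rewrite -ZP => /proper_card.
    by rewrite ltnNge subset_leq_card.
  apply: (@le_trans _ _ (domC Kd q * dens m v P `^ q)); last first.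
    by rewrite ler_wpM2l ?(le_trans ler01).
  rewrite leNgt; apply/negP => h.
  have bx : finset.set1 x \in [set Q in cone D P | bad P Q].
    rewrite !inE D1 finset.sub1set xP /=; apply: lt_le_trans h _.
    apply: ler_sum => j _; apply: powR_le; [exact: ltW|exact: dyadic_max_ge0|].
    apply: dyadic_max_le => [|Q QP xQ]; first exact: bigmax_ge_id.
    by apply: (le_bigmax_cond 0); rewrite QP finset.sub1set.
  have [Q Qs /fintype.subsetP /(_ x)] := tops_above bx.
  rewrite inE eqxx => /(_ isT) xQ; have := none Q.
  by rewrite xQ andbT => /negP; apply.
Qed.

End Sparse_domination.

(** * Two-weight bounds on a finite dyadic system *)

Section Finite_model.
Context {R : realType} {X J : finType}.
Variables (m w sigma Phi : X -> R) (D : {set {set X}}) (psi : J -> X -> R).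
Variables (Kd A K W p q : R).
Hypotheses (p1 : 1 < p) (q1 : 1 < q) (Kd1 : 1 <= Kd).
Hypotheses (A0 : 0 <= A) (K0 : 0 <= K) (W1 : 1 <= W).
Hypotheses (m0 : forall x, 0 < m x) (w0 : forall x, 0 <= w x).
Hypotheses (s0 : forall x, 0 <= sigma x) (P0 : forall x, 0 <= Phi x).
Hypotheses (psi0 : forall j x, 0 <= psi j x).
Hypothesis (psiPhi :
  forall x, \sum_j psi j x `^ q <= (Phi x * sigma x / m x) `^ q).
Hypotheses (lD : laminar D) (D0 : finset.set0 \notin D).
Hypotheses (D1 : forall x, finset.set1 x \in D) (DT : [set: X] \in D).
Hypothesis (doubling : forall P Q, P \in D -> Q \in D -> Q \proper P ->
  exists Q', [/\ Q' \in D, Q \proper Q', Q' \subset P & mass m Q' <= Kd * mass m Q]).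
Hypothesis (hA : forall P, P \in D -> dens m w P * dens m sigma P `^ (p - 1) <= A).
Hypothesis (hK : forall P, P \in D ->
  \sum_(x in P) m x * dyadic_max (cone D P) m sigma x <= K * mass sigma P).
Hypothesis (hW : forall P, P \in D ->
  \sum_(x in P) m x * dyadic_max (cone D P) m w x <= W * mass w P).

Let U x := \sum_j dyadic_max D m (fun y => psi j y * m y) x `^ q.
Let E := \sum_x sigma x * Phi x `^ p.

Let E0 : 0 <= E.
Proof. by apply: sumr_ge0 => x _; rewrite mulr_ge0 ?powR_ge0. Qed.

Let dominated : exists T : {set {set X}}, [/\ T \subset D, sparse m T &
  forall x, U x <= domC Kd q * sparse_op m (fun x => Phi x * sigma x) T q x].
Proof.
have Psi0 x : 0 <= Phi x * sigma x / m x by rewrite divr_ge0 ?mulr_ge0 // ltW.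
have [T [TD _ sT dom]] := sparse_domination q1 Kd1 m0 lD D0 D1 doubling psi0 Psi0 psiPhi DT.
have cT : cone D [set: X] = D.
  by apply/finset.setP => P; rewrite inE finset.subsetT andbT.
exists T; split => //; first by rewrite -cT.
move=> x; have := dom x (finset.in_setT x).
rewrite /Uq cT; congr (_ <= _ * _); rewrite /sparse_op; apply: eq_bigr => P _.
by congr (dens m _ P `^ q); apply: funext => y; rewrite divfK // gt_eqF.
Qed.

Let carleson (u : X -> R) B (T : {set {set X}}) (P : {set X}) : (forall x, 0 <= u x) ->
  (forall P, P \in D -> \sum_(x in P) m x * dyadic_max (cone D P) m u x <= B * mass u P) ->
  T \subset D -> sparse m T -> P \in T ->
  \sum_(Q in cone T P) mass u Q <= 2 * B * mass u P.
Proof.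
move=> u0 hB TD sT PT; apply: (sparse_carleson_ainfty (laminar_sub TD lD) TD m0 u0 sT).
by apply: hB; exact: (fintype.subsetP TD).
Qed.

Definition strongC (Kd p q : R) := domC Kd q `^ (p / q) *
  Num.max (gtC p q) (2 `^ p * (geoC p * doobC p)) * (2 + 2 `^ Num.max (p / q - 1) 0).

Lemma finite_strong : \sum_x w x * U x `^ (p / q) <=
  strongC Kd p q * A * (K + W `^ Num.max (p / q - 1) 0) * E.
Proof.
have [T [TD sT dom]] := dominated.
have p0 : 0 < p by exact: lt_trans p1.
have q0 : 0 < q by exact: lt_trans q1.
have C0 : 0 <= domC Kd q by exact: le_trans (domC_ge1 q1 Kd1).
have D0' : finset.set0 \notin T by apply: contra D0; exact: (fintype.subsetP TD).
have hA' P : P \in T -> dens m w P * dens m sigma P `^ (p - 1) <= A.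
  by move=> /(fintype.subsetP TD); exact: hA.
have K2 : 0 <= 2 * K by rewrite mulr_ge0.
have W2 : 1 <= 2 * W by move: W1; lra.
have main := sparse_op_strong p1 q1 A0 K2 W2 (laminar_sub TD lD) D0' m0 w0 s0 P0 sT hA'
  (fun P => carleson s0 hK TD sT) (fun P => carleson w0 hW TD sT).
set C := Num.max (gtC p q) _ in main *; set e := Num.max (p / q - 1) 0 in main *.
have Cp : 0 <= C.
  rewrite le_max; apply/orP; right; apply: mulr_ge0; [exact: powR_ge0|exact: geoC_doobC_ge0].
apply: (@le_trans _ _ (domC Kd q `^ (p / q) * \sum_x w x * sparse_op m (fun x => Phi x * sigma x) T q x `^ (p / q))).
  rewrite mulr_sumr; apply: ler_sum => x _; rewrite mulrCA ler_wpM2l //.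
  rewrite -powRM //; last by apply: sumr_ge0 => P _; exact: powR_ge0.
  apply: powR_le; [by rewrite ltW // divr_gt0| |exact: dom].
  by apply: sumr_ge0 => j _; exact: powR_ge0.
apply: le_trans (ler_wpM2l (powR_ge0 _ _) main) _.
rewrite /strongC -/C -/e -/E powRM //; last by apply: le_trans W1.
set We := W `^ e; set e2 := 2 `^ e; set c := domC _ _ `^ _.
have We0 : 0 <= We by exact: powR_ge0.
have e20 : 0 <= e2 by exact: powR_ge0.
have c0 : 0 <= c by exact: powR_ge0.
have -> : c * C * (2 + e2) * A * (K + We) * E = c * (C * A * ((2 + e2) * (K + We)) * E) by ring.
rewrite ler_wpM2l // ler_wpM2r // ler_wpM2l ?mulr_ge0 //.
have h1 : 0 <= e2 * K by exact: mulr_ge0.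
by rewrite mulrDl !mulrDr; lra.
Qed.

Definition weakC (Kd p q : R) := (2 * domC Kd q) `^ (p / q) * 2 `^ p *
  Num.max (2 `^ p * geoC p + 2 `^ q * geoC (q - p))
          (weak_gtC p q * 2 `^ (p / q - 1)).

Lemma finite_weak (t : R) : p <> q -> 0 < t ->
  t `^ p * mass w [set x | t `^ q < U x] <=
  weakC Kd p q * A * W `^ Num.max (p / q - 1) 0 * E.
Proof.
move=> /eqP pq t0; have [T [TD sT dom]] := dominated.
have p0 : 0 < p by exact: lt_trans p1.
have q0 : 0 < q by exact: lt_trans q1.
have C0 : 0 < domC Kd q by exact: lt_le_trans (domC_ge1 q1 Kd1).
have W0 : 0 < W by exact: lt_le_trans W1.
set ps := (fun x => Phi x * sigma x) in dom.
pose S := [set P in T | 0 < dens m ps P].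
have ST : S \subset T by apply/fintype.subsetP => P; rewrite inE => /andP[].
have SD : S \subset D := fintype.subset_trans ST TD.
have sS : sparse m S by apply: sparse_sub ST sT => x; exact: ltW.
have ps0 x : 0 <= ps x by exact: mulr_ge0.
have opS x : sparse_op m ps T q x = sparse_op m ps S q x.
  rewrite /sparse_op (bigID (fun P => 0 < dens m ps P)) /=.
  rewrite [X in _ + X]big1 ?addr0 => [|P /andP[_]].
    by apply: eq_bigl => P; rewrite inE -!andbA [X in _ && X]andbC.
  rewrite lt0r dens_ge0 // => [|y]; last exact: ltW.
  by rewrite andbT negbK => /eqP ->; rewrite powR0 // gt_eqF.
have hA' P : P \in S -> dens m w P * dens m sigma P `^ (p - 1) <= A.
  by move=> /(fintype.subsetP SD); exact: hA.
have bp P : P \in S -> 0 < dens m ps P by rewrite inE => /andP[].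
pose c := 2 * domC Kd q.
have c0 : 0 < c by rewrite mulr_gt0.
(* The constant of the sparse domination is moved into the height. *)
pose t' := t * c `^ (- q^-1).
have t'0 : 0 < t' by rewrite mulr_gt0 ?powR_gt0.
have tq : 2 * t' `^ q * domC Kd q = t `^ q.
  rewrite /t' powRM ?powR_ge0 ?(ltW t0) // -powRrM mulNr mulVf ?gt_eqF //.
  rewrite powR_inv1 ?(ltW c0) // /c; field; exact: lt0r_neq0.
have tp : t `^ p = c `^ (p / q) * t' `^ p.
  rewrite /t' powRM ?powR_ge0 ?(ltW t0) // -powRrM mulrCA -powRD ?(gt_eqF c0) ?implybT //.
  by rewrite (_ : p / q + - q^-1 * p = 0) ?powRr0 ?mulr1 //; ring.
have sub : [set x | t `^ q < U x] \subset [set x | 2 * t' `^ q < sparse_op m ps S q x].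
  apply/fintype.subsetP => x; rewrite !inE => h.
  have := lt_le_trans h (dom x); rewrite -tq opS [_ * domC _ _]mulrC ltr_pM2l //.
have E' : \sum_x Phi x `^ p * sigma x = E by apply: eq_bigr => x _; rewrite mulrC.
have WE : 0 <= A * E by exact: mulr_ge0.
rewrite tp -mulrA; apply: (@le_trans _ _ (c `^ (p / q) * (t' `^ p * mass w [set x | 2 * t' `^ q < sparse_op m ps S q x]))).
  rewrite ler_wpM2l ?powR_ge0 // ler_wpM2l ?powR_ge0 //; exact: mass_le.
rewrite /weakC -/c -!mulrA ler_wpM2l ?powR_ge0 //.
set Cm := Num.max (_ + _) _.
have fin : Cm * W `^ Num.max (p / q - 1) 0 * (2 `^ p * A * E) =
   2 `^ p * (Cm * (A * (W `^ Num.max (p / q - 1) 0 * E))) by ring.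
rewrite -fin; have [lt|gt] := ltP p q.
  apply: le_trans (sparse_op_weak_lt p1 A0 (laminar_sub SD lD) m0 w0 s0 P0 sS hA' bp lt t'0) _.
  rewrite E' max_r; last by rewrite subr_le0 ler_pdivrMr // mul1r ltW.
  rewrite powRr0 mulr1 ler_wpM2r ?mulr_ge0 ?powR_ge0 //.
  by rewrite le_max lexx.
have qp : q < p by rewrite lt_neqAle eq_sym pq.
have W2 : 1 <= 2 * W by move: W1; lra.
apply: le_trans (sparse_op_weak_gt p1 A0 (laminar_sub SD lD) m0 w0 s0 P0 sS hA' bp q0 qp t'0 W2 (fun P => carleson w0 hW SD sS)) _.
rewrite E' max_l; last by rewrite subr_ge0 ler_pdivlMr // mul1r.
rewrite ler_wpM2r //; first by rewrite -mulrA mulr_ge0 ?powR_ge0.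
rewrite powRM ?(ltW W0) // mulrA ler_wpM2r ?powR_ge0 //.
by rewrite le_max lexx orbT.
Qed.

End Finite_model.

Local Close Scope set_scope.
Local Open Scope classical_set_scope.
Local Open Scope ring_scope.
Local Open Scope ereal_scope.

(** * Lower integrals and null sets *)

Section Lower_integral.
Import HBNNSimple.
Context d (T : measurableType d) (R : realType).
Variable mu : {measure set T -> \bar R}.
Implicit Types (D N : set T) (f g : T -> \bar R).

(** The integral of a nonnegative function is the supremum over the measurable
    simple functions below it, so it is monotone without measurability. *)
Lemma ge0_integral_mono D f g : (forall x, D x -> 0 <= f x) ->
  (forall x, D x -> f x <= g x) -> \int[mu]_(x in D) f x <= \int[mu]_(x in D) g x.
Proof.
move=> f0 fg; have g0 x : D x -> 0 <= g x.
  by move=> Dx; exact: le_trans (f0 _ Dx) (fg _ Dx).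
rewrite !ge0_integralE //; apply: ereal_sup_le => _ [h hf <-].
exists h => // x; apply: le_trans (hf x) _; rewrite !patchE.
by case: ifPn => // /set_mem; exact: fg.
Qed.

(** Cutting off a simple function on the null set [N] does not change its
    integral. *)
Lemma le_integral_off_null D N f g : measurable N -> mu N = 0 ->
  (forall x, D x -> 0 <= f x) -> (forall x, D x -> 0 <= g x) ->
  (forall x, D x -> ~ N x -> f x <= g x) ->
  \int[mu]_(x in D) f x <= \int[mu]_(x in D) g x.
Proof.
move=> mN N0 f0 g0 fg; rewrite !ge0_integralE //.
apply: ge_ereal_sup => _ [h hf <-].
pose h' := mul_nnsfun h (indic_nnsfun R (measurableC mN)).
rewrite -integralT_nnsfun.
apply: (@le_trans _ _ (\int[mu]_x (h' x)%:E)).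
  rewrite le_eqVlt; apply/orP; left; apply/eqP.
  apply: ge0_ae_eq_integral => //.
  - by apply/measurable_EFinP.
  - by apply/measurable_EFinP.
  - by move=> x _; rewrite lee_fin.
  - by move=> x _; rewrite lee_fin.
  exists N; split => // x /= hx; apply: contrapT => Nx; apply: hx => _.
  by rewrite /= mindicE mem_set // mulr1.
rewrite integralT_nnsfun; apply: ereal_sup_ubound; exists h' => //= x.
rewrite mindicE; case: (pselect (N x)) => Nx.
  rewrite memNset ?mulr0; last by move=> /(_ Nx).
  by rewrite patchE; case: ifPn => // /set_mem /g0.
rewrite mem_set // mulr1; apply: le_trans (hf x) _; rewrite !patchE.
by case: ifPn => // /set_mem Dx; exact: fg.
Qed.

Lemma integral_off_null D N f g : measurable N -> mu N = 0 ->
  (forall x, D x -> 0 <= f x) -> (forall x, D x -> 0 <= g x) ->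
  (forall x, D x -> ~ N x -> f x = g x) ->
  \int[mu]_(x in D) f x = \int[mu]_(x in D) g x.
Proof.
move=> mN N0 f0 g0 fg; apply/eqP; rewrite eq_le; apply/andP; split;
  apply: (le_integral_off_null mN N0) => // x Dx Nx; by rewrite fg.
Qed.

End Lower_integral.

Section Weighted_congruence.
Context (R : realType) (n : nat).
Implicit Types (f g w sigma : n.-tuple R -> R) (F G : n.-tuple R -> \bar R).
Local Notation mu := (lebesgue R n).
Variable N : set (n.-tuple R).
Hypotheses (mN : measurable N) (N0 : mu N = 0).

Lemma average_congr Q f g : (forall x, ~ N x -> `|f x| = `|g x|)%R ->
  average Q f = average Q g.
Proof.
move=> fg; rewrite /average; congr (_ * _).
by apply: (integral_off_null mN N0) => // x _ /fg ->.
Qed.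

Lemma maximal_congr f g : (forall x, ~ N x -> `|f x| = `|g x|)%R ->
  maximal f = maximal g.
Proof.
move=> fg; apply/funext => x; rewrite /maximal; congr ereal_sup.
by apply: eq_imagel => Q _; exact: average_congr.
Qed.

Lemma Lp_norm_congr p w w' F G : (forall x, 0 <= w x)%R -> (forall x, 0 <= w' x)%R ->
  (forall x, ~ N x -> w x = w' x) -> (forall x, ~ N x -> `|F x| = `|G x|) ->
  Lp_norm p w F = Lp_norm p w' G.
Proof.
move=> w0 w'0 ww FG; rewrite /Lp_norm; congr (_ `^ _).
apply: (integral_off_null mN N0) => [x _|x _|x _ Nx].
- by rewrite mule_ge0 ?poweR_ge0 ?lee_fin.
- by rewrite mule_ge0 ?poweR_ge0 ?lee_fin.
- by rewrite ww // FG.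
Qed.

Lemma weak_Lp_norm_congr p w w' F : (forall x, 0 <= w x)%R -> (forall x, 0 <= w' x)%R ->
  (forall x, ~ N x -> w x = w' x) ->
  weak_Lp_norm p w F = weak_Lp_norm p w' F.
Proof.
move=> w0 w'0 ww; rewrite /weak_Lp_norm; congr ereal_sup.
apply: eq_imagel => t _; congr (_ * _ `^ _).
by apply: (integral_off_null mN N0) => [x _|x _|x _ /ww ->] //; rewrite lee_fin.
Qed.

Lemma Ap_constant_congr p w w' s s' :
  (forall x, ~ N x -> `|w x| = `|w' x|)%R -> (forall x, ~ N x -> `|s x| = `|s' x|)%R ->
  Ap_constant p w s = Ap_constant p w' s'.
Proof.
move=> ww ss; rewrite /Ap_constant; congr ereal_sup.
by apply: eq_imagel => Q _; rewrite (average_congr Q ww) (average_congr Q ss).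
Qed.

Lemma Ainfty_constant_congr w w' : (forall x, 0 <= w x)%R -> (forall x, 0 <= w' x)%R ->
  (forall x, ~ N x -> w x = w' x) ->
  Ainfty_constant w = Ainfty_constant w'.
Proof.
move=> w0 w'0 ww.
pose G (v : n.-tuple R -> R) Q := (\int[mu]_(x in Q) (v x)%:E)^-1 *
  \int[mu]_(x in Q) maximal (v \_ Q) x.
change (ereal_sup [set G w Q | Q in [set Q | is_cube Q]] =
  ereal_sup [set G w' Q | Q in [set Q | is_cube Q]]).
suff -> : G w = G w' by [].
apply/funext => Q; rewrite /G.
have -> : \int[mu]_(x in Q) (w x)%:E = \int[mu]_(x in Q) (w' x)%:E.
  by apply: (integral_off_null mN N0) => [x _|x _|x _ /ww ->] //; rewrite lee_fin.
have -> : maximal (w \_ Q) = maximal (w' \_ Q) :> (n.-tuple R -> \bar R).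
  by apply: maximal_congr => x Nx; rewrite !patchE; case: ifP => //; rewrite ww.
by [].
Qed.

End Weighted_congruence.

Section Borel_representatives.
Context (R : realType) (n : nat).
Local Notation mu := (lebesgue R n).

Lemma lebesgue_measurable_null (f : n.-tuple R -> R) : lebesgue_measurable f ->
  exists g N, [/\ measurable_fun setT g, measurable N, mu N = 0 &
    forall x, ~ N x -> f x = g x].
Proof.
move=> [g mg [N [mN N0 hN]]]; exists g, N; split => // x Nx.
by apply: contrapT => h; apply: Nx; apply: hN.
Qed.

Lemma common_representatives (w sigma : n.-tuple R -> R) (f : nat -> n.-tuple R -> R) :
  lebesgue_measurable w -> lebesgue_measurable sigma ->
  (forall j, lebesgue_measurable (f j)) ->
  exists (w' sigma' : n.-tuple R -> R) (f' : nat -> n.-tuple R -> R) N,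
    [/\ [/\ measurable_fun setT w', measurable_fun setT sigma' &
          forall j, measurable_fun setT (f' j)],
        [/\ measurable N & mu N = 0],
        [/\ forall x, (0 <= w' x)%R, forall x, (0 <= sigma' x)%R &
          forall j x, (0 <= f' j x)%R] &
        forall x, ~ N x -> [/\ `|w x| = w' x, `|sigma x| = sigma' x &
          forall j, `|f j x| = f' j x]%R].
Proof.
move=> /lebesgue_measurable_null[w' [Nw [mw mNw Nw0 hw]]].
move=> /lebesgue_measurable_null[s' [Ns [ms mNs Ns0 hs]]].
move=> hf; have /choice[g hg] := fun j => lebesgue_measurable_null (hf j).
have /choice[Nf hNf] := hg.
have mabs (h : n.-tuple R -> R) : measurable_fun setT h ->
    measurable_fun setT (fun x => `|h x|%R).
  by move=> mh; exact: measurableT_comp.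
exists (fun x => `|w' x|%R), (fun x => `|s' x|%R), (fun j x => `|g j x|%R).
have mU : measurable (\bigcup_j Nf j).
  by apply: bigcup_measurable => j _; have [] := hNf j.
exists (Nw `|` Ns `|` \bigcup_j Nf j); split => //.
- split; [exact: mabs|exact: mabs|move=> j; apply: mabs].
  by have [] := hNf j.
- split; first by apply: measurableU => //; exact: measurableU.
  apply/eqP; rewrite eq_le measure_ge0 andbT.
  apply: (@le_trans _ _ (mu (Nw `|` Ns) + mu (\bigcup_j Nf j))).
    by apply: measureU2 => //; exact: measurableU.
  rewrite -[leRHS]adde0 leeD //.
    apply: (@le_trans _ _ (mu Nw + mu Ns)); first exact: measureU2.
    by rewrite Nw0 Ns0 adde0.
  apply: (@le_trans _ _ (\sum_(0 <= j <oo) mu (Nf j))).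
    by apply: measure_sigma_subadditive => // j; have [] := hNf j.
  by rewrite eseries0 // => j _ _; have [] := hNf j.
- move=> x Nx; split.
  + by rewrite hw // => h; apply: Nx; left; left.
  + by rewrite hs // => h; apply: Nx; left; right.
  + move=> j; have [_ _ _ -> //] := hNf j => h; apply: Nx; right; by exists j.
Qed.

End Borel_representatives.

(** * Boxes and dyadic grids *)

Section Boxes.
Context (R : realType) (n : nat).
Local Notation mu := (lebesgue R n).
Implicit Types (a : 'I_n -> R) (s : R).

(** Half-open boxes tile exactly; closed ones are the cubes of the theorem. *)
Definition rbox a s : set (n.-tuple R) :=
  [set z | forall i, (a i <= tnth z i < a i + s)%R].

Definition cbox a s : set (n.-tuple R) :=
  [set z | forall i, (a i <= tnth z i <= a i + s)%R].

Lemma measurable_prod_set (A : 'I_n -> set R) : (forall i, measurable (A i)) ->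
  measurable [set z : n.-tuple R | forall i, A i (tnth z i)].
Proof.
move=> mA; rewrite (_ : mkset _ = \bigcap_(i in setT)
  ((fun z : n.-tuple R => tnth z i) @^-1` A i)); last first.
  by apply/seteqP; split => z /= hz => [i _|i]; apply: hz.
apply: fin_bigcap_measurable => [|i _]; first exact: finite_finset.
by rewrite -[X in measurable X]setTI; exact: measurable_tnth.
Qed.

Lemma rboxE a s : rbox a s = [set z | forall i, `[a i, (a i + s)%R[%classic (tnth z i)].
Proof.
by apply/seteqP; split => z hz i; have := hz i; rewrite /= in_itv /=.
Qed.

Lemma cboxE a s : cbox a s = [set z | forall i, `[a i, (a i + s)%R]%classic (tnth z i)].
Proof.
by apply/seteqP; split => z hz i; have := hz i; rewrite /= in_itv /=.
Qed.

Lemma measurable_rbox a s : measurable (rbox a s).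
Proof.
rewrite rboxE; apply: (@measurable_prod_set (fun i => `[a i, (a i + s)%R[%classic)).
by move=> i; exact: measurable_itv.
Qed.

Lemma measurable_cbox a s : measurable (cbox a s).
Proof.
rewrite cboxE; apply: (@measurable_prod_set (fun i => `[a i, (a i + s)%R]%classic)).
by move=> i; exact: measurable_itv.
Qed.

Lemma prod_side s : \prod_(i < n) s%:E = (s ^+ n)%:E.
Proof. by rewrite prodEFin prodr_const card_ord. Qed.

Lemma mu_rbox a s : (0 < s)%R -> mu (rbox a s) = (s ^+ n)%:E.
Proof.
move=> s0; rewrite rboxE (lebesgue_setX (A := fun i => `[a i, (a i + s)%R[%classic)); last by move=> i; exact: measurable_itv.
rewrite -prod_side; apply: eq_bigr => i _.
by rewrite lebesgue_measure_itv /= lte_fin ltrDl s0 -EFinB addrAC subrr add0r.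
Qed.

Lemma mu_cbox a s : (0 < s)%R -> mu (cbox a s) = (s ^+ n)%:E.
Proof.
move=> s0; rewrite cboxE (lebesgue_setX (A := fun i => `[a i, (a i + s)%R]%classic)); last by move=> i; exact: measurable_itv.
rewrite -prod_side; apply: eq_bigr => i _.
by rewrite lebesgue_measure_itv /= lte_fin ltrDl s0 -EFinB addrAC subrr add0r.
Qed.

Lemma rbox_sub_cbox a s : rbox a s `<=` cbox a s.
Proof. by move=> z hz i; have /andP[-> /ltW ->] := hz i. Qed.

Lemma is_cube_cbox a s : (0 < s)%R -> is_cube (cbox a s).
Proof.
move=> s0; exists [tuple a i | i < n], s; split => //.
by apply/seteqP; split => z hz i; have := hz i; rewrite tnth_mktuple.
Qed.

Lemma is_cubeP Q : is_cube Q -> exists a s, (0 < s)%R /\ Q = cbox a s.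
Proof. by move=> [a [s [s0 ->]]]; exists (tnth a), s. Qed.

Lemma integral_cbox_rbox a s (g : n.-tuple R -> \bar R) : (0 < s)%R ->
  measurable_fun setT g -> (forall z, 0 <= g z) ->
  \int[mu]_(z in cbox a s) g z = \int[mu]_(z in rbox a s) g z.
Proof.
move=> s0 mg g0.
have mD : measurable (cbox a s `\` rbox a s).
  by apply: measurableD; [exact: measurable_cbox|exact: measurable_rbox].
have D0 : mu (cbox a s `\` rbox a s) = 0.
  have fin : mu (cbox a s) < +oo by rewrite mu_cbox // ltry.
  have := measureD (measurable_cbox a s) (measurable_rbox a s) fin.
  rewrite setIidr; last exact: rbox_sub_cbox.
  move=> e; have {}e : mu (cbox a s `\` rbox a s) = mu (cbox a s) - mu (rbox a s) := e.
  by rewrite e mu_cbox // mu_rbox // subee.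
rewrite [LHS]integral_mkcond [RHS]integral_mkcond.
apply: (integral_off_null mD D0) => [z _|z _|z _ hz].
- by rewrite patchE; case: ifP.
- by rewrite patchE; case: ifP.
rewrite !patchE; have [hr|hr] := pselect (rbox a s z).
  by rewrite !mem_set //; exact: rbox_sub_cbox.
have hc : ~ cbox a s z by move=> hc; apply: hz.
by rewrite !memNset.
Qed.

End Boxes.

Section Grid.
Context (R : realType) (n : nat).
Local Notation mu := (lebesgue R n).
Variables (h : R) (c : 'I_n -> R) (M : nat).
Hypothesis h0 : (0 < h)%R.

Definition cell := {ffun 'I_n -> 'I_(2 ^ M)}.
Implicit Types (x y : cell) (k : nat).

(** The cells of the grid are the boxes of side [h] whose coordinates run over
    0, ..., 2^M - 1, starting from the corner [c]. *)
Definition Box x := rbox (fun i => c i + h * (x i)%:R)%R h.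

(** The cells of the dyadic cube of generation [k] around [x]. *)
Definition cyl k x : {set cell} :=
  finset (fun y => [forall i, (y i %/ 2 ^ k == x i %/ 2 ^ k)%N]).

Definition cubes : {set {set cell}} :=
  finset (fun P => [exists k : 'I_M.+1, [exists x : cell, P == cyl k x]]).

Definition side k : R := (h * (2 ^ k)%:R)%R.

Definition corner k x i : R := (c i + side k * (x i %/ 2 ^ k)%:R)%R.

Lemma side_gt0 k : (0 < side k)%R.
Proof. by rewrite mulr_gt0 // ltr0n expn_gt0. Qed.

Lemma cylP k x y : reflect (forall i, y i %/ 2 ^ k = x i %/ 2 ^ k)%N (y \in cyl k x).
Proof.
rewrite inE; apply: (iffP forallP) => [e i|e i]; first exact/eqP.
by apply/eqP.
Qed.

Lemma cyl_self k x : x \in cyl k x.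
Proof. exact/cylP. Qed.

Lemma cubesP (P : {set cell}) : P \in cubes -> exists k x, (k <= M)%N /\ P = cyl k x.
Proof.
rewrite inE => /existsP[k /existsP[x /eqP ->]]; exists (nat_of_ord k), x; split => //.
by rewrite -ltnS ltn_ord.
Qed.

Lemma cyl_cubes k x : (k <= M)%N -> cyl k x \in cubes.
Proof.
move=> kM; rewrite inE; apply/existsP; exists (Ordinal (kM : (k < M.+1)%N)).
by apply/existsP; exists x.
Qed.

Lemma cyl_eq k x y : y \in cyl k x -> cyl k y = cyl k x.
Proof.
move=> /cylP yx; apply/finset.setP => z; apply/cylP/cylP => e i; rewrite e //.
Qed.

Lemma cyl_le k l x : (k <= l)%N -> cyl k x \subset cyl l x.
Proof.
move=> kl; apply/fintype.subsetP => y /cylP e; apply/cylP => i.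
by rewrite -(subnKC kl) expnD !divnMA e.
Qed.

Lemma cubes_set0 : finset.set0 \notin cubes.
Proof.
apply/negP => /cubesP[k [x [_ e]]]; have := cyl_self k x.
by rewrite -e finset.in_set0.
Qed.

Lemma cubes_laminar : laminar cubes.
Proof.
move=> P Q /cubesP[k [x [_ ->]]] /cubesP[l [y [_ ->]]].
have [|] := boolP [disjoint cyl k x & cyl l y]; first by rewrite !orbT.
move=> /pred0Pn[z /= /andP[zx zy]].
rewrite -(cyl_eq zx) -(cyl_eq zy); have [kl|lk] := leqP k l.
  by rewrite cyl_le.
by rewrite (cyl_le _ (ltnW lk)) !orbT.
Qed.

Lemma cubes_set1 x : finset.set1 x \in cubes.
Proof.
suff -> : finset.set1 x = cyl 0 x by exact: cyl_cubes.
apply/finset.setP => y; rewrite finset.in_set1; apply/eqP/cylP => [->//|e].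
by apply/ffunP => i; apply/val_inj; have := e i; rewrite expn0 !divn1.
Qed.

Lemma cubes_setT x : cyl M x = finset.setTfor cell.
Proof.
apply/finset.setP => y; rewrite finset.in_setT; apply/cylP => i.
by rewrite !divn_small.
Qed.

Lemma cell_exists z k x : (k <= M)%N -> rbox (corner k x) (side k) z ->
  exists2 y, y \in cyl k x & Box y z.
Proof.
move=> kM hz.
pose t i := ((tnth z i - c i) / h)%R.
pose e i := (x i %/ 2 ^ k)%N.
have p2 : (0 < 2 ^ k)%N by rewrite expn_gt0.
have ti i : ((2 ^ k * e i)%:R <= t i < (2 ^ k * (e i).+1)%:R)%R.
  have := hz i; rewrite /corner /side -/(e i) => /andP[h1 h2].
  rewrite /t ler_pdivlMr // ltr_pdivrMr // !natrM -natr1; apply/andP; split; lra.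
have t0 i : (0 <= t i)%R by have /andP[h1 _] := ti i; apply: le_trans h1; rewrite ler0n.
have tr i := truncn_itv (t0 i).
have lo i : (2 ^ k * e i <= Num.truncn (t i))%N.
  have /andP[h1 _] := ti i; have /andP[_ h2] := tr i.
  by rewrite -ltnS -(ltr_nat R); exact: le_lt_trans h1 h2.
have hi i : (Num.truncn (t i) < 2 ^ k * (e i).+1)%N.
  have /andP[_ h1] := ti i; have /andP[h2 _] := tr i.
  by rewrite -(ltr_nat R); exact: le_lt_trans h2 h1.
have lt2M i : (Num.truncn (t i) < 2 ^ M)%N.
  apply: leq_trans (hi i) _; rewrite -(subnKC kM) expnD leq_mul2l.
  by rewrite ltn_divLR // -expnD addnC subnKC // ltn_ord orbT.
exists [ffun i => Ordinal (lt2M i)].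
  apply/cylP => i; rewrite ffunE /=; apply/eqP; rewrite -/(e i) eqn_leq.
  by rewrite -ltnS ltn_divLR // leq_divRL // mulnC hi mulnC lo.
move=> i; rewrite ffunE /=; have /andP[h1 h2] := tr i; rewrite /t in h1 h2.
rewrite ler_pdivlMr // in h1; rewrite ltr_pdivrMr // -natr1 in h2.
by apply/andP; split; lra.
Qed.

Lemma Box_sub_cyl z k x y : y \in cyl k x -> Box y z -> rbox (corner k x) (side k) z.
Proof.
move=> /cylP yx hz i; have /andP[h1 h2] := hz i; rewrite /corner -yx /side.
have p2 : (0 < 2 ^ k)%N by rewrite expn_gt0.
have l1 : (2 ^ k * (y i %/ 2 ^ k) <= y i)%N by rewrite mulnC leq_divM.
have l2 : ((y i).+1 <= 2 ^ k * (y i %/ 2 ^ k).+1)%N by rewrite mulnC ltn_ceil.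
have r1 : (h * (2 ^ k * (y i %/ 2 ^ k))%:R <= h * (y i)%:R)%R by rewrite ler_pM2l // ler_nat.
have r2 : (h * (y i).+1%:R <= h * (2 ^ k * (y i %/ 2 ^ k).+1)%:R)%R by rewrite ler_pM2l // ler_nat.
rewrite natrM in r1; rewrite natrM -!natr1 in r2.
by apply/andP; split; lra.
Qed.

Lemma Box_inj z x y : Box x z -> Box y z -> x = y.
Proof.
move=> hx hy; apply/ffunP => i; apply/val_inj/eqP => /=.
have /andP[x1 x2] := hx i; have /andP[y1 y2] := hy i.
have a1 : (h * (x i)%:R < h * (y i).+1%:R)%R by rewrite -natr1; lra.
have a2 : (h * (y i)%:R < h * (x i).+1%:R)%R by rewrite -natr1; lra.
rewrite ltr_pM2l // ltr_nat ltnS in a1; rewrite ltr_pM2l // ltr_nat ltnS in a2.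
by rewrite eqn_leq a1 a2.
Qed.

Lemma cyl_cover k x : (k <= M)%N ->
  rbox (corner k x) (side k) = \big[setU/set0]_(y <- enum (cyl k x)) Box y.
Proof.
move=> kM; apply/seteqP; split => z.
  move=> /(cell_exists kM)[y yx yz]; rewrite -bigcup_seq.
  by exists y => //=; rewrite mem_enum.
by rewrite -bigcup_seq => -[y /=]; rewrite mem_enum => yx; exact: Box_sub_cyl.
Qed.

Lemma measurable_Box x : measurable (Box x).
Proof. exact: measurable_rbox. Qed.

Lemma integral_cyl (g : n.-tuple R -> \bar R) k x : (k <= M)%N ->
  measurable_fun setT g -> (forall z, 0 <= g z) ->
  \int[mu]_(z in rbox (corner k x) (side k)) g z =
  \sum_(y in cyl k x) \int[mu]_(z in Box y) g z.
Proof.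
move=> kM mg g0; rewrite cyl_cover // ge0_integral_bigsetU //.
- by rewrite big_enum.
- by move=> y; exact: measurable_Box.
- exact: enum_uniq.
- by apply/trivIsetP => y y' _ _ yy'; apply/seteqP; split => // z [h1 h2];
    move/eqP: yy'; apply; exact: Box_inj h1 h2.
- exact: measurable_funTS.
Qed.

End Grid.

(** * Hoelder and Minkowski inequalities on a cell *)

Section Integral_inequalities.
Context d (T : measurableType d) (R : realType).
Variable mu : {measure set T -> \bar R}.
Implicit Types (s F f g : T -> R).

Lemma powR_le1D (x p : R) : (1 <= p)%R -> (0 <= x)%R -> (x <= 1 + x `^ p)%R.
Proof.
move=> p1 x0; have [x1|x1] := leP x 1%R.
  by rewrite (le_trans x1) // lerDl powR_ge0.
by rewrite -[leLHS]add0r lerD // le1r_powR // ltW.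
Qed.

Lemma measurable_mulEFin D f g : measurable_fun D f -> measurable_fun D g ->
  measurable_fun D (fun z => (f z * g z)%:E).
Proof. by move=> mf mg; apply/measurable_EFinP; exact: measurable_funM. Qed.

Lemma ge0_fine_integral D f : (forall x, 0 <= f x)%R ->
  \int[mu]_(x in D) (f x)%:E < +oo ->
  (fine (\int[mu]_(x in D) (f x)%:E))%:E = \int[mu]_(x in D) (f x)%:E.
Proof.
move=> f0 fin; rewrite fineK // ge0_fin_numE //.
by apply: integral_ge0 => x _; rewrite lee_fin.
Qed.

Lemma fine_integral_ge0 D f : (forall x, 0 <= f x)%R ->
  (0 <= fine (\int[mu]_(x in D) (f x)%:E))%R.
Proof. by move=> f0; rewrite fine_ge0 // integral_ge0 // => x _; rewrite lee_fin. Qed.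

(** Integrating c F <= a + b F^p against [s] bounds the integral of [s F]; the
    constants for which Young's inequality is sharp at the value [V / S] of [F] give
    the result. *)
Lemma holder_cell (B : set T) s F (p : R) : (1 < p)%R -> measurable B ->
  measurable_fun setT s -> measurable_fun setT F ->
  (forall z, 0 <= s z)%R -> (forall z, 0 <= F z)%R ->
  \int[mu]_(z in B) (s z)%:E < +oo ->
  \int[mu]_(z in B) (F z `^ p * s z)%:E < +oo ->
  \int[mu]_(z in B) (s z * F z)%:E < +oo /\
  (fine (\int[mu]_(z in B) (s z * F z)%:E) `^ p <=
   fine (\int[mu]_(z in B) (F z `^ p * s z)%:E) *
   fine (\int[mu]_(z in B) (s z)%:E) `^ (p - 1))%R.
Proof.
move=> p1 mB ms mF s0 F0 sfin Efin.
have mFp : measurable_fun setT (fun z => F z `^ p)%R.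
  by apply: (measurableT_comp (measurable_powR p)).
have mE : measurable_fun B (fun z => (F z `^ p * s z)%:E).
  by apply: measurable_funTS; exact: measurable_mulEFin.
have msB : measurable_fun B (fun z => (s z)%:E).
  by apply: measurable_funTS; apply/measurable_EFinP.
have mV : measurable_fun B (fun z => (s z * F z)%:E).
  by apply: measurable_funTS; exact: measurable_mulEFin.
have E0 z : (0 <= F z `^ p * s z)%R by rewrite mulr_ge0 ?powR_ge0.
have V0 z : (0 <= s z * F z)%R by exact: mulr_ge0.
(* Any bound of [c F] by [a + b F ^ p] may be integrated against [s]. *)
have comb (a b c : R) : (0 <= a)%R -> (0 <= b)%R ->  (0 <= c)%R ->
    (forall z, c * F z <= a + b * F z `^ p)%R ->
    c%:E * \int[mu]_(z in B) (s z * F z)%:E <=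
    a%:E * \int[mu]_(z in B) (s z)%:E + b%:E * \int[mu]_(z in B) (F z `^ p * s z)%:E.
  move=> a0 b0 c0 hab; rewrite -!ge0_integralZl //; last first.
  - by move=> z _; rewrite lee_fin.
  - by move=> z _; rewrite lee_fin.
  - by move=> z _; rewrite lee_fin.
  rewrite -ge0_integralD //; last first.
  - by apply: emeasurable_funM => //.
  - by move=> z _; rewrite -EFinM lee_fin mulr_ge0.
  - by apply: emeasurable_funM => //.
  - by move=> z _; rewrite -EFinM lee_fin mulr_ge0.
  apply: ge0_le_integral => //.
  - by move=> z _; rewrite -EFinM lee_fin mulr_ge0.
  - by apply: emeasurable_funM => //.
  - by apply: emeasurable_funD; apply: emeasurable_funM => //.
  move=> z _; rewrite -!EFinM -EFinD lee_fin.
  have := ler_wpM2l (s0 z) (hab z); lra.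
have fin : \int[mu]_(z in B) (s z * F z)%:E < +oo.
  have := @comb 1%R 1%R 1%R ler01 ler01 ler01.
  rewrite !mul1e => h; apply: le_lt_trans (h _) _.
    by move=> z; rewrite !mul1r; apply: powR_le1D => //; exact: ltW.
  by rewrite lte_add_pinfty.
split => //.
have eV := ge0_fine_integral V0 fin.
have eE := ge0_fine_integral E0 Efin.
have es := ge0_fine_integral s0 sfin.
have Vge0 := fine_integral_ge0 B V0.
have Ege0 := fine_integral_ge0 B E0.
have sge0 := fine_integral_ge0 B s0.
move: eV eE es Vge0 Ege0 sge0 comb.
set V := fine _; set E := fine _; set S := fine _ => eV eE es Vge0 Ege0 sge0.
rewrite -eV -eE -es => comb.
have {}comb (a b c : R) : (0 <= a)%R -> (0 <= b)%R ->  (0 <= c)%R ->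
    (forall z, c * F z <= a + b * F z `^ p)%R -> (c * V <= a * S + b * E)%R.
  by move=> a0 b0 c0 hab; have := comb _ _ _ a0 b0 c0 hab; rewrite -!EFinM -EFinD lee_fin.
pose q := (p / (p - 1))%R.
have p0 : (0 < p)%R by lra.
have q1 : (1 < q)%R by rewrite /q ltr_pdivlMr; lra.
have pq : (p^-1 + q^-1 = 1)%R by rewrite /q invf_div; field; lra.
have [Vz|Vn] := eqVneq V 0%R.
  by rewrite Vz powR0 ?gt_eqF // mulr_ge0 ?powR_ge0.
have Vp : (0 < V)%R by rewrite lt0r Vn.
have Sp : (0 < S)%R.
  rewrite lt0r sge0 andbT; apply: contra_neq Vn => Sz.
  apply/eqP; rewrite eq_le Vge0 andbT; apply/ler_addgt0Pr => e e0; rewrite add0r.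
  pose b := (e / (E + 1))%R.
  have E1 : (0 < E + 1)%R by lra.
  have b0 : (0 < b)%R by rewrite divr_gt0.
  have := @comb (b `^ (- (q - 1)))%R b 1%R (powR_ge0 _ _) (ltW b0) ler01.
  rewrite Sz mulr0 add0r mul1r => h; apply: le_trans (h _) _.
    move=> z; have := young_eta p1 q1 pq b0 (F0 z) ler01.
    by rewrite mulr1 mul1r powR1 mulr1.
  rewrite /b mulrAC ler_pdivrMr // ler_pM2l //; lra.
pose a := (V / S)%R.
have ap : (0 < a)%R by rewrite divr_gt0.
have aq0 : (0 <= a `^ p / q)%R by rewrite divr_ge0 ?powR_ge0 // ltW // (lt_trans ltr01).
have pV0 : (0 <= p^-1)%R by rewrite invr_ge0 ltW.
have h := @comb (a `^ p / q)%R (p^-1)%R (a `^ (p - 1))%R aq0 pV0 (powR_ge0 _ _).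
have {}h : (a `^ (p - 1) * V <= a `^ p / q * S + p^-1 * E)%R.
  apply: h => z; rewrite mulrC.
  have := @conjugate_powR _ (F z) (a `^ (p - 1))%R p q (F0 z) (powR_ge0 _ _) p0 (lt_trans ltr01 q1) pq.
  rewrite -powRrM (_ : ((p - 1) * q = p)%R); last by rewrite /q; field; lra.
  by rewrite (mulrC p^-1%R) [X in (_ <= X)%R -> _]addrC.
have e1 : (a `^ (p - 1) * V = a `^ p * S)%R.
  by rewrite -(@mulr_powRB1 _ a p) ?(ltW ap) // /a; field; exact: lt0r_neq0.
have qi : (q^-1 = 1 - p^-1)%R by lra.
have h2 : (a `^ p * S <= E)%R.
  rewrite e1 qi in h; have : (p^-1 * (a `^ p * S) <= p^-1 * E)%R by lra.
  by rewrite ler_pM2l ?invr_gt0.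
have -> : V = (a * S)%R by rewrite /a divfK // gt_eqF.
rewrite powRM ?(ltW ap) // -(@mulr_powRB1 _ S p) // mulrA.
by rewrite ler_wpM2r ?powR_ge0.
Qed.

(** The same duality as in [minkowski_sum], with an integral for the inner sum. *)
Lemma minkowski_cell (J : finType) (B : set T) s F (f : J -> T -> R) (q : R) :
  (1 < q)%R -> measurable B ->
  measurable_fun setT s -> measurable_fun setT F ->
  (forall j, measurable_fun setT (f j)) ->
  (forall z, 0 <= s z)%R -> (forall z, 0 <= F z)%R -> (forall j z, 0 <= f j z)%R ->
  (forall z, \sum_j f j z `^ q <= F z `^ q)%R ->
  \int[mu]_(z in B) (s z * F z)%:E < +oo ->
  (forall j, \int[mu]_(z in B) (s z * f j z)%:E < +oo) /\
  (\sum_j fine (\int[mu]_(z in B) (s z * f j z)%:E) `^ q <=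
   fine (\int[mu]_(z in B) (s z * F z)%:E) `^ q)%R.
Proof.
move=> q1 mB ms mF mf s0 F0 f0 fF fin; have q0 : (0 < q)%R by exact: lt_trans q1.
have fjF j z : (f j z <= F z)%R.
  have : (f j z `^ q <= F z `^ q)%R.
    apply: le_trans (fF z); rewrite (bigD1 j) //= lerDl sumr_ge0 // => i _.
    exact: powR_ge0.
  move=> h; have := powR_le (ltW (_ : 0 < q^-1)%R) (powR_ge0 _ _) h.
  by rewrite invr_gt0 !powRK ?gt_eqF //; apply.
have mfj j : measurable_fun B (fun z => (s z * f j z)%:E).
  by apply: measurable_funTS; exact: measurable_mulEFin.
have mV : measurable_fun B (fun z => (s z * F z)%:E).
  by apply: measurable_funTS; exact: measurable_mulEFin.
have fj0 j z : (0 <= s z * f j z)%R by exact: mulr_ge0.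
have V0 z : (0 <= s z * F z)%R by exact: mulr_ge0.
have finj j : \int[mu]_(z in B) (s z * f j z)%:E < +oo.
  apply: le_lt_trans fin; apply: ge0_integral_mono => z _; rewrite lee_fin //.
  by rewrite ler_wpM2l.
split => //.
pose S j := fine (\int[mu]_(z in B) (s z * f j z)%:E).
have S0 j : (0 <= S j)%R by exact: fine_integral_ge0.
pose Sq := (\sum_j S j `^ q)%R.
have Sq0 : (0 <= Sq)%R by apply: sumr_ge0 => j _; exact: powR_ge0.
have Vge0 := fine_integral_ge0 B V0.
have eV := ge0_fine_integral V0 fin.
set V := fine _ in Vge0 eV *.
rewrite -/Sq; have [->|Sn] := eqVneq Sq 0%R; first exact: powR_ge0.
have Sp : (0 < Sq)%R by rewrite lt0r Sn.
have key : (Sq <= Sq `^ ((q - 1) / q) * V)%R.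
  rewrite -lee_fin EFinM eV -ge0_integralZl //; last first.
    by rewrite lee_fin powR_ge0.
    by move=> z _; rewrite lee_fin.
  have -> : Sq%:E = \int[mu]_(z in B) (\sum_(j <- enum J) (S j `^ (q - 1))%:E * (s z * f j z)%:E).
    rewrite ge0_integral_sum //; last first.
    - by move=> j z _; rewrite -EFinM lee_fin mulr_ge0 ?powR_ge0.
    - by move=> j; apply: emeasurable_funM.
    rewrite /Sq -sumEFin -big_enum; apply: eq_bigr => j _.
    rewrite ge0_integralZl //; last by rewrite lee_fin powR_ge0.
      by rewrite -(ge0_fine_integral (fj0 j) (finj j)) -/(S j) -EFinM mulrC mulr_powRB1.
    by move=> z _; rewrite lee_fin.
  apply: ge0_integral_mono => z _.
    by apply: sume_ge0 => j _; rewrite -EFinM lee_fin mulr_ge0 ?powR_ge0.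
  under eq_bigr do rewrite -EFinM.
  rewrite sumEFin -EFinM lee_fin big_enum /=.
  under eq_bigr do rewrite mulrCA.
  rewrite -mulr_sumr mulrCA ler_wpM2l //.
  exact: holder_sum q1 S0 (f0^~ z) (F0 z) (fF z).
have Sb : (Sq `^ q^-1 <= V)%R.
  have Sqp : (0 < Sq `^ ((q - 1) / q))%R by rewrite powR_gt0.
  rewrite -(ler_pM2l Sqp) -powRD ?(gt_eqF Sp) ?implybT //.
  rewrite (_ : ((q - 1) / q + q^-1 = 1)%R) ?powRr1 //.
  by field; rewrite gt_eqF.
rewrite -[leLHS](@powRVK _ _ q) ?gt_eqF //.
by apply: powR_le => //; rewrite ?powR_ge0 ?(ltW q0).
Qed.

End Integral_inequalities.

(** * From a grid to the finite model *)

Section Atoms.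
Context (R : realType) (n : nat).
Local Notation mu := (lebesgue R n).
Variables (h : R) (c : 'I_n -> R) (M : nat).
Hypothesis h0 : (0 < h)%R.
Local Notation X := (cell n M).
Local Notation Bx := (@Box R n h c M).
Local Notation cyl := (@cyl n M).
Local Notation corner := (@corner R n h c M).
Local Notation side := (side h).
Implicit Types (u w s F : n.-tuple R -> R) (x y : X) (P Q : {set X}).

Definition atom u x : R := fine (\int[mu]_(z in Bx x) (u z)%:E).

Definition volume x : R := (h ^+ n)%R.

Definition borel_weight u := [/\ measurable_fun setT u, forall z, (0 <= u z)%R &
  forall (a : 'I_n -> R) (l : R), \int[mu]_(z in cbox a l) (u z)%:E < +oo].

Lemma volume_gt0 x : (0 < volume x)%R.
Proof. by rewrite exprn_gt0. Qed.

Lemma atom_ge0 u x : (forall z, 0 <= u z)%R -> (0 <= atom u x)%R.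
Proof. exact: fine_integral_ge0. Qed.

Lemma borel_weight_Box u x : borel_weight u -> \int[mu]_(z in Bx x) (u z)%:E < +oo.
Proof.
move=> [mu_ u0 uf]; apply: le_lt_trans (uf (fun i => c i + h * (x i)%:R)%R h).
apply: ge0_subset_integral => //.
- exact: measurable_Box.
- exact: measurable_cbox.
- by apply: measurable_funTS; apply/measurable_EFinP.
- by move=> z _; rewrite lee_fin.
- exact: rbox_sub_cbox.
Qed.

Lemma mass_atom u k x : (k <= M)%N -> measurable_fun setT u -> (forall z, 0 <= u z)%R ->
  (forall y, \int[mu]_(z in Bx y) (u z)%:E < +oo) ->
  \int[mu]_(z in rbox (corner k x) (side k)) (u z)%:E = (mass (atom u) (cyl k x))%:E.
Proof.
move=> kM mu_ u0 fin; rewrite integral_cyl //; last by apply/measurable_EFinP.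
by rewrite /mass -sumEFin; apply: eq_bigr => y _; rewrite /atom ge0_fine_integral.
Qed.

Lemma mass_volume k x : (k <= M)%N -> mass volume (cyl k x) = (side k ^+ n)%R.
Proof.
move=> kM; have e y : \int[mu]_(z in Bx y) (cst 1%R z)%:E = (h ^+ n)%:E.
  rewrite -[LHS]/(\int[mu]_(z in Bx y) cst 1 z) integral_cst ?mul1e; first exact: mu_rbox.
  exact: measurable_Box.
apply/EFin_inj; rewrite -(mu_rbox (corner k x)) ?side_gt0 //.
have -> : volume = atom (cst 1%R) by apply/funext => y; rewrite /atom e.
rewrite -mass_atom //; last by move=> y; rewrite e ltry.
rewrite -[LHS]/(\int[mu]_(z in rbox (corner k x) (side k)) cst 1 z).
by rewrite integral_cst ?mul1e //; exact: measurable_rbox.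
Qed.

Lemma dens_average u k x : (k <= M)%N -> measurable_fun setT u -> (forall z, 0 <= u z)%R ->
  (forall y, \int[mu]_(z in Bx y) (u z)%:E < +oo) ->
  average (cbox (corner k x) (side k)) u = (dens volume (atom u) (cyl k x))%:E.
Proof.
move=> kM mu_ u0 fin; rewrite /average mu_cbox ?side_gt0 //.
rewrite inver gt_eqF ?exprn_gt0 ?side_gt0 //.
under eq_integral do rewrite ger0_norm //.
rewrite integral_cbox_rbox ?side_gt0 //; last by apply/measurable_EFinP.
by rewrite mass_atom // -EFinM /dens mass_volume // mulrC.
Qed.

Lemma dens_Ap w s p (A : R) P : borel_weight w -> borel_weight s ->
  Ap_constant p w s <= A%:E -> P \in cubes n M ->
  (dens volume (atom w) P * dens volume (atom s) P `^ (p - 1) <= A)%R.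
Proof.
move=> bw bs hA /cubesP[k [x [kM ->]]]; rewrite -lee_fin; apply: le_trans hA.
have [mw w0 _] := bw; have [ms s0 _] := bs.
rewrite EFinM -poweR_EFin -!dens_average //; last 2 first.
- by move=> y; exact: borel_weight_Box.
- by move=> y; exact: borel_weight_Box.
apply: ereal_sup_ubound; exists (cbox (corner k x) (side k)) => //.
by apply: is_cube_cbox; exact: side_gt0.
Qed.

(** [Q'] is the dyadic parent of [Q]. *)
Lemma cubes_doubling P Q : (0 < n)%N -> P \in cubes n M -> Q \in cubes n M -> Q \proper P ->
  exists Q', [/\ Q' \in cubes n M, Q \proper Q', Q' \subset P &
    (mass volume Q' <= 2 ^+ n * mass volume Q)%R].
Proof.
move=> n0 /cubesP[k [x [kM ->]]] /cubesP[l [y [lM ->]]] lk.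
have yx : y \in cyl k x by apply: (fintype.subsetP (fintype.proper_sub lk)); exact: cyl_self.
rewrite -(cyl_eq yx) in lk *.
have kl : (l < k)%N.
  rewrite ltnNge; apply/negP => kl; have := cyl_le y kl.
  by move: lk => /properP[_ [z zk zl]] /fintype.subsetP/(_ z zk); rewrite (negPf zl).
have l1M : (l.+1 <= M)%N by exact: leq_trans kM.
exists (cyl l.+1 y); split; first exact: cyl_cubes.
- rewrite properEcard cyl_le //=.
  rewrite -(ltr_nat R) -(ltr_pM2l (exprn_gt0 n h0)).
  have e j : (h ^+ n * #|cyl j y|%:R = mass volume (cyl j y))%R.
    by rewrite /mass sumr_const mulr_natr.
  rewrite !e !mass_volume // ltrXn2r -?lt0n ?ltW ?side_gt0 //.
  by rewrite /side ltr_pM2l // ltr_nat ltn_exp2l.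
- exact: cyl_le.
rewrite !mass_volume // -exprMn /side mulrCA -natrM -expnS //.
Qed.

Lemma atom1 : atom (cst 1%R) = volume.
Proof.
apply/funext => y; rewrite /atom.
rewrite -[X in fine X]/(\int[mu]_(z in Bx y) cst 1 z) integral_cst ?mul1e.
  by apply: (congr1 fine (_ : _ = (h ^+ n)%:E)); exact: mu_rbox.
exact: measurable_Box.
Qed.

Definition step (phi : X -> R) (z : n.-tuple R) : R :=
  (\sum_y phi y * \1_(Bx y) z)%R.

Lemma step_ge0 phi z : (forall y, 0 <= phi y)%R -> (0 <= step phi z)%R.
Proof. by move=> phi0; apply: sumr_ge0 => y _; rewrite mulr_ge0 // indicE ler0n. Qed.

Lemma stepE phi z y : Bx y z -> step phi z = phi y.
Proof.
move=> yz; rewrite /step (bigD1 y) //= big1 => [|x xy].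
  by rewrite addr0 indicE mem_set // mulr1.
rewrite indicE memNset ?mulr0 // => xz; move/eqP: xy; apply.
exact: (Box_inj h0 xz yz).
Qed.

Lemma step_out phi z : (forall y, ~ Bx y z) -> step phi z = 0%R.
Proof. by move=> out; rewrite /step big1 // => y _; rewrite indicE memNset ?mulr0. Qed.

Lemma measurable_step phi : measurable_fun setT (step phi).
Proof.
apply: measurable_sum => y; apply: measurable_funM => //.
by apply: measurable_indic; exact: measurable_Box.
Qed.

Lemma integral_step phi u : (forall y, 0 <= phi y)%R ->
  measurable_fun setT u -> (forall z, 0 <= u z)%R ->
  (forall y, \int[mu]_(z in Bx y) (u z)%:E < +oo) ->
  \int[mu]_z (step phi z * u z)%:E = (\sum_y phi y * atom u y)%:E.
Proof.
move=> phi0 mu_ u0 fin.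
have mB y : measurable (Bx y) by exact: measurable_Box.
transitivity (\int[mu]_z \sum_(y <- enum X) (phi y)%:E * ((u z)%:E * (\1_(Bx y) z)%:E)).
  apply: eq_integral => z _; rewrite big_enum /= /step mulr_suml -sumEFin.
  by apply: eq_bigr => y _; rewrite -!EFinM mulrA mulrAC.
have mi y : measurable_fun setT (fun z => (u z)%:E * (\1_(Bx y) z)%:E).
  by apply: emeasurable_funM; apply/measurable_EFinP => //; exact: measurable_indic.
have i0 y z : 0 <= (u z)%:E * (\1_(Bx y) z)%:E :> \bar R.
  by rewrite mule_ge0 ?lee_fin // indicE ler0n.
rewrite ge0_integral_sum //; last first.
- by move=> y z _; apply: mule_ge0; [rewrite lee_fin|exact: i0].
- by move=> y; apply: emeasurable_funM.
rewrite big_enum /= -sumEFin; apply: eq_bigr => y _.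
rewrite ge0_integralZl //; last by rewrite lee_fin.
rewrite EFinM /atom ge0_fine_integral // [in RHS]integral_mkcond; congr (_ * _).
apply: eq_integral => z _; rewrite patchE indicE.
by case: ifP; rewrite ?mule1 ?mule0.
Qed.

Lemma maximal_ge0 (g : n.-tuple R -> R) z : 0 <= maximal g z.
Proof.
apply: (@le_trans _ _ (average (cbox (tnth z) 1) g)); last first.
  apply: ereal_sup_ubound; exists (cbox (tnth z) 1) => //; split; first exact: is_cube_cbox.
  by move=> i; rewrite lexx lerDl ler01.
rewrite /average mule_ge0 //; last by apply: integral_ge0 => x _; rewrite lee_fin.
by rewrite mu_cbox // inver gt_eqF ?exprn_gt0 // lee_fin invr_ge0 exprn_ge0.
Qed.

Lemma cyl_sub_rbox k x l y : (l <= M)%N -> cyl l y \subset cyl k x ->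
  rbox (corner l y) (side l) `<=` rbox (corner k x) (side k).
Proof.
move=> lM /fintype.subsetP yx z /(cell_exists h0 lM)[y' /yx y'x y'z].
exact: Box_sub_cyl y'x y'z.
Qed.

(** The closed cube of a dyadic subcube of [cyl k x] is one of the cubes in the
    supremum defining the maximal function. *)
Lemma dyadic_max_cone_le_maximal u k x y z : borel_weight u -> (k <= M)%N -> y \in cyl k x ->
  Bx y z -> (dyadic_max (cone (cubes n M) (cyl k x)) volume (atom u) y)%:E <=
            maximal (u \_ (cbox (corner k x) (side k))) z.
Proof.
move=> bu kM yx yz; have [m_ u0 _] := bu.
set Qb := cbox _ _.
have [le0|gt0] := leP (dyadic_max (cone (cubes n M) (cyl k x)) volume (atom u) y) 0%R.
  by apply: le_trans (maximal_ge0 _ _); rewrite lee_fin.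
have [Q /andP[]] := dyadic_max_gt0P gt0 (lexx _); rewrite inE => /andP[QD QP] yQ leQ.
have [l [y' [lM e]]] := cubesP QD; subst Q; have {}e := cyl_eq yQ.
apply: (@le_trans _ _ (dens volume (atom u) (cyl l y'))%:E); first by rewrite lee_fin.
rewrite -e -dens_average //; last by move=> x'; exact: borel_weight_Box.
rewrite -e in QP.
apply: (@le_trans _ _ (average (cbox (corner l y) (side l)) (u \_ Qb))); last first.
  apply: ereal_sup_ubound; exists (cbox (corner l y) (side l)) => //.
  split; first by apply: is_cube_cbox; exact: side_gt0.
  by apply: rbox_sub_cbox; exact: Box_sub_cyl (cyl_self l y) yz.
rewrite /average; apply: lee_wpmul2l.
  by rewrite mu_cbox ?side_gt0 // inver gt_eqF ?exprn_gt0 ?side_gt0 // lee_fin invr_ge0 exprn_ge0 // ltW ?side_gt0.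
rewrite integral_cbox_rbox ?side_gt0 //; last first.
  by apply/measurable_EFinP; exact: measurableT_comp.
rewrite integral_mkcond [leRHS]integral_mkcond.
apply: ge0_integral_mono => z' _; rewrite !patchE; first by case: ifP.
case: ifPn => [/set_mem zr|_]; last by case: ifP => _; rewrite ?lee_fin.
rewrite mem_set; last exact: rbox_sub_cbox.
by rewrite mem_set //; apply: rbox_sub_cbox; exact: (cyl_sub_rbox lM QP).
Qed.

Lemma carleson_null u P : (forall z, 0 <= u z)%R -> mass (atom u) P = 0%R ->
  (\sum_(y in P) volume y * dyadic_max (cone (cubes n M) P) volume (atom u) y = 0)%R.
Proof.
move=> u0 S0; have a0 y := atom_ge0 y u0.
rewrite big1 // => y yx; apply/eqP; rewrite mulf_eq0 gt_eqF ?volume_gt0 //=.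
rewrite eq_le dyadic_max_ge0 andbT; apply: dyadic_max_le => // Q; rewrite inE => /andP[_ QP] _.
suff e : mass (atom u) Q = 0%R by rewrite /dens e mul0r.
by apply/eqP; rewrite eq_le mass_ge0 // andbT -S0 mass_le.
Qed.

(** The constant depends on the grid; it is used only when the exponent of the
    A_infty constant is zero. *)
Lemma carleson_finite u : (forall z, 0 <= u z)%R ->
  exists2 W : R, (1 <= W)%R & forall P, P \in cubes n M ->
  (\sum_(y in P) volume y * dyadic_max (cone (cubes n M) P) volume (atom u) y <=
   W * mass (atom u) P)%R.
Proof.
move=> u0; have a0 y := atom_ge0 y u0.
pose r P := ((\sum_(y in P) volume y * dyadic_max (cone (cubes n M) P) volume (atom u) y) /
             mass (atom u) P)%R.
have r0 P : (0 <= r P)%R.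
  apply: divr_ge0; last exact: mass_ge0.
  apply: sumr_ge0 => y _; by rewrite mulr_ge0 ?dyadic_max_ge0 // ltW ?volume_gt0.
exists (1 + \sum_P r P)%R => [|P _]; first by rewrite lerDl sumr_ge0.
have [S0|Sn] := eqVneq (mass (atom u) P) 0%R; first by rewrite carleson_null // S0 mulr0.
rewrite -ler_pdivrMr; last by rewrite lt0r Sn mass_ge0.
rewrite -/(r P) (bigD1 P) //= addrCA lerDl addr_ge0 // sumr_ge0 //.
Qed.

(** The dyadic maximal function of [u] on [P], as a step function, lies below the
    maximal function of [u] restricted to the cube. *)
Lemma carleson_cubes u (K : R) P : borel_weight u -> (Ainfty_constant u <= K%:E) ->
  P \in cubes n M ->
  (\sum_(y in P) volume y * dyadic_max (cone (cubes n M) P) volume (atom u) y <=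
   K * mass (atom u) P)%R.
Proof.
move=> bu hK /cubesP[k [x [kM ->]]]; have [m_ u0 _] := bu.
have ub y := borel_weight_Box y bu.
set Qb := cbox (corner k x) (side k).
have s0 := side_gt0 h0 k.
have a0 y := atom_ge0 y u0.
have eS : \int[mu]_(z in Qb) (u z)%:E = (mass (atom u) (cyl k x))%:E.
  by rewrite integral_cbox_rbox ?mass_atom //; apply/measurable_EFinP.
have [S0|Sn] := eqVneq (mass (atom u) (cyl k x)) 0%R.
  by rewrite carleson_null // S0 mulr0.
have Sp : (0 < mass (atom u) (cyl k x))%R by rewrite lt0r Sn mass_ge0.
pose phi y := if y \in cyl k x then dyadic_max (cone (cubes n M) (cyl k x)) volume (atom u) y else 0%R.
have phi0 y : (0 <= phi y)%R by rewrite /phi; case: ifP => // _; exact: dyadic_max_ge0.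
have -> : (\sum_(y in cyl k x) volume y * dyadic_max (cone (cubes n M) (cyl k x)) volume (atom u) y =
           \sum_y phi y * atom (cst 1%R) y)%R.
  rewrite big_mkcond /=; apply: eq_bigr => y _; rewrite atom1 /phi.
  by case: ifP => _; rewrite ?mul0r // mulrC.
rewrite -lee_fin -integral_step //; last first.
  move=> y; rewrite -[X in X < _]/(\int[mu]_(z in Bx y) cst 1 z) integral_cst.
    by rewrite mul1e; apply: le_lt_trans (ltry (h ^+ n)); rewrite le_eqVlt (introT eqP (mu_rbox _ h0)).
  exact: measurable_Box.
apply: (@le_trans _ _ (\int[mu]_(z in Qb) maximal (u \_ Qb) z)).
  rewrite [leRHS]integral_mkcond; apply: ge0_integral_mono => z _.
    by rewrite mulr1 lee_fin step_ge0.
  rewrite mulr1 patchE.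
  have [[y yz]|out] := pselect (exists y, Bx y z); last first.
    rewrite step_out; first by case: ifP => // _; exact: maximal_ge0.
    by move=> y yz; apply: out; exists y.
  rewrite (stepE phi yz) /phi; case: ifPn => yx; last by case: ifP => // _; exact: maximal_ge0.
  rewrite mem_set; first exact: dyadic_max_cone_le_maximal.
  by apply: rbox_sub_cbox; exact: Box_sub_cyl yx yz.
have : (\int[mu]_(z in Qb) (u z)%:E)^-1 * \int[mu]_(z in Qb) maximal (u \_ Qb) z <= K%:E.
  apply: le_trans hK; apply: ereal_sup_ubound; exists Qb => //.
  by apply: is_cube_cbox.
by rewrite eS inver (gt_eqF Sp) muleC lee_pdivrMr // -EFinM.
Qed.

(** The function [Phi] of the finite model is the mean of [F] with respect to
    [s] on each cell; by [holder_cell] its energy is at most that of [F]. *)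
Lemma energy_le s F p (E : R) : borel_weight s -> measurable_fun setT F ->
  (forall z, 0 <= F z)%R -> (1 < p)%R -> \int[mu]_z (F z `^ p * s z)%:E <= E%:E ->
  [/\ forall x, \int[mu]_(z in Bx x) (s z * F z)%:E < +oo,
      forall x, (atom (fun z => s z * F z)%R x / atom s x * atom s x =
                 atom (fun z => s z * F z)%R x)%R &
      (\sum_x atom s x * (atom (fun z => s z * F z)%R x / atom s x) `^ p <= E)%R].
Proof.
move=> bs mF F0 p1 hE; have [ms s0 _] := bs.
have p0 : (0 < p)%R by exact: lt_trans p1.
have p10 : (0 < p - 1)%R by rewrite subr_gt0.
have sb x := borel_weight_Box x bs.
have mB x : measurable (Bx x) by exact: measurable_Box.
have mFp : measurable_fun setT (fun z => F z `^ p)%R.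
  by apply: (measurableT_comp (measurable_powR p)).
have mE : measurable_fun setT (fun z => (F z `^ p * s z)%R) by exact: measurable_funM.
have E0 z : (0 <= F z `^ p * s z)%R by rewrite mulr_ge0 ?powR_ge0.
have Eb x : \int[mu]_(z in Bx x) (F z `^ p * s z)%:E < +oo.
  apply: (@le_lt_trans _ _ (\int[mu]_z (F z `^ p * s z)%:E)).
    apply: ge0_subset_integral => //; first by apply/measurable_EFinP.
    by move=> z _; rewrite lee_fin.
  by apply: le_lt_trans hE _; rewrite ltry.
have hold x := holder_cell p1 (mB x) ms mF s0 F0 (sb x) (Eb x).
set V := atom _; have V0 x : (0 <= V x)%R.
  by apply: atom_ge0 => z; rewrite mulr_ge0.
have S0 x : (0 <= atom s x)%R by exact: atom_ge0.
have hV x : (V x `^ p <= atom (fun z => F z `^ p * s z) x * atom s x `^ (p - 1))%R.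
  exact: (hold x).2.
have VS x : (V x / atom s x * atom s x = V x)%R.
  have [Sx|Sn] := eqVneq (atom s x) 0%R; last by rewrite divfK.
  rewrite Sx mulr0; apply/esym/eqP; have := hV x; rewrite Sx powR0 ?mulr0 ?(lt0r_neq0 p10) //.
  by rewrite le_eqVlt ltNge powR_ge0 orbF powR_eq0 => /andP[].
split => // [x|]; first exact: (hold x).1.
apply: (@le_trans _ _ (\sum_x atom (fun z => F z `^ p * s z) x)%R).
  apply: ler_sum => x _.
  have [Sx|Sn] := eqVneq (atom s x) 0%R; first by rewrite Sx mul0r atom_ge0.
  have Sp : (0 < atom s x)%R by rewrite lt0r Sn S0.
  rewrite powRM ?invr_ge0 // -(powR_inv1 (S0 x)) -powRrM mulN1r mulrCA.
  rewrite -{1}(powRr1 (S0 x)) -powRD ?Sn ?implybT // -opprB powRN.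
  rewrite ler_pdivrMr ?powR_gt0 //; exact: hV.
rewrite -lee_fin; apply: le_trans hE.
pose x0 : X := [ffun _ => Ordinal (expn_gt0 2 M : (0 < 2 ^ M)%N)].
have := mass_atom x0 (leqnn M) mE E0 Eb.
rewrite cubes_setT /mass; under eq_bigl do rewrite inE.
move=> <-; apply: ge0_subset_integral => //.
- exact: measurable_rbox.
- by apply/measurable_EFinP.
- by move=> z _; rewrite lee_fin.
Qed.

Definition gridU s (f : nat -> n.-tuple R -> R) q J x : R :=
  (\sum_(j < J) dyadic_max (cubes n M) volume (atom (fun z => s z * f j z)) x `^ q)%R.

Section Grid_inequalities.
Variables (w s F : n.-tuple R -> R) (f : nat -> n.-tuple R -> R) (p q A W E : R) (J : nat).
Hypotheses (n0 : (0 < n)%N) (p1 : (1 < p)%R) (q1 : (1 < q)%R) (A0 : (0 <= A)%R) (W1 : (1 <= W)%R).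
Hypotheses (bw : borel_weight w) (bs : borel_weight s).
Hypotheses (mF : measurable_fun setT F) (F0 : forall z, (0 <= F z)%R).
Hypotheses (mf : forall j, measurable_fun setT (f j)) (f0 : forall j z, (0 <= f j z)%R).
Hypothesis fF : forall z, (\sum_(j < J) f j z `^ q <= F z `^ q)%R.
Hypotheses (hA : Ap_constant p w s <= A%:E)
  (hW : Ainfty_constant w <= W%:E \/ (p <= q)%R).
Hypothesis hE : \int[mu]_z (F z `^ p * s z)%:E <= E%:E.

Let V := atom (fun z => s z * F z)%R.
Let Phi x := (V x / atom s x)%R.
Let psi (j : 'I_J) x := (atom (fun z => s z * f j z) x / volume x)%R.

Let s0 z : (0 <= s z)%R. Proof. by have [_ ->] := bs. Qed.

Let sf0 j z : (0 <= s z * f j z)%R. Proof. by rewrite mulr_ge0. Qed.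

Let V0 x : (0 <= V x)%R.
Proof. by apply: atom_ge0 => z; rewrite mulr_ge0. Qed.

Let Phi0 x : (0 <= Phi x)%R.
Proof. by rewrite divr_ge0 // atom_ge0. Qed.

Let psi0 j x : (0 <= psi j x)%R.
Proof. by rewrite divr_ge0 ?atom_ge0 // ltW ?volume_gt0. Qed.

Let cells x : (forall j : 'I_J, \int[mu]_(z in Bx x) (s z * f j z)%:E < +oo) /\
  (\sum_(j < J) psi j x `^ q <= (Phi x * atom s x / volume x) `^ q)%R.
Proof.
have [finV VS _] := energy_le bs mF F0 p1 hE.
have [ms _ _] := bs.
have [fin le] := minkowski_cell q1 (@measurable_Box _ _ h c M x) ms mF
  (fun j : 'I_J => mf j) s0 F0 (fun j : 'I_J => f0 j) fF (finV x).
split => //; have v0 : (0 <= (volume x)^-1)%R by rewrite invr_ge0 ltW ?volume_gt0.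
rewrite /Phi VS (powRM _ (V0 x) v0).
under eq_bigr do rewrite powRM ?atom_ge0 //.
by rewrite -mulr_suml ler_wpM2r ?powR_ge0.
Qed.

Let gridUE x : gridU s f q J x =
  (\sum_(j < J) dyadic_max (cubes n M) volume (fun y => psi j y * volume y) x `^ q)%R.
Proof.
apply: eq_bigr => j _; congr (dyadic_max _ _ _ _ `^ _)%R; apply/funext => y.
by rewrite /psi divfK // gt_eqF ?volume_gt0.
Qed.

Let energy : (\sum_x atom s x * Phi x `^ p <= E)%R.
Proof. by have [_ _] := energy_le bs mF F0 p1 hE. Qed.

Let DT : finset.setTfor X \in cubes n M.
Proof.
pose x0 : X := [ffun _ => Ordinal (expn_gt0 2 M : (0 < 2 ^ M)%N)].
by rewrite -(cubes_setT x0) cyl_cubes.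
Qed.

Let w0 z : (0 <= w z)%R. Proof. by have [_ ->] := bw. Qed.

Let Kd1 : (1 <= 2 ^+ n :> R)%R. Proof. by rewrite exprn_ege1 // ler1n. Qed.


(** If p <= q, the A_infty constant of [w] may be infinite; since it then occurs
    with exponent zero, any finite Carleson constant of the grid will do. *)
Let carleson_w : exists2 W' : R, (1 <= W')%R & [/\ forall P, P \in cubes n M ->
  (\sum_(y in P) volume y * dyadic_max (cone (cubes n M) P) volume (atom w) y <=
   W' * mass (atom w) P)%R & (W' `^ Num.max (p / q - 1) 0 = W `^ Num.max (p / q - 1) 0)%R].
Proof.
case: hW => [hW'|pq]; first by exists W => //; split => // P; exact: carleson_cubes.
have [W' W'1 hW'] := carleson_finite w0; exists W' => //; split => //.
suff -> : Num.max (p / q - 1)%R 0%R = 0%R by rewrite !powRr0.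
by apply/max_idPr; rewrite subr_le0 ler_pdivrMr ?mul1r // (lt_trans ltr01).
Qed.

Lemma grid_strong (K : R) : (0 <= K)%R -> Ainfty_constant s <= K%:E ->
  (\sum_x atom w x * gridU s f q J x `^ (p / q) <=
   `|strongC (2 ^+ n) p q| * A * (K + W `^ Num.max (p / q - 1) 0) * E)%R.
Proof.
move=> K0 hK.
under [X in (X <= _)%R]eq_bigr do rewrite gridUE.
have [W' W'1 [hW' <-]] := carleson_w.
have := @finite_strong R X 'I_J volume (atom w) (atom s) Phi (cubes n M) psi
  (2 ^+ n)%R A K W' p q p1 q1 Kd1 A0 K0 W'1 volume_gt0
  (fun x => atom_ge0 x w0) (fun x => atom_ge0 x s0) Phi0 psi0 (fun x => (cells x).2)
  (@cubes_laminar n M) (cubes_set0 n M) (@cubes_set1 n M) DT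
  (fun P Q => @cubes_doubling P Q n0) (fun P => dens_Ap bw bs hA)
  (fun P => carleson_cubes bs hK) hW'.
move=> /le_trans; apply.
have E'0 : (0 <= \sum_x atom s x * Phi x `^ p)%R.
  by apply: sumr_ge0 => x _; rewrite mulr_ge0 ?powR_ge0 // atom_ge0.
have B0 : (0 <= K + W' `^ Num.max (p / q - 1) 0)%R by rewrite addr_ge0 ?powR_ge0.
apply: (@le_trans _ _ (`|strongC (2 ^+ n) p q| * A * (K + W' `^ Num.max (p / q - 1) 0) *
  \sum_x atom s x * Phi x `^ p)%R).
  by rewrite !ler_wpM2r // ler_norm.
by rewrite ler_wpM2l // !mulr_ge0.
Qed.

Lemma grid_weak t : p <> q -> (0 < t)%R ->
  (t `^ p * \sum_(x | t `^ q < gridU s f q J x) atom w x <=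
   `|weakC (2 ^+ n) p q| * A * W `^ Num.max (p / q - 1) 0 * E)%R.
Proof.
move=> pq t0.
have -> : (\sum_(x | t `^ q < gridU s f q J x) atom w x = mass (atom w) (finset (fun x =>
    t `^ q < \sum_(j < J) dyadic_max (cubes n M) volume (fun y => psi j y * volume y) x `^ q)))%R.
  by apply: eq_bigl => x; rewrite inE gridUE.
have [W' W'1 [hW' <-]] := carleson_w.
have := @finite_weak R X 'I_J volume (atom w) (atom s) Phi (cubes n M) psi
  (2 ^+ n)%R A W' p q p1 q1 Kd1 A0 W'1 volume_gt0
  (fun x => atom_ge0 x w0) (fun x => atom_ge0 x s0) Phi0 psi0 (fun x => (cells x).2)
  (@cubes_laminar n M) (cubes_set0 n M) (@cubes_set1 n M) DT
  (fun P Q => @cubes_doubling P Q n0) (fun P => dens_Ap bw bs hA)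
  hW' t pq t0.
move=> /le_trans; apply.
have E'0 : (0 <= \sum_x atom s x * Phi x `^ p)%R.
  by apply: sumr_ge0 => x _; rewrite mulr_ge0 ?powR_ge0 // atom_ge0.
apply: (@le_trans _ _ (`|weakC (2 ^+ n) p q| * A * W' `^ Num.max (p / q - 1) 0 *
  \sum_x atom s x * Phi x `^ p)%R).
  by rewrite !ler_wpM2r ?powR_ge0 // ler_norm.
by rewrite ler_wpM2l // !mulr_ge0 ?powR_ge0.
Qed.

End Grid_inequalities.
End Atoms.

Lemma le_poweR (R : realType) (r : R) (x y : \bar R) : (0 <= r)%R -> 0 <= x -> x <= y ->
  x `^ r <= y `^ r.
Proof.
move=> r0 x0 xy; apply: gt0_ler_poweR => //; rewrite in_itv /= leey andbT //.
exact: le_trans xy.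
Qed.

(** * The one-third trick *)

Section One_third.
Context (R : realType) (n : nat).
Local Notation mu := (lebesgue R n).
Implicit Types (a : 'I_n -> R) (z : n.-tuple R) (N : nat) (b : {ffun 'I_n -> bool}).

Definition mesh N : R := ((2 ^ N)%:R)^-1%R.

(** With L = 2^N, the grids cover [-L/3, 2L/3) or [-2L/3, L/3) in each coordinate.
    Both contain every bounded set for large [N], and their offset L/3 is what the
    one-third trick needs. *)
Definition origin N b (i : 'I_n) : R :=
  (if b i then - ((2 * 2 ^ N)%:R / 3) else - ((2 ^ N)%:R / 3))%R.

Lemma mesh_gt0 N : (0 < mesh N)%R.
Proof. by rewrite invr_gt0 ltr0n expn_gt0. Qed.

Lemma side_mesh N : side (mesh N) N.*2 = (2 ^ N)%:R%R.
Proof.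
rewrite /side /mesh -addnn expnD natrM mulKf //.
Qed.

(** The two grids of step [s] have offset 2^j s / 3, and 2^j is not divisible by 3,
    so their points are at least s / 3 apart. An interval shorter than s / 3 cannot
    contain a point of each. *)
Lemma one_third_line (s x l : R) (j : nat) : (0 < s)%R -> (3 * l < s)%R -> (0 < l)%R ->
  exists b : bool, exists e : int,
   (let c := if b then (- (2 * (2 ^ j)%:R * s / 3))%R else (- ((2 ^ j)%:R * s / 3))%R in
   (c + s * e%:~R <= x) /\ (x + l < c + s * (e + 1)%:~R))%R.
Proof.
move=> s0 ls l0.
pose c (b : bool) := (if b then - (2 * (2 ^ j)%:R * s / 3) else - ((2 ^ j)%:R * s / 3))%R.
pose e (b : bool) := Num.floor ((x - c b) / s).
have fl (b : bool) : (c b + s * (e b)%:~R <= x < c b + s * (e b + 1)%:~R)%R.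
  have /andP[h1 h2] := floor_itv ((x - c b) / s)%R.
  rewrite ler_pdivlMr // in h1; rewrite ltr_pdivrMr // in h2.
  by rewrite /e; apply/andP; split; move: h1 h2; set u := (_%:~R)%R; set v := (_%:~R)%R; lra.
have [h|h0] := ltP (x + l)%R (c false + s * (e false + 1)%:~R)%R.
  by exists false, (e false); have /andP[] := fl false.
have [h|h1] := ltP (x + l)%R (c true + s * (e true + 1)%:~R)%R.
  by exists true, (e true); have /andP[] := fl true.
exfalso; have /andP[_ f0] := fl false; have /andP[_ f1] := fl true.
pose d : int := (((2 ^ j)%N : int) + 3 * (e false - e true))%R.
have dd : (d%:~R * s = 3 * ((c false + s * (e false + 1)%:~R) - (c true + s * (e true + 1)%:~R)))%R.
  rewrite /c /d !(intrD, intrM, rmorphB) /= -pmulrn; lra.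
have d1 : (-1 < d < 1)%R.
  rewrite -!(ltr_int R) -(ltr_pM2r s0) -[X in _ && X](ltr_pM2r s0) dd mul1r mulN1r.
  by apply/andP; split; lra.
have d0 : d = 0%R by lia.
have : (3 %| 2 ^ j)%N.
  have : (3 %| ((2 ^ j)%N : int))%Z.
    apply/dvdzP; exists (e true - e false)%R; move: d0; rewrite /d; lia.
  by [].
by rewrite Euclid_dvdX.
Qed.

Lemma large_scale a (l : R) : (0 < l)%R -> exists N0, forall N, (N0 <= N)%N ->
  [/\ (mesh N <= 3 * l)%R, (3 * l < (2 ^ N)%:R)%R &
      forall i, (3 * `|a i| < (2 ^ N)%:R)%R].
Proof.
move=> l0; pose B : R := (3 * l + (3 * l)^-1 + \sum_i 3 * `|a i|)%R.
have l30 : (0 < 3 * l)%R by rewrite mulr_gt0.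
have S0 : (0 <= \sum_i 3 * `|a i|)%R by apply: sumr_ge0 => i _; rewrite mulr_ge0.
have v0 : (0 < (3 * l)^-1)%R by rewrite invr_gt0.
have B0 : (0 < B)%R by rewrite /B; lra.
exists (Num.truncn B).+1 => N hN.
have BN : (B < (2 ^ N)%:R)%R.
  have /andP[_ h] := truncn_itv (ltW B0); apply: lt_le_trans h _.
  by rewrite ler_nat (leq_trans hN) // ltnW // ltn_expl.
split.
- rewrite /mesh -[leRHS]invrK lef_pV2 ?posrE ?ltr0n ?expn_gt0 //.
  by apply: ltW; move: BN; rewrite /B; lra.
- by move: BN; rewrite /B; lra.
move=> i; apply: le_lt_trans BN; rewrite /B (bigD1 i) //=.
have := normr_ge0 (a i); have : (0 <= \sum_(j | j != i) 3 * `|a j|)%R.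
  by apply: sumr_ge0 => j _; rewrite mulr_ge0.
lra.
Qed.

Lemma dyadic_scale N (l : R) : (0 < l)%R -> (mesh N <= 3 * l)%R -> (3 * l < (2 ^ N)%:R)%R ->
  exists k, [/\ (k <= N.*2)%N, (3 * l < side (mesh N) k)%R & (side (mesh N) k <= 6 * l)%R].
Proof.
move=> l0 h1 h2; have ex : exists k, (3 * l < side (mesh N) k)%R.
  by exists N.*2; rewrite side_mesh.
case: (ex_minnP ex) => k hk kmin; exists k; split => //.
  by apply: kmin; rewrite side_mesh.
case: k hk kmin => [|k] hk kmin.
  by rewrite /side expn0 mulr1 in hk *; lra.
have : (side (mesh N) k <= 3 * l)%R.
  by rewrite leNgt; apply/negP => /kmin; rewrite ltnn.
rewrite /side expnS natrM; lra.
Qed.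

(** A scale with 3 l < s <= 6 l exists, and the grid is chosen coordinate by
    coordinate. This determines a dyadic cube, by a cell [y] in it; [x] is the cell
    of the same cube that contains [z]. *)
Lemma one_third a (l : R) z : (0 < l)%R -> cbox a l z -> exists N0, forall N, (N0 <= N)%N ->
  exists b : {ffun 'I_n -> bool}, exists x : cell n N.*2,
    Box (mesh N) (origin N b) x z /\
    exists k, [/\ (k <= N.*2)%N, (side (mesh N) k <= 6 * l)%R &
      cbox a l `<=` rbox (corner (mesh N) (origin N b) k x) (side (mesh N) k)].
Proof.
move=> l0 az; have [N0 hN0] := large_scale a l0; exists N0 => N /hN0[hm hl ha].
have [k [kM lk kl]] := dyadic_scale l0 hm hl.
have s0 := side_gt0 (mesh_gt0 N) k.
pose s := side (mesh N) k; pose j := (N.*2 - k)%N.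
have js : ((2 ^ j)%:R * s = (2 ^ N)%:R)%R.
  rewrite /s -(side_mesh N) /side mulrCA -natrM -expnD subnK //.
have [g hg] := choice (fun i : 'I_n => @one_third_line s (a i) l j s0 lk l0).
have [e he] := choice hg.
pose b : {ffun 'I_n -> bool} := [ffun i => g i].
have oE i : origin N b i = (if g i then - (2 * (2 ^ j)%:R * s / 3) else - ((2 ^ j)%:R * s / 3))%R.
  by rewrite /origin ffunE -(mulrA 2%R) js natrM.
have {}he i : (origin N b i + s * (e i)%:~R <= a i /\ a i + l < origin N b i + s * (e i + 1)%:~R)%R.
  by rewrite oE; exact: he.
have ob i : (origin N b i <= - ((2 ^ N)%:R / 3) /\ - (2 * ((2 ^ N)%:R / 3)) <= origin N b i)%R.
  have : (0 < (2 ^ N)%:R :> R)%R by rewrite ltr0n expn_gt0.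
  by rewrite /origin; case: (b i); rewrite ?natrM; set u := (2 ^ N)%:R%R; lra.
have {}ha i : (- (2 ^ N)%:R < 3 * a i < (2 ^ N)%:R)%R.
  by have := ha i; rewrite -{1}(ger0_norm (ler0n R 3)) -normrM ltr_norml.
have e0 i : (0 <= e i)%R.
  have [_ h] := he i; have [ho _] := ob i; have /andP[h1 _] := ha i.
  have : (0 < s * (e i + 1)%:~R)%R by lra.
  by rewrite pmulr_rgt0 // ltr0z; lia.
have ej i : (e i < (2 ^ j)%N)%R.
  have [h _] := he i; have [_ ho] := ob i; have /andP[_ h1] := ha i.
  have : (s * (e i)%:~R < s * (2 ^ j)%:R)%R by rewrite [ltRHS]mulrC js; lra.
  by rewrite ltr_pM2l // pmulrn ltr_int.
have ltM i : (`|e i|%N * 2 ^ k < 2 ^ N.*2)%N.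
  rewrite -(subnK kM) expnD ltn_mul2r expn_gt0 /=.
  have := ej i; have := e0 i; rewrite -/j; lia.
pose y : cell n N.*2 := [ffun i => Ordinal (ltM i)].
have cE i : corner (mesh N) (origin N b) k y i = (origin N b i + s * (e i)%:~R)%R.
  rewrite /corner ffunE /= mulnK ?expn_gt0 // -/s; congr (_ + _ * _)%R.
  by rewrite -[in RHS](gez0_abs (e0 i)).
have sub : cbox a l `<=` rbox (corner (mesh N) (origin N b) k y) s.
  move=> u hu i; rewrite cE; have /andP[u1 u2] := hu i; have [h1 h2] := he i.
  rewrite intrD mulrDr mulr1 addrA in h2; apply/andP; split; lra.
have [x xy xz] := cell_exists (mesh_gt0 N) kM (sub z az).
exists b, x; split => //; exists k; split => //.
have -> : corner (mesh N) (origin N b) k x = corner (mesh N) (origin N b) k y.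
  by apply/funext => i; rewrite /corner (cylP _ _ _ xy).
exact: sub.
Qed.
Definition integrable_boxes (u : n.-tuple R -> R) :=
  forall (a : 'I_n -> R) (l : R), (0 < l)%R -> \int[mu]_(z in rbox a l) (u z)%:E < +oo.

Lemma average_le_dyadic_max (u : n.-tuple R -> R) a (l : R) N b (x : cell n N.*2) k :
  measurable_fun setT u -> (forall z, 0 <= u z)%R -> integrable_boxes u ->
  (0 < l)%R -> (k <= N.*2)%N -> (side (mesh N) k <= 6 * l)%R ->
  cbox a l `<=` rbox (corner (mesh N) (origin N b) k x) (side (mesh N) k) ->
  average (cbox a l) u <=
  (6 ^+ n * dyadic_max (cubes n N.*2) (volume (mesh N) (M := N.*2))
              (atom (mesh N) (origin N b) u) x)%:E.
Proof.
move=> m_ u0 fin l0 kM sl sub; have h0 := mesh_gt0 N.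
have s0 := side_gt0 h0 k.
set c := origin N b in sub *; set s := side _ k in s0 sl sub *.
have a0 y : (0 <= atom (mesh N) c u y)%R by exact: atom_ge0.
have d0 : (0 <= dens (volume (mesh N) (M := N.*2)) (atom (mesh N) c u) (cyl k x))%R.
  by apply: dens_ge0 => // y; exact: ltW (volume_gt0 h0 y).
apply: (@le_trans _ _ (6 ^+ n * dens (volume (mesh N) (M := N.*2)) (atom (mesh N) c u) (cyl k x))%:E);
  last first.
  rewrite lee_fin ler_wpM2l ?exprn_ge0 //.
  by apply: dyadic_max_ge; [exact: cyl_cubes|exact: cyl_self].
rewrite EFinM -dens_average //; last by move=> y; exact: fin.
rewrite /average !mu_cbox // !inver !gt_eqF ?exprn_gt0 //.
have hI : \int[mu]_(z in cbox a l) `|u z|%:E <=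
          \int[mu]_(z in cbox (corner (mesh N) c k x) s) `|u z|%:E.
  apply: ge0_subset_integral => //.
  - exact: measurable_cbox.
  - exact: measurable_cbox.
  - by apply/measurable_EFinP/measurableT_comp => //; exact: measurable_funTS.
  - by move=> z /sub; exact: rbox_sub_cbox.
rewrite muleA -EFinM; apply: lee_pmul => //.
- by rewrite lee_fin invr_ge0 exprn_ge0 // ltW.
- by apply: integral_ge0 => z _; rewrite lee_fin.
rewrite lee_fin -[leRHS]/(_ / _)%R ler_pdivlMr ?exprn_gt0 // mulrC ler_pdivrMr ?exprn_gt0 //.
by rewrite -exprMn; apply: lerXn2r => //; rewrite nnegrE ?mulr_ge0 ?ltW.
Qed.

(** Lowering each finite summand by a little, and replacing an infinite one by a
    large number. *)
Lemma lt_sum_split (J : nat) (X : nat -> \bar R) (r : R) : (forall j, 0 <= X j) ->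
  r%:E < \sum_(0 <= j < J) X j ->
  exists2 v : nat -> R, (forall j, (0 <= v j)%R /\ (v j = 0%R \/ (v j)%:E < X j)) &
    (r < \sum_(j < J) v j)%R.
Proof.
move=> X0; elim: J r => [|J IH] r.
  by rewrite big_nil lte_fin => r0; exists (fun=> 0%R) => [j|]; [split => //; left|rewrite big_ord0].
rewrite big_nat_recr //=.
have build v c : (forall j, (0 <= v j)%R /\ (v j = 0%R \/ (v j)%:E < X j)) ->
    (0 <= c)%R -> c = 0%R \/ c%:E < X J -> (r < \sum_(j < J) v j + c)%R ->
    exists2 v' : nat -> R, (forall j, (0 <= v' j)%R /\ (v' j = 0%R \/ (v' j)%:E < X j)) &
    (r < \sum_(j < J.+1) v' j)%R.
  move=> hv c0 hc hr; exists (fun j => if j == J then c else v j).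
    by move=> j; case: eqP => [->|_].
  rewrite big_ord_recr /= eqxx; congr (_ < _ + _)%R: hr.
  by apply: eq_bigr => j _; rewrite ltn_eqF.
have := X0 J; case E : (X J) => [x| |] // x0.
  rewrite lee_fin in x0.
  rewrite -lteBlDr // -EFinB => /IH[v hv hr].
  pose d := ((\sum_(j < J) v j - (r - x)) / 2)%R.
  have d0 : (0 < d)%R by rewrite /d; lra.
  have [xd|dx] := leP x d.
    apply: (build v 0%R) => //; first by left.
    by move: xd; rewrite /d; lra.
  apply: (build v (x - d)%R) => //; first by lra.
    by right; rewrite E lte_fin; lra.
  by rewrite /d; lra.
move=> _; apply: (build (fun=> 0%R) (`|r| + 1)%R).
- by move=> j; split => //; left.
- by rewrite addr_ge0.
- by right; rewrite E ltry.
by rewrite big1 // add0r (le_lt_trans (ler_norm r)) // ltrDl.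
Qed.

Definition dyadic_lq s f q N z : R :=
  (\sum_b step (mesh N) (origin N b) (gridU (mesh N) (origin N b) (M := N.*2) s f q N) z)%R.

(** A finite partial sum already exceeds t^q, and finitely many cubes witness it.
    Each of them lies in a dyadic cube of one of the grids as soon as [N] is large;
    summing over all grids makes the choice of the grid irrelevant. *)
Lemma maximal_lq_dyadic s (f : nat -> n.-tuple R -> R) (q t : R) z : (0 < q)%R -> (0 < t)%R ->
  (forall j, measurable_fun setT (fun z => s z * f j z)%R) ->
  (forall j z, 0 <= s z * f j z)%R -> (forall j, integrable_boxes (fun z => s z * f j z)%R) ->
  t%:E < maximal_lq q (fun j x => s x * f j x)%R z ->
  exists N0, forall N, (N0 <= N)%N ->
    (t `^ q < (6 ^+ n) `^ q * dyadic_lq s f q N z)%R.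
Proof.
move=> q0 t0 mf f0 fin; set X := fun j => maximal (fun x => s x * f j x)%R z `^ q.
have X0 j : 0 <= X j by exact: poweR_ge0.
rewrite /maximal_lq -/X => ht.
have {}ht : (t `^ q)%:E < \sum_(0 <= j <oo) X j.
  rewrite ltNge; apply/negP => h; move: ht; rewrite ltNge => /negP; apply.
  apply: (@le_trans _ _ (((t `^ q)%:E) `^ q^-1)).
    apply: le_poweR => //; first by rewrite invr_ge0 ltW.
    by apply: nneseries_ge0 => j _ _; exact: X0.
  by rewrite poweR_EFin powRK ?gt_eqF // ltW.
have [J hJ] : exists J, (t `^ q)%:E < \sum_(0 <= j < J) X j.
  apply: contrapT => h; move: ht; rewrite ltNge => /negP; apply.
  apply: lime_le; first by apply: is_cvg_nneseries.
  by apply: nearW => J; rewrite leNgt; apply/negP => hJ; apply: h; exists J.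
have [v hv ltv] := lt_sum_split X0 hJ.
(* A positive value below the j-th maximal function is exceeded by the average over
   one cube; for the value 0 any cell containing [z] will do. *)
have cube j : exists N0, forall N, (N0 <= N)%N -> exists b, exists2 x : cell n N.*2,
   Box (mesh N) (origin N b) x z & (v j <= (6 ^+ n) `^ q *
   dyadic_max (cubes n N.*2) (volume (mesh N) (M := N.*2)) (atom (mesh N) (origin N b) (fun z => s z * f j z)) x `^ q)%R.
  have [v0 [vj0|vjX]] := hv j.
    have [N0 hN0] := @one_third (tnth z) 1 z ltr01 (fun i => introT andP (conj (lexx _) (ltW (ltr_pwDr ltr01 (lexx _))))).
    exists N0 => N /hN0[b [x [xz _]]]; exists b, x => //.
    by rewrite vj0 mulr_ge0 ?powR_ge0.
  have : (v j `^ q^-1)%:E < maximal (fun x => s x * f j x)%R z.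
    rewrite ltNge; apply/negP => h; move: vjX; rewrite ltNge => /negP; apply.
    rewrite /X -[v j](@powRVK _ _ q) ?gt_eqF // -poweR_EFin.
    by apply: le_poweR => //; [exact: ltW|exact: maximal_ge0].
  move=> /ereal_sup_gt[_ [Q [cQ Qz] <-]] hQ; have [a [l [l0 e]]] := is_cubeP cQ; subst Q.
  have [N0 hN0] := one_third l0 Qz; exists N0 => N /hN0[b [x [xz [k [kM sl sub]]]]].
  exists b, x => //; have := average_le_dyadic_max (mf j) (f0 j) (fin j) l0 kM sl sub.
  move=> /(lt_le_trans hQ); rewrite lte_fin => /ltW h.
  rewrite -powRM ?exprn_ge0 ?dyadic_max_ge0 // -[leLHS](@powRVK _ _ q) ?gt_eqF //.
  by apply: powR_le => //; rewrite ?powR_ge0 ?ltW.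
have [N0 hN0] := choice cube.
exists (maxn J (\max_(j < J) N0 j))%N => N; rewrite geq_max => /andP[JN mN].
apply: lt_le_trans ltv _.
pose g (j : nat) (b : {ffun 'I_n -> bool}) (x : cell n N.*2) :=
  (dyadic_max (cubes n N.*2) (volume (mesh N) (M := N.*2))
    (atom (mesh N) (origin N b) (fun z => s z * f j z)) x `^ q * \1_(Box (mesh N) (origin N b) x) z)%R.
have g0 j b x : (0 <= g j b x)%R by rewrite mulr_ge0 ?powR_ge0 // indicE ler0n.
have -> : dyadic_lq s f q N z = (\sum_(j < N) \sum_b \sum_x g j b x)%R.
  rewrite exchange_big /=; apply: eq_bigr => b _; rewrite exchange_big /=.
  by apply: eq_bigr => x _; rewrite /gridU mulr_suml.
apply: (@le_trans _ _ (\sum_(j < J) (6 ^+ n) `^ q * \sum_b \sum_x g j b x)%R).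
  apply: ler_sum => j _.
  have [|b [x xz h]] := hN0 j N; first exact: leq_trans (leq_bigmax j) mN.
  apply: le_trans h _; rewrite ler_wpM2l ?powR_ge0 //.
  apply: (@le_trans _ _ (g j b x)); first by rewrite /g indicE mem_set // mulr1.
  rewrite (bigD1 b) //= (bigD1 x) //=; move: (g j b x) => r.
  have r1 : (0 <= \sum_(x' | x' != x) g j b x')%R by apply: sumr_ge0.
  have r2 : (0 <= \sum_(b' | b' != b) \sum_x' g j b' x')%R.
    by apply: sumr_ge0 => b' _; apply: sumr_ge0.
  by apply: (le_trans _ (lerD (lerD (lexx r) r1) r2)); rewrite !addr0.
rewrite -mulr_sumr ler_wpM2l ?powR_ge0 //.
rewrite -!(big_mkord xpredT (fun j => \sum_b \sum_x g j b x)%R).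
rewrite [leRHS](@big_cat_nat _ _ _ J) //= lerDl.
by do 3 (apply: sumr_ge0 => ? _).
Qed.
End One_third.

Lemma ereal_between (R : realType) (x y : \bar R) : 0 <= x -> x < y ->
  exists r : R, [/\ (0 < r)%R, x < r%:E & r%:E < y].
Proof.
case: x => [x| |] //; rewrite ?lee_fin; case: y => [y| |] // x0.
- rewrite lte_fin => xy; exists ((x + y) / 2)%R; rewrite !lte_fin.
  by split; lra.
- by move=> _; exists (x + 1)%R; rewrite lte_fin ltry; split => //; lra.
Qed.

Lemma limn_einf_ge (R : realType) (u : nat -> \bar R) (r : \bar R) N0 :
  (forall N, (N0 <= N)%N -> r <= u N) -> r <= limn_einf u.
Proof.
move=> h; rewrite limn_einf_lim; apply: lime_ge; first exact: is_cvg_einfs.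
exists N0 => // N /= hN; apply: le_ereal_inf_tmp => _ [k /= hk <-].
by apply: h; exact: leq_trans hk.
Qed.

(** Pointwise, the lower limit of the [H N] is at least [G], which is compared with
    it by monotonicity of the lower integral only. *)
Lemma fatou_eventually d (T : measurableType d) (R : realType)
  (mu : {measure set T -> \bar R}) (G : T -> \bar R) (H : nat -> T -> R) (C : \bar R) :
  (forall z, 0 <= G z) -> (forall N, measurable_fun setT (H N)) ->
  (forall N z, 0 <= H N z)%R -> (forall N, \int[mu]_z (H N z)%:E <= C) ->
  (forall z (r : R), (0 < r)%R -> r%:E < G z ->
     exists N0, forall N, (N0 <= N)%N -> (r <= H N z)%R) ->
  \int[mu]_z G z <= C.
Proof.
move=> G0 mH H0 HC GH.
have L0 z : 0 <= limn_einf (fun N => (H N z)%:E).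
  by apply: (@limn_einf_ge _ _ _ 0%N) => N _; rewrite lee_fin.
apply: (@le_trans _ _ (\int[mu]_z limn_einf (fun N => (H N z)%:E))).
  apply: ge0_integral_mono => // z _; rewrite leNgt; apply/negP => hlt.
  have [r [r0 Lr rG]] := ereal_between (L0 z) hlt.
  have [N0 hN0] := GH z r r0 rG.
  move: Lr; rewrite ltNge => /negP; apply; apply: (@limn_einf_ge _ _ _ N0) => N hN.
  by rewrite lee_fin hN0.
apply: le_trans (fatou mu measurableT _ _) _.
- by move=> N; apply/measurable_EFinP.
- by move=> N z _; rewrite lee_fin.
rewrite limn_einf_lim; apply: lime_le; first exact: is_cvg_einfs.
near=> N; apply: le_trans (HC N); apply: ereal_inf_lbound.
by exists N => /=.
Unshelve. all: by end_near. Qed.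

Lemma sum_le_card (R : realType) (I : finType) (i0 : I) (a : I -> R) :
  exists i, (\sum_i a i <= #|I|%:R * a i)%R.
Proof.
pose i := [arg max_(i > i0) a i]%O.
exists i; rewrite mulr_natl -sumr_const; apply: ler_sum => j _.
by rewrite /i; case: arg_maxP => // k _; apply.
Qed.

(** * Fatou's lemma and Borel weights *)

Section Borel_inequalities.
Context (R : realType) (n : nat).
Local Notation mu := (lebesgue R n).
Variables (w s : n.-tuple R -> R) (f : nat -> n.-tuple R -> R) (p q A W E : R).
Hypotheses (n0 : (0 < n)%N) (p1 : (1 < p)%R) (q1 : (1 < q)%R) (A0 : (0 <= A)%R) (W1 : (1 <= W)%R).
Hypotheses (bw : borel_weight w) (bs : borel_weight s).
Hypotheses (mf : forall j, measurable_fun setT (f j)) (f0 : forall j z, (0 <= f j z)%R).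
Hypotheses (hA : Ap_constant p w s <= A%:E)
  (hW : Ainfty_constant w <= W%:E \/ (p <= q)%R).

Let F J z := ((\sum_(j < J) f j z `^ q) `^ q^-1)%R.

Hypothesis hE : forall J, \int[mu]_z (F J z `^ p * s z)%:E <= E%:E.

Let p0 : (0 < p)%R. Proof. exact: lt_trans p1. Qed.
Let q0 : (0 < q)%R. Proof. exact: lt_trans q1. Qed.

Let mF J : measurable_fun setT (F J).
Proof.
apply: (measurableT_comp (measurable_powR _)); apply: measurable_sum => j.
exact: (measurableT_comp (measurable_powR _)).
Qed.

Let F0 J z : (0 <= F J z)%R. Proof. exact: powR_ge0. Qed.

Let fF J z : (\sum_(j < J) f j z `^ q <= F J z `^ q)%R.
Proof. by rewrite /F powRVK ?gt_eqF // sumr_ge0 // => j _; exact: powR_ge0. Qed.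

Let w0 z : (0 <= w z)%R. Proof. by have [_ ->] := bw. Qed.
Let s0 z : (0 <= s z)%R. Proof. by have [_ ->] := bs. Qed.
Let mw : measurable_fun setT w. Proof. by have [] := bw. Qed.
Let ms : measurable_fun setT s. Proof. by have [] := bs. Qed.

Let integrable_sf j : integrable_boxes (fun z => s z * f j z)%R.
Proof.
move=> a l l0; have mB := measurable_rbox a l.
have sb : \int[mu]_(z in rbox a l) (s z)%:E < +oo.
  have [_ _ fin] := bs; apply: le_lt_trans (fin a l).
  apply: ge0_subset_integral => //; first exact: measurable_cbox.
  - by apply: measurable_funTS; apply/measurable_EFinP.
  - by move=> z _; rewrite lee_fin.
  - exact: rbox_sub_cbox.
have Eb : \int[mu]_(z in rbox a l) (F j.+1 z `^ p * s z)%:E < +oo.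
  apply: le_lt_trans (le_lt_trans (hE j.+1) (ltry _)).
  apply: ge0_subset_integral => //.
  - apply: measurable_mulEFin => //; exact: (measurableT_comp (measurable_powR p)).
  - by move=> z _; rewrite lee_fin mulr_ge0 ?powR_ge0.
have [finV _] := holder_cell p1 mB ms (mF j.+1) s0 (F0 j.+1) sb Eb.
have [fin _] := minkowski_cell q1 mB ms (mF j.+1) (fun j : 'I_j.+1 => mf j) s0 (F0 j.+1)
  (fun j : 'I_j.+1 => f0 j) (fF j.+1) finV.
exact: (fin ord_max).
Qed.

Let sf0 j z : (0 <= s z * f j z)%R. Proof. by rewrite mulr_ge0. Qed.
Let msf j : measurable_fun setT (fun z => s z * f j z)%R.
Proof. exact: measurable_funM. Qed.

Let MX := maximal_lq q (fun j x => s x * f j x)%R.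

Let MX0 z : 0 <= MX z. Proof. exact: poweR_ge0. Qed.

Let gU N b := gridU (mesh R N) (origin R N b) (M := N.*2) s f q N.

Let gU0 N b x : (0 <= @gU N b x)%R.
Proof. by apply: sumr_ge0 => j _; exact: powR_ge0. Qed.

Let b0 : {ffun 'I_n -> bool} := [ffun=> true].

Let K2 : R := #|{: {ffun 'I_n -> bool}}|%:R%R.

Let step_pow N b (g : R -> R) z : g 0%R = 0%R ->
  g (step (mesh R N) (origin R N b) (@gU N b) z) =
  step (mesh R N) (origin R N b) (fun x => g (@gU N b x)) z.
Proof.
move=> g00; have [[x xz]|out] := pselect (exists x, Box (mesh R N) (origin R N b) (M := N.*2) x z).
  by rewrite !(stepE (mesh_gt0 R N) _ xz).
by rewrite !step_out // => x xz; apply: out; exists x.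
Qed.

(** Comparing the sum over the grids with its largest term costs the number of
    grids once inside the power and once outside. *)
Definition transferC (C : R) := (((6 ^+ n) `^ q * K2) `^ (p / q) * (K2 * C))%R.

Let integral_steps N (phi : forall b, cell n N.*2 -> R) (c B : R) : (0 <= c)%R ->
  (forall b x, 0 <= phi b x)%R ->
  (forall b, \sum_x phi b x * atom (mesh R N) (origin R N b) w x <= B)%R ->
  \int[mu]_z (c * \sum_b step (mesh R N) (origin R N b) (phi b) z * w z)%:E <=
  (c * (K2 * B))%:E.
Proof.
move=> c0 phi0 hB.
have mst b : measurable_fun setT (fun z => (step (mesh R N) (origin R N b) (phi b) z * w z)%:E).
  by apply: measurable_mulEFin => //; exact: measurable_step.
have st0 b z : 0 <= (step (mesh R N) (origin R N b) (phi b) z * w z)%:E.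
  by rewrite lee_fin mulr_ge0 // step_ge0.
rewrite (_ : \int[mu]_z _ = \int[mu]_z (c%:E * \sum_(b <- enum {: {ffun 'I_n -> bool}})
  (step (mesh R N) (origin R N b) (phi b) z * w z)%:E)); last first.
  by apply: eq_integral => z _; rewrite big_enum /= sumEFin -EFinM.
rewrite ge0_integralZl //; last 2 first.
- exact: emeasurable_sum.
- by move=> z _; apply: sume_ge0.
rewrite ge0_integral_sum // EFinM big_enum /=; apply: lee_wpmul2l; first by rewrite lee_fin.
rewrite /K2 mulr_natl -sumr_const -sumEFin; apply: lee_sum => b _.
rewrite integral_step ?mesh_gt0 ?lee_fin //.
by move=> y; apply: borel_weight_Box.
Qed.

Let pointwise N z t : (t `^ q < (6 ^+ n) `^ q * dyadic_lq s f q N z)%R ->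
  exists b, (t `^ q < (6 ^+ n) `^ q * K2 *
     step (mesh R N) (origin R N b) (@gU N b) z)%R.
Proof.
have [b hb] := sum_le_card b0 (fun b => step (mesh R N) (origin R N b) (@gU N b) z).
move=> /lt_le_trans ht; exists b; apply: ht; rewrite -mulrA ler_wpM2l ?powR_ge0 //.
Qed.

Let C10 : (0 < (6 ^+ n) `^ q * K2)%R.
Proof.
rewrite mulr_gt0 ?powR_gt0 ?exprn_gt0 // ltr0n; apply/card_gt0P; by exists b0.
Qed.

Let pq0 : (0 < p / q)%R. Proof. exact: divr_gt0. Qed.

Lemma borel_strong (K : R) : (0 <= K)%R -> Ainfty_constant s <= K%:E ->
  \int[mu]_z (MX z `^ p * (w z)%:E) <=
  (transferC (`|strongC (2 ^+ n) p q| * A * (K + W `^ Num.max (p / q - 1) 0) * E))%:E.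
Proof.
move=> K0 hK; pose phi N b (x : cell n N.*2) := (@gU N b x `^ (p / q))%R.
have phi0 N b x : (0 <= phi N b x)%R by exact: powR_ge0.
pose C1 := (((6 ^+ n) `^ q * K2) `^ (p / q))%R.
have C1ge0 : (0 <= C1)%R by exact: powR_ge0.
apply: (@fatou_eventually _ _ _ mu _ (fun N z =>
  C1 * \sum_b step (mesh R N) (origin R N b) (phi N b) z * w z)%R).
- by move=> z; rewrite mule_ge0 ?poweR_ge0 ?lee_fin.
- move=> N; apply: measurable_funM => //; apply: measurable_sum => b.
  by apply: measurable_funM => //; exact: measurable_step.
- by move=> N z; rewrite mulr_ge0 // sumr_ge0 // => b _; rewrite mulr_ge0 // step_ge0.
- move=> N; apply: integral_steps => // b.
  under eq_bigr do rewrite mulrC.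
  exact: (grid_strong (origin R N b) N.*2 (mesh_gt0 R N) n0 p1 q1 A0 W1 bw bs (mF N) (F0 N) mf f0
    (fF N) hA hW (hE N) K0 hK).
move=> z r r0 hr.
have wz : (0 < w z)%R.
  rewrite lt0r w0 andbT; apply/negP => /eqP wz; move: hr; rewrite wz mule0 lte_fin.
  by rewrite ltNge ltW.
pose t := ((r / w z) `^ p^-1)%R.
have rw0 : (0 < r / w z)%R by exact: divr_gt0.
have t0 : (0 < t)%R by rewrite powR_gt0.
have tp : (t `^ p = r / w z)%R by rewrite powRVK ?gt_eqF // ltW.
have ht : t%:E < MX z.
  rewrite ltNge; apply/negP => h; move: hr; rewrite ltNge => /negP; apply.
  have := le_poweR (ltW p0) (MX0 z) h; rewrite poweR_EFin tp.
  by move=> /(lee_wpmul2r (_ : 0 <= (w z)%:E)) -/(_ (ltW wz)); rewrite -EFinM divfK ?gt_eqF.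
have [N0 hN0] := maximal_lq_dyadic q0 t0 msf sf0 integrable_sf ht.
exists N0 => N /hN0/pointwise[b hb].
have {}hb : (t `^ p <= C1 * step (mesh R N) (origin R N b) (phi N b) z)%R.
  have := powR_le (ltW pq0) (powR_ge0 _ _) (ltW hb).
  rewrite -powRrM mulrCA divff ?gt_eqF // mulr1 powRM ?(ltW C10) ?step_ge0 //.
  by rewrite (@step_pow N b (fun u => u `^ (p / q))%R z) // powR0 ?gt_eqF.
rewrite -mulr_suml mulrA -(ler_pdivrMr _ _ wz) -tp.
apply: le_trans hb _; rewrite ler_wpM2l // (bigD1 b) //= lerDl.
by apply: sumr_ge0 => b' _; exact: step_ge0.
Qed.

(** If [t ^ q] lies below the sum over all grids, then [tau ^ q] lies below one
    of its terms; the weak bound at height [tau] is used on each grid. *)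
Lemma borel_weak t : p <> q -> (0 < t)%R ->
  (t `^ p)%:E * \int[mu]_(z in [set z | t%:E < `|MX z|]) (w z)%:E <=
  (transferC (`|weakC (2 ^+ n) p q| * A * W `^ Num.max (p / q - 1) 0 * E))%:E.
Proof.
move=> pq t0; set C := (_ * E)%R.
pose C1 := (((6 ^+ n) `^ q * K2) `^ (p / q))%R.
pose tau := ((t `^ q / ((6 ^+ n) `^ q * K2)) `^ q^-1)%R.
have c0 : (0 < t `^ q / ((6 ^+ n) `^ q * K2))%R by rewrite divr_gt0 ?powR_gt0.
have tau0 : (0 < tau)%R by rewrite powR_gt0.
have tauq : (tau `^ q = t `^ q / ((6 ^+ n) `^ q * K2))%R by rewrite powRVK ?gt_eqF // ltW.
have taup : (t `^ p = C1 * tau `^ p)%R.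
  have e (x : R) : (x `^ p = (x `^ q) `^ (p / q))%R.
    by rewrite -powRrM mulrCA divff ?gt_eqF // mulr1.
  rewrite (e t) (e tau) tauq -powRM ?(ltW C10) ?(ltW c0) //.
  by congr (_ `^ _)%R; rewrite mulrC divfK ?gt_eqF.
pose phi N b (x : cell n N.*2) : R := (tau `^ q < @gU N b x)%R%:R%R.
have phi0 N b x : (0 <= phi N b x)%R by rewrite ler0n.
have tp0 : (0 < t `^ p)%R by rewrite powR_gt0.
have tq0 : (0 < tau `^ p)%R by rewrite powR_gt0.
suff h : \int[mu]_(z in [set z | t%:E < `|MX z|]) (w z)%:E <= (1 * (K2 * (C / tau `^ p)))%:E.
  apply: le_trans (lee_wpmul2l _ h) _; first by rewrite lee_fin ltW.
  rewrite -EFinM lee_fin mul1r /transferC -/C1 taup le_eqVlt; apply/orP; left; apply/eqP.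
  by field; rewrite gt_eqF.
rewrite integral_mkcond; apply: (@fatou_eventually _ _ _ mu _ (fun N z =>
  1 * \sum_b step (mesh R N) (origin R N b) (phi N b) z * w z)%R).
- by move=> z; rewrite patchE; case: ifP => _; rewrite ?lee_fin.
- move=> N; apply: measurable_funM => //; apply: measurable_sum => b.
  by apply: measurable_funM => //; exact: measurable_step.
- by move=> N z; rewrite mulr_ge0 // sumr_ge0 // => b _; rewrite mulr_ge0 // step_ge0.
- move=> N; apply: integral_steps => // b.
  rewrite ler_pdivlMr // mulrC.
  have := grid_weak (origin R N b) N.*2 (mesh_gt0 R N) n0 p1 q1 A0 W1 bw bs (mF N) (F0 N) mf f0
    (fF N) hA hW (hE N) pq tau0.
  rewrite big_mkcond /=; congr (_ * _ <= _)%R; apply: eq_bigr => x _.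
  by rewrite /phi /gU; case: ifP => _; rewrite ?mul1r ?mul0r.
move=> z r r0; rewrite patchE; case: ifPn => [/set_mem/= |_]; last first.
  by rewrite lte_fin ltNge ltW.
rewrite gee0_abs // => ht rw.
have [N0 hN0] := maximal_lq_dyadic q0 t0 msf sf0 integrable_sf ht.
exists N0 => N /hN0/pointwise[b hb]; rewrite mul1r -mulr_suml.
rewrite lte_fin in rw; apply: le_trans (ltW rw) _.
rewrite -[leLHS]mul1r ler_wpM2r // (bigD1 b) //=.
have hs : (1 = step (mesh R N) (origin R N b) (phi N b) z)%R.
  have {}hb : (tau `^ q < step (mesh R N) (origin R N b) (@gU N b) z)%R.
    by rewrite tauq ltr_pdivrMr // mulrC.
  rewrite -(@step_pow N b (fun u => (tau `^ q < u)%R%:R)%R z) ?hb //.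
  by rewrite ltNge powR_ge0.
rewrite -hs lerDl.
by apply: sumr_ge0 => b' _; exact: step_ge0.
Qed.

End Borel_inequalities.

(** * Degenerate weights and functions *)

Section Degenerate.
Context (R : realType) (n : nat).
Local Notation mu := (lebesgue R n).
Implicit Types (u w s : n.-tuple R -> R) (f : nat -> n.-tuple R -> R).
Hypothesis n0 : (0 < n)%N.

Definition null_off (P : n.-tuple R -> Prop) :=
  exists N, [/\ measurable N, mu N = 0 & forall z, ~ N z -> P z].

Definition centered k : set (n.-tuple R) :=
  cbox (fun=> - k.+1%:R)%R (2 * k.+1%:R)%R.

Let l0 k : (0 < 2 * k.+1%:R :> R)%R. Proof. by rewrite mulr_gt0 // ltr0n. Qed.

Lemma measurable_centered k : measurable (centered k).
Proof. exact: measurable_cbox. Qed.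

Lemma centered_mono k l : (k <= l)%N -> centered k `<=` centered l.
Proof.
move=> kl z hz i; have /andP[h1 h2] := hz i.
have : (k.+1%:R <= l.+1%:R :> R)%R by rewrite ler_nat ltnS.
by move=> h; apply/andP; split; lra.
Qed.

Lemma centered_cover z : exists k, centered k z.
Proof.
pose B := (\sum_i `|tnth z i|)%R.
have B0 : (0 <= B)%R by apply: sumr_ge0.
exists (Num.truncn B) => i; have /andP[_ h] := truncn_itv B0.
have : (`|tnth z i| <= B)%R by rewrite /B (bigD1 i) //= lerDl sumr_ge0.
rewrite ler_norml => /andP[h1 h2]; apply/andP; split; lra.
Qed.

Lemma integral0_null (D : set (n.-tuple R)) u : measurable D -> measurable_fun setT u ->
  (forall z, 0 <= u z)%R -> \int[mu]_(z in D) (u z)%:E = 0 ->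
  null_off (fun z => D z -> u z = 0%R).
Proof.
move=> mD mu_ u0 h.
have m_ : measurable_fun D (fun z => (u z)%:E).
  by apply: measurable_funTS; apply/measurable_EFinP.
have : \int[mu]_(z in D) `|(u z)%:E| = 0.
  by rewrite -h; apply: eq_integral => z _; rewrite gee0_abs // lee_fin.
move=> /(ae_eq_integral_abs mu mD m_).1[N [mN N0 hN]].
exists N; split => // z Nz Dz; apply: contrapT => uz; apply: Nz; apply: hN => /= /(_ Dz).
by move=> /eqP; rewrite eqe => /eqP.
Qed.

Lemma null_off_forall (P : nat -> n.-tuple R -> Prop) :
  (forall k, null_off (P k)) -> null_off (fun z => forall k, P k z).
Proof.
move=> /choice[N hN].
have mU : measurable (\bigcup_k N k) by apply: bigcup_measurable => k _; have [] := hN k.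
exists (\bigcup_k N k); split => //.
  apply/eqP; rewrite eq_le measure_ge0 andbT.
  apply: (@le_trans _ _ (\sum_(0 <= k <oo) mu (N k))).
    by apply: measure_sigma_subadditive => // k; have [] := hN k.
  by rewrite eseries0 // => k _ _; have [] := hN k.
by move=> z Nz k; have [_ _] := hN k; apply => h; apply: Nz; exists k.
Qed.

Lemma null_off_imp (P Q : n.-tuple R -> Prop) : (forall z, P z -> Q z) ->
  null_off P -> null_off Q.
Proof. by move=> PQ [N [mN N0 hN]]; exists N; split => // z /hN; exact: PQ. Qed.

Lemma null_of_centered u : borel_weight u ->
  (forall k, \int[mu]_(z in centered k) (u z)%:E = 0) -> null_off (fun z => u z = 0%R).
Proof.
move=> [m_ u0 _] h; apply: (@null_off_imp (fun z => forall k, centered k z -> u z = 0%R)).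
  by move=> z hz; have [k kz] := centered_cover z; exact: hz kz.
by apply: null_off_forall => k; exact: integral0_null (measurable_centered k) m_ u0 (h k).
Qed.

Lemma is_cube_centered k : is_cube (centered k).
Proof. exact: is_cube_cbox. Qed.

Lemma average_pos u k : borel_weight u -> \int[mu]_(z in centered k) (u z)%:E != 0 ->
  exists2 S : R, (0 < S)%R & \int[mu]_(z in centered k) (u z)%:E = S%:E.
Proof.
move=> [m_ u0 fin] h; have E := ge0_fine_integral u0 (fin (fun=> - k.+1%:R) (2 * k.+1%:R))%R.
exists (fine (\int[mu]_(z in centered k) (u z)%:E)); last by rewrite E.
rewrite lt0r fine_integral_ge0 // andbT; apply: contra h => /eqP e.
by apply/eqP; rewrite -[LHS]E e.
Qed.

(** On [Q], the maximal function of [w] restricted to [Q] is at least the average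
    of [w] on [Q]. *)
Lemma Ainfty_ge1 w k : borel_weight w -> \int[mu]_(z in centered k) (w z)%:E != 0 ->
  1 <= Ainfty_constant w.
Proof.
move=> bw h; have [S S0 eS] := average_pos bw h; have [mw w0 _] := bw.
set Q := centered k in eS *.
have mQ : mu Q = ((2 * k.+1%:R) ^+ n)%:E by exact: mu_cbox.
set v := ((2 * k.+1%:R) ^+ n)%R in mQ; have v0 : (0 < v)%R by rewrite exprn_gt0.
apply: (@le_trans _ _ ((\int[mu]_(x in Q) (w x)%:E)^-1 * \int[mu]_(x in Q) maximal (w \_ Q) x)); last first.
  by apply: ereal_sup_ubound; exists Q => //; exact: is_cube_centered.
rewrite eS inver gt_eqF // muleC lee_pdivlMr // mul1e.
have av : average Q (w \_ Q) = (S / v)%:E.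
  rewrite /average mQ inver gt_eqF // EFinM muleC -eS; congr (_ * _).
  by apply: eq_integral => z zQ; rewrite patchE zQ ger0_norm.
apply: (@le_trans _ _ (\int[mu]_(x in Q) cst (S / v)%:E x)).
  rewrite integral_cst; last exact: measurable_centered.
  apply: (@le_trans _ _ ((S / v)%:E * v%:E)); last by rewrite -mQ.
  by rewrite -EFinM divfK // gt_eqF.
apply: ge0_integral_mono => z Qz; first by rewrite lee_fin divr_ge0 // ltW.
rewrite /= -av; apply: ereal_sup_ubound; exists Q => //; split => //.
exact: is_cube_centered.
Qed.

(** A large cube contains a given one of positive w-mass, so its sigma-mass must
    vanish. *)
Lemma Ap_zero p w s k0 : borel_weight w -> borel_weight s -> Ap_constant p w s <= 0 ->
  \int[mu]_(z in centered k0) (w z)%:E != 0 ->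
  forall k, \int[mu]_(z in centered k) (s z)%:E = 0.
Proof.
move=> bw bs hA hw k; have [mw w0 wf] := bw; have [ms s0 sf] := bs.
have ge k1 k2 u : borel_weight u -> (k1 <= k2)%N ->
    \int[mu]_(z in centered k1) (u z)%:E <= \int[mu]_(z in centered k2) (u z)%:E.
  move=> [m_ u0 _] k12; apply: ge0_subset_integral.
  - exact: measurable_centered.
  - exact: measurable_centered.
  - by apply: measurable_funTS; apply/measurable_EFinP.
  - by move=> z _; rewrite lee_fin.
  - exact: centered_mono.
pose m := maxn k0 k; pose Q := centered m.
have avE u : (forall z, 0 <= u z)%R ->
    average Q u = (mu Q)^-1 * \int[mu]_(z in Q) (u z)%:E.
  by move=> u0; congr (_ * _); apply: eq_integral => z _; rewrite ger0_norm.
have mQ : mu Q = ((2 * m.+1%:R) ^+ n)%:E by exact: mu_cbox.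
set v := ((2 * m.+1%:R) ^+ n)%R in mQ; have v0 : (0 < v)%R by rewrite exprn_gt0.
have vi : 0 < (mu Q)^-1 by rewrite mQ inver gt_eqF // lte_fin invr_gt0.
have [S S0 eS] := average_pos bw hw.
have wQ : 0 < average Q w.
  rewrite avE // mule_gt0 //; apply: lt_le_trans (ge k0 m w bw (leq_maxl _ _)).
  by rewrite eS lte_fin.
have : average Q w * average Q s `^ (p - 1) <= 0.
  apply: le_trans hA; apply: ereal_sup_ubound; exists Q => //; exact: is_cube_centered.
have sQ : 0 <= average Q s.
  by rewrite avE // mule_ge0 ?(ltW vi) // integral_ge0 // => z _; rewrite lee_fin.
move=> h; apply/eqP; rewrite eq_le; apply/andP; split; last first.
  by apply: integral_ge0 => z _; rewrite lee_fin.
apply: le_trans (ge k m s bs (leq_maxr _ _)) _.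
rewrite leNgt; apply/negP => sp; move: h; rewrite leNgt => /negP; apply.
rewrite mule_gt0 // poweR_gt0 // avE // mule_gt0 //.
Qed.

Section Vector.
Variables (p q : R) (w s : n.-tuple R -> R) (f : nat -> n.-tuple R -> R).
Hypotheses (p1 : (1 < p)%R) (q1 : (1 < q)%R).
Hypotheses (bw : borel_weight w) (bs : borel_weight s).
Hypotheses (mf : forall j, measurable_fun setT (f j)) (f0 : forall j z, (0 <= f j z)%R).

Let MX := maximal_lq q (fun j x => s x * f j x)%R.
Let p0 : (0 < p)%R. Proof. exact: lt_trans p1. Qed.
Let q0 : (0 < q)%R. Proof. exact: lt_trans q1. Qed.
Let pV0 : (0 <= p^-1)%R. Proof. by rewrite invr_ge0 ltW. Qed.
Let pVn0 : p^-1%R != 0%R. Proof. by rewrite invr_eq0 gt_eqF. Qed.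
Let w0 z : (0 <= w z)%R. Proof. by have [_ ->] := bw. Qed.
Let s0 z : (0 <= s z)%R. Proof. by have [_ ->] := bs. Qed.
Let mw : measurable_fun setT w. Proof. by have [] := bw. Qed.
Let ms : measurable_fun setT s. Proof. by have [] := bs. Qed.

Lemma norms_null_weight : null_off (fun z => w z = 0%R) ->
  Lp_norm p w MX = 0 /\ weak_Lp_norm p w MX = 0.
Proof.
move=> [N [mN N0 hN]].
pose zero : n.-tuple R -> R := cst 0%R; have z0 z : (0 <= zero z)%R by [].
split.
  rewrite (Lp_norm_congr mN N0 p w0 z0 hN (fun z _ => erefl (`|MX z|))) /Lp_norm.
  by under eq_integral do rewrite mule0; rewrite integral0 poweR0r.
rewrite (weak_Lp_norm_congr mN N0 p MX w0 z0 hN) /weak_Lp_norm.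
apply/eqP; rewrite eq_le; apply/andP; split.
  apply: ge_ereal_sup => _ [t _ <-].
  by under eq_integral do rewrite /=; rewrite integral0 poweR0r // mule0.
apply: ereal_sup_ubound; exists 1%R => //=.
by under eq_integral do rewrite /=; rewrite integral0 poweR0r // mule0.
Qed.

Lemma maximal_null : null_off (fun z => forall j, (s z * f j z)%R = 0%R) ->
  MX = cst 0.
Proof.
move=> [N [mN N0 hN]]; apply/funext => z; rewrite /MX /maximal_lq.
have e j : maximal (fun x => s x * f j x)%R z = 0.
  rewrite (@maximal_congr _ _ N mN N0 _ (cst 0%R)); last by move=> x /hN ->.
  apply/eqP; rewrite eq_le maximal_ge0 andbT; apply: ge_ereal_sup => _ [Q _ <-].
  rewrite /average; under eq_integral do rewrite normr0.
  by rewrite integral0 mule0.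
rewrite eseries0 ?poweR0r ?invr_eq0 ?gt_eqF // => j _ _.
by rewrite e poweR0r // gt_eqF.
Qed.

Lemma norms_null_function : null_off (fun z => forall j, (s z * f j z)%R = 0%R) ->
  Lp_norm p w MX = 0 /\ weak_Lp_norm p w MX = 0.
Proof.
move=> /maximal_null ->; split.
  rewrite /Lp_norm; under eq_integral do rewrite /cst abse0 poweR0r ?gt_eqF // mul0e.
  by rewrite integral0 poweR0r.
have e (t : R) : (0 < t)%R -> [set x : n.-tuple R | t%:E < `|cst 0 x| ] = set0.
  by move=> t0; apply/seteqP; split => x //; rewrite /mkset /cst abse0 lte_fin ltNge ltW.
apply/eqP; rewrite eq_le; apply/andP; split.
  by apply: ge_ereal_sup => _ [t t0 <-]; rewrite e // integral_set0 poweR0r // mule0.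
by apply: ereal_sup_ubound; exists 1%R => //=; rewrite e // integral_set0 poweR0r // mule0.
Qed.

Let F J z := ((\sum_(j < J) f j z `^ q) `^ q^-1)%R.
Let I := \int[mu]_z (`|lq_norm q f z| `^ p * (s z)%:E).

Lemma partial_energy J : \int[mu]_z (F J z `^ p * s z)%:E <= I.
Proof.
apply: ge0_integral_mono => z _; first by rewrite lee_fin mulr_ge0 ?powR_ge0.
rewrite EFinM -poweR_EFin lee_wpmul2r ?lee_fin //.
apply: le_poweR; rewrite ?lee_fin ?powR_ge0 ?(ltW p0) // gee0_abs; last exact: poweR_ge0.
rewrite -poweR_EFin /lq_norm; apply: le_poweR.
- by rewrite invr_ge0 ltW.
- by rewrite lee_fin sumr_ge0 // => j _; exact: powR_ge0.
rewrite -sumEFin -(big_mkord xpredT (fun j => (f j z `^ q)%:E)).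
rewrite (eq_bigr (fun j => `|f j z|%:E `^ q)); last first.
  by move=> j _; rewrite poweR_EFin ger0_norm.
by apply: nneseries_lim_ge => j _ _; exact: poweR_ge0.
Qed.

Lemma zero_energy : I <= 0 -> null_off (fun z => forall j, (s z * f j z)%R = 0%R).
Proof.
move=> I0; apply: null_off_forall => j.
have m_ : measurable_fun setT (fun z => (F j.+1 z `^ p * s z)%R).
  apply: measurable_funM => //; apply: (measurableT_comp (measurable_powR _)).
  apply: (measurableT_comp (measurable_powR _)); apply: measurable_sum => i.
  exact: (measurableT_comp (measurable_powR _)).
have u0 z : (0 <= F j.+1 z `^ p * s z)%R by rewrite mulr_ge0 ?powR_ge0.
have e : \int[mu]_z (F j.+1 z `^ p * s z)%:E = 0.
  apply/eqP; rewrite eq_le (le_trans (partial_energy _) I0) /=.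
  by apply: integral_ge0 => z _; rewrite lee_fin.
apply: null_off_imp (integral0_null measurableT m_ u0 e) => z /(_ Logic.I) /eqP.
rewrite mulf_eq0 powR_eq0 => /orP[/andP[/eqP Fz _]|/eqP ->]; last by rewrite mul0r.
suff -> : f j z = 0%R by rewrite mulr0.
have : (f j z `^ q <= F j.+1 z `^ q)%R.
  rewrite /F powRVK ?gt_eqF //; last by apply: sumr_ge0 => i _; exact: powR_ge0.
  by rewrite big_ord_recr /= lerDr sumr_ge0 // => i _; exact: powR_ge0.
rewrite Fz powR0 ?gt_eqF // le_eqVlt ltNge powR_ge0 orbF powR_eq0.
by move=> /andP[/eqP].
Qed.

End Vector.
End Degenerate.

(** * Reduction to Borel weights and assembly *)

Section Reduction.
Context (R : realType) (n : nat).
Local Notation mu := (lebesgue R n).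
Implicit Types (w s : n.-tuple R -> R) (f : nat -> n.-tuple R -> R) (p q : R).

Lemma compact_cbox (a : 'I_n -> R) (l : R) :
  compact [set \row_i tnth x i | x in cbox a l].
Proof.
rewrite (_ : [set _ | _ in _] =
    [set v : 'rV[R]_n | forall i, `[a i, (a i + l)%R]%classic (v ord0 i)]).
  apply: (@rV_compact R n (fun i => `[a i, (a i + l)%R]%classic)).
  by move=> i; exact: segment_compact.
apply/seteqP; split => [v [x hx <-] i|v hv].
  by rewrite mxE; have := hx i; rewrite /= in_itv.
exists [tuple v ord0 i | i < n].
  by move=> i; rewrite tnth_mktuple; have := hv i; rewrite /= in_itv.
by apply/rowP => i; rewrite mxE tnth_mktuple.
Qed.

Lemma borel_weight_representative w w' N : weight w -> measurable N -> mu N = 0 ->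
  measurable_fun setT w' -> (forall z, 0 <= w' z)%R ->
  (forall z, ~ N z -> w z = w' z) -> borel_weight w'.
Proof.
move=> [w0 [_ wloc]] mN N0 mw' w'0 ww'; split => // a l.
have := wloc _ (@compact_cbox a l); congr (_ < _).
apply: (integral_off_null mN N0) => [z _|z _|z _ Nz]; rewrite ?lee_fin //.
by rewrite -ww' // ger0_norm.
Qed.

Lemma borel_reduction p q w s f : weight w -> weight s -> (forall j, lebesgue_measurable (f j)) ->
  exists (w' s' : n.-tuple R -> R) (f' : nat -> n.-tuple R -> R), [/\
    [/\ borel_weight w', borel_weight s', forall j, measurable_fun setT (f' j) &
      forall j z, (0 <= f' j z)%R],
    Ap_constant p w s = Ap_constant p w' s',
    Ainfty_constant w = Ainfty_constant w' /\ Ainfty_constant s = Ainfty_constant s',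
    Lp_norm p s (lq_norm q f) = Lp_norm p s' (lq_norm q f') &
    Lp_norm p w (maximal_lq q (fun j x => (s x * f j x)%R)) =
      Lp_norm p w' (maximal_lq q (fun j x => (s' x * f' j x)%R)) /\
    weak_Lp_norm p w (maximal_lq q (fun j x => (s x * f j x)%R)) =
      weak_Lp_norm p w' (maximal_lq q (fun j x => (s' x * f' j x)%R))].
Proof.
move=> hw hs hf; have [w0 [mw _]] := hw; have [s0 [ms _]] := hs.
have [w' [s' [f' [N [[mw' ms' mf'] [mN N0] [w'0 s'0 f'0] hN]]]]] :=
  common_representatives mw ms hf.
have ww' z : ~ N z -> w z = w' z by move=> /hN[<- _ _]; rewrite ger0_norm.
have ss' z : ~ N z -> s z = s' z by move=> /hN[_ <- _]; rewrite ger0_norm.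
have MXE : maximal_lq q (fun j x => (s x * f j x)%R) = maximal_lq q (fun j x => (s' x * f' j x)%R).
  have mE j : maximal (fun x => s x * f j x)%R = maximal (fun x => s' x * f' j x)%R.
    apply: (maximal_congr mN N0) => x Nx; have [_ _ e] := hN x Nx.
    by rewrite !normrM ss' // e (ger0_norm (f'0 j x)).
  apply/funext => z; apply: (congr1 (fun u : nat -> \bar R => (\sum_(0 <= j <oo) u j) `^ q^-1)).
  by apply/funext => j; rewrite mE.
have lqE z : ~ N z -> `|lq_norm q f z| = `|lq_norm q f' z|.
  move=> Nz; congr (`| _ |).
  apply: (congr1 (fun u : nat -> \bar R => (\sum_(0 <= j <oo) u j) `^ q^-1)).
  by apply/funext => j; have [_ _ ->] := hN z Nz; rewrite (ger0_norm (f'0 j z)).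
have bw := borel_weight_representative hw mN N0 mw' w'0 ww'.
have bs := borel_weight_representative hs mN N0 ms' s'0 ss'.
exists w', s', f'; split.
- by split.
- by apply: (Ap_constant_congr mN N0) => z Nz; rewrite ?ww' ?ss'.
- by split; apply: (Ainfty_constant_congr mN N0).
- exact: (Lp_norm_congr mN N0 p s0 s'0 ss' lqE).
rewrite MXE; split; first exact: (Lp_norm_congr mN N0 p w0 w'0 ww' (fun _ _ => erefl)).
exact: (weak_Lp_norm_congr mN N0 p _ w0 w'0 ww').
Qed.

Lemma Ainfty_ge0 w : (forall z, 0 <= w z)%R -> 0 <= Ainfty_constant w.
Proof.
move=> w0; pose Q : set (n.-tuple R) := centered 0%N.
apply: (@le_trans _ _ ((\int[mu]_(x in Q) (w x)%:E)^-1 * \int[mu]_(x in Q) maximal (w \_ Q) x)).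
  rewrite mule_ge0 ?inve_ge0 ?integral_ge0 // => z _; rewrite ?lee_fin //.
  exact: maximal_ge0.
by apply: ereal_sup_ubound; exists Q => //; exact: is_cube_centered.
Qed.


(** Outside the degenerate cases all factors on the right-hand side are positive,
    so an infinite factor makes it infinite. *)
Lemma trichotomy p q w s f : (0 < n)%N -> (1 < p)%R -> (1 < q)%R ->
  borel_weight w -> borel_weight s ->
  (forall j, measurable_fun setT (f j)) -> (forall j z, 0 <= f j z)%R ->
  (Lp_norm p w (maximal_lq q (fun j x => s x * f j x)%R) = 0 /\
   weak_Lp_norm p w (maximal_lq q (fun j x => s x * f j x)%R) = 0) \/
  [/\ 1 <= Ainfty_constant w, 0 < Ap_constant p w s &
      0 < \int[mu]_z (`|lq_norm q f z| `^ p * (s z)%:E)].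
Proof.
move=> n0 p1 q1 bw bs mf f0.
have [[k hk]|hw] := pselect (exists k, \int[mu]_(z in centered k) (w z)%:E != 0); last first.
  left; apply: norms_null_weight => //; apply: null_of_centered => // k.
  by apply/eqP; apply: contrapT => /negP hk; apply: hw; exists k.
have [hA|hA] := leP (Ap_constant p w s) 0.
  left; apply: norms_null_function => //.
  have := null_of_centered bs (Ap_zero bw bs hA hk).
  by apply: null_off_imp => z -> j; rewrite mul0r.
have [hI|hI] := leP (\int[mu]_z (`|lq_norm q f z| `^ p * (s z)%:E)) 0.
  by left; apply: norms_null_function => //; exact: zero_energy hI.
by right; split => //; exact: Ainfty_ge1 bw hk.
Qed.

Lemma prod_infty (C a b d : \bar R) : 0 < C -> 0 < a -> 0 < b -> 0 < d ->
  [\/ a = +oo, b = +oo | d = +oo] -> C * a * b * d = +oo.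
Proof.
move=> C0 a0 b0 d0 [] ->; rewrite ?gt0_muley ?gt0_mulye // ?mule_gt0 //.
Qed.

Lemma ge0_cases (x : \bar R) : 0 <= x -> x = +oo \/ exists2 r : R, (0 <= r)%R & x = r%:E.
Proof. by case: x => [r| |] // r0; [right; exists r|left]. Qed.

(** When p <= q the exponent vanishes and W = 1 serves, even if the A_infty
    constant is infinite. *)
Lemma Ainfty_factor p q w : (1 < p)%R -> (1 < q)%R -> 1 <= Ainfty_constant w ->
  let e := Num.max (q^-1 - p^-1)%R 0%R in
  Ainfty_constant w `^ e = +oo \/
  exists W : R, [/\ (1 <= W)%R, Ainfty_constant w <= W%:E \/ (p <= q)%R &
    Ainfty_constant w `^ e = (W `^ e)%:E].
Proof.
move=> p1 q1 h e; have p0 : (0 < p)%R by exact: lt_trans p1.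
have q0 : (0 < q)%R by exact: lt_trans q1.
have [pq|qp] := leP p q.
  right; exists 1%R; split => //; first by right.
  suff -> : e = 0%R by rewrite poweRe0 powRr0.
  by apply/max_idPr; rewrite subr_le0 lef_pV2.
case E : (Ainfty_constant w) h => [W| |] // h.
  by right; exists W; split => //; left.
left; rewrite poweRyr // gt_eqF // lt_max subr_gt0 ltf_pV2 ?qp //.
Qed.

Lemma max_exponent p q : (0 < p)%R -> (0 < q)%R ->
  (Num.max (p / q - 1) 0 / p = Num.max (q^-1 - p^-1) 0)%R.
Proof.
move=> p0 q0; rewrite maxr_pMl ?invr_ge0 ?ltW // mul0r; congr Num.max.
by field; rewrite !gt_eqF.
Qed.

Lemma root_prod (C A B E r : R) : (0 <= C)%R -> (0 <= A)%R -> (0 <= B)%R -> (0 <= E)%R ->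
  ((C * A * B * E) `^ r = C `^ r * A `^ r * B `^ r * E `^ r)%R.
Proof. by move=> ? ? ? ?; rewrite !powRM ?mulr_ge0. Qed.

Lemma root_add (x y r : R) : (0 < r)%R -> (r <= 1)%R -> (0 <= x)%R -> (0 <= y)%R ->
  ((x + y) `^ r <= x `^ r + y `^ r)%R.
Proof.
move=> r0 r1 x0 y0.
have := @powR_sum_le R bool [:: true; false] xpredT (fun b => if b then x else y) r r0 r1.
by rewrite !big_cons !big_nil !addr0; apply => -[].
Qed.

(** The constants of the theorem may be taken finite: otherwise the right-hand
    side is infinite. *)
Lemma finite_factors (C r : R) (X a b d : \bar R) : (0 < r)%R ->
  (0 < C)%R -> 0 < a -> 0 < b -> 0 < d ->
  (forall A B D : R, (0 <= A)%R -> (0 <= D)%R -> a = A%:E -> b = B%:E -> d = D%:E ->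
     X <= (C * A `^ r * B * D `^ r)%:E) ->
  X <= C%:E * a `^ r * b * d `^ r.
Proof.
move=> r0 C0 a0 b0 d0 h; have rn : r != 0%R by rewrite gt_eqF.
have ar := poweR_gt0 r a0; have dr := poweR_gt0 r d0.
have oo : [\/ a `^ r = +oo, b = +oo | d `^ r = +oo] -> X <= C%:E * a `^ r * b * d `^ r.
  by move=> H; rewrite prod_infty ?leey ?lte_fin.
case: (ge0_cases (ltW a0)) => [ea|[A A0 ea]].
  by apply: oo; constructor 1; rewrite ea poweRyr.
case: (ge0_cases (ltW b0)) => [eb|[B B0 eb]]; first by apply: oo; constructor 2.
case: (ge0_cases (ltW d0)) => [ed|[D D0 ed]].
  by apply: oo; constructor 3; rewrite ed poweRyr.
by apply: le_trans (h A B D A0 D0 ea eb ed) _; rewrite ea eb ed !poweR_EFin -!EFinM.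
Qed.

Lemma add_root_finite (r B : R) (x y : \bar R) : (0 < r)%R -> 0 <= x -> 0 <= y ->
  x + y `^ r = B%:E ->
  exists x' K : R, [/\ (0 <= K)%R, x = x'%:E, y = K%:E & B = (x' + K `^ r)%R].
Proof.
move=> r0 x0 y0; case: (ge0_cases x0) => [->|[x' _ ->]].
  by rewrite addye // -ltNye (lt_le_trans ltNy0) ?poweR_ge0.
case: (ge0_cases y0) => [->|[K K0 ->]]; first by rewrite poweRyr ?gt_eqF // addey.
by rewrite poweR_EFin -EFinD => -[<-]; exists x', K.
Qed.

Section Borel.
Variables (p q : R).
Hypotheses (n0 : (0 < n)%N) (p1 : (1 < p)%R) (q1 : (1 < q)%R).

Let p0 : (0 < p)%R. Proof. exact: lt_trans p1. Qed.
Let q0 : (0 < q)%R. Proof. exact: lt_trans q1. Qed.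
Let r0 : (0 < p^-1)%R. Proof. by rewrite invr_gt0. Qed.
Let r1 : (p^-1 <= 1)%R. Proof. by rewrite invf_le1 // ltW. Qed.

(** The summand 1 makes the constant positive. *)
Definition strong_constant : R := (1 + transferC n p q `|strongC (2 ^+ n) p q| `^ p^-1)%R.
Definition weak_constant : R := (1 + transferC n p q `|weakC (2 ^+ n) p q| `^ p^-1)%R.

Let transferC_ge0 (C : R) : (0 <= C)%R -> (0 <= transferC n p q C)%R.
Proof. by move=> C0; rewrite /transferC mulr_ge0 ?powR_ge0 // mulr_ge0. Qed.

Let transferCM (C A B E : R) : transferC n p q (C * A * B * E)%R = (transferC n p q C * A * B * E)%R.
Proof. by rewrite /transferC !mulrA. Qed.

Lemma strong_constant_gt0 : (0 < strong_constant)%R.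
Proof. by rewrite ltr_pwDl // powR_ge0. Qed.

Lemma weak_constant_gt0 : (0 < weak_constant)%R.
Proof. by rewrite ltr_pwDl // powR_ge0. Qed.

Variables (w s : n.-tuple R -> R) (f : nat -> n.-tuple R -> R).
Hypotheses (bw : borel_weight w) (bs : borel_weight s).
Hypotheses (mf : forall j, measurable_fun setT (f j)) (f0 : forall j z, (0 <= f j z)%R).

Let MX := maximal_lq q (fun j x => s x * f j x)%R.
Let e := Num.max (q^-1 - p^-1)%R 0%R.
Let I := \int[mu]_z (`|lq_norm q f z| `^ p * (s z)%:E).

Let RHS0 (C : R) (b : \bar R) : (0 < C)%R -> 0 <= b ->
  0 <= C%:E * Ap_constant p w s `^ p^-1 * b * Lp_norm p s (lq_norm q f).
Proof. by move=> C0 b0; rewrite !mule_ge0 ?poweR_ge0 ?lee_fin // ltW. Qed.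

Let factor (W1 : 1 <= Ainfty_constant w) : Ainfty_constant w `^ e = +oo \/
  exists W : R, [/\ (1 <= W)%R, Ainfty_constant w <= W%:E \/ (p <= q)%R &
    Ainfty_constant w `^ e = (W `^ e)%:E].
Proof. exact: Ainfty_factor. Qed.

Let exponent : (Num.max (p / q - 1) 0 / p = e)%R.
Proof. exact: max_exponent. Qed.

Lemma borel_strong_norm : Lp_norm p w MX <=
  strong_constant%:E * Ap_constant p w s `^ p^-1 *
  (Ainfty_constant w `^ e + Ainfty_constant s `^ p^-1) * Lp_norm p s (lq_norm q f).
Proof.
have [_ w0 _] := bw; have [_ s0 _] := bs.
case: (trichotomy n0 p1 q1 bw bs mf f0) => [[-> _]|[W1 A0 I0]].
  by apply: RHS0; [exact: strong_constant_gt0|rewrite adde_ge0 ?poweR_ge0].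
have b0 : 0 < Ainfty_constant w `^ e by rewrite poweR_gt0 // (lt_le_trans _ W1).
apply: (finite_factors r0 strong_constant_gt0 A0 _ I0).
  by rewrite lte_paddr // poweR_ge0.
move=> A B E A0' E0 EA EB EI.
have [x [K [K0 ex EK eB]]] := add_root_finite r0 (ltW b0) (Ainfty_ge0 s0) EB.
case: (factor W1) => [bo|[W [W1' hW eW]]]; first by rewrite bo in ex.
have {}ex : x = (W `^ e)%R by apply/EFin_inj; rewrite -ex -eW.
have hA : Ap_constant p w s <= A%:E by rewrite EA.
have hK : Ainfty_constant s <= K%:E by rewrite EK.
have hE J : \int[mu]_z (((\sum_(j < J) f j z `^ q) `^ q^-1) `^ p * s z)%:E <= E%:E.
  by rewrite -EI; exact: partial_energy.
have := borel_strong n0 p1 q1 A0' W1' bw bs mf f0 hA hW hE K0 hK.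
rewrite transferCM; set D := (K + _)%R => h.
have D0 : (0 <= D)%R by rewrite addr_ge0 ?powR_ge0.
have T0 := transferC_ge0 (normr_ge0 (strongC (2 ^+ n) p q)).
apply: (@le_trans _ _ ((transferC n p q `|strongC (2 ^+ n) p q| * A * D * E) `^ p^-1)%:E).
  rewrite -poweR_EFin; apply: le_poweR; first exact: ltW.
    by apply: integral_ge0 => z _; rewrite mule_ge0 ?poweR_ge0 ?lee_fin.
  apply: le_trans h; rewrite le_eqVlt; apply/orP; left; apply/eqP.
  by apply: eq_integral => z _; rewrite gee0_abs // poweR_ge0.
rewrite lee_fin root_prod // ler_wpM2r ?powR_ge0 //.
apply: ler_pM; rewrite ?mulr_ge0 ?powR_ge0 //.
  by rewrite ler_wpM2r ?powR_ge0 // lerDr.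
apply: le_trans (root_add r0 r1 K0 (powR_ge0 _ _)) _.
by rewrite -powRrM exponent addrC eB ex.
Qed.

Lemma borel_weak_norm : p <> q -> weak_Lp_norm p w MX <=
  weak_constant%:E * Ap_constant p w s `^ p^-1 *
  Ainfty_constant w `^ e * Lp_norm p s (lq_norm q f).
Proof.
have [_ w0 _] := bw; move=> pq.
case: (trichotomy n0 p1 q1 bw bs mf f0) => [[_ ->]|[W1 A0 I0]].
  by apply: RHS0; [exact: weak_constant_gt0|exact: poweR_ge0].
have b0 : 0 < Ainfty_constant w `^ e by rewrite poweR_gt0 // (lt_le_trans _ W1).
apply: (finite_factors r0 weak_constant_gt0 A0 b0 I0) => A B E A0' E0 EA EB EI.
case: (factor W1) => [bo|[W [W1' hW eW]]]; first by rewrite bo in EB.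
have {EB} eB : B = (W `^ e)%R by apply/EFin_inj; rewrite -EB -eW.
have hA : Ap_constant p w s <= A%:E by rewrite EA.
have hE J : \int[mu]_z (((\sum_(j < J) f j z `^ q) `^ q^-1) `^ p * s z)%:E <= E%:E.
  by rewrite -EI; exact: partial_energy.
apply: ge_ereal_sup => _ [t /= t0 <-].
have := borel_weak n0 p1 q1 A0' W1' bw bs mf f0 hA hW hE pq t0.
rewrite transferCM; set D := (W `^ _)%R => h.
have D0 : (0 <= D)%R by exact: powR_ge0.
have T0 := transferC_ge0 (normr_ge0 (weakC (2 ^+ n) p q)).
have tE : t%:E = (t `^ p)%:E `^ p^-1 by rewrite poweR_EFin powRK ?gt_eqF // ltW.
rewrite {1}tE -poweRM; last 2 first.
- by rewrite lee_fin powR_ge0.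
- by apply: integral_ge0 => z _; rewrite lee_fin.
apply: le_trans (le_poweR (ltW r0) _ h) _.
  by rewrite mule_ge0 ?lee_fin ?powR_ge0 // integral_ge0 // => z _; rewrite lee_fin.
rewrite poweR_EFin lee_fin root_prod // ler_wpM2r ?powR_ge0 //.
apply: ler_pM; rewrite ?mulr_ge0 ?powR_ge0 //.
  by rewrite ler_wpM2r ?powR_ge0 // lerDr.
by rewrite eB /D -powRrM exponent.
Qed.

End Borel.
End Reduction.

Theorem theorem2 (R : realType) (n : nat) (p q : R)
    (hn : (0 < n)%N) (hp : (1 < p)%R) (hq : (1 < q)%R) :
  (exists2 C : R, (0 < C)%R &
    forall w sigma : n.-tuple R -> R, weight w -> weight sigma ->
    forall f : nat -> n.-tuple R -> R, (forall j, lebesgue_measurable (f j)) ->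
      Lp_norm p w (maximal_lq q (fun j x => (sigma x * f j x)%R)) <=
      C%:E * Ap_constant p w sigma `^ p^-1 *
      (Ainfty_constant w `^ Num.max (q^-1 - p^-1)%R 0%R +
       Ainfty_constant sigma `^ p^-1) *
      Lp_norm p sigma (lq_norm q f)) /\
  (p <> q ->
   exists2 C : R, (0 < C)%R &
    forall w sigma : n.-tuple R -> R, weight w -> weight sigma ->
    forall f : nat -> n.-tuple R -> R, (forall j, lebesgue_measurable (f j)) ->
      weak_Lp_norm p w (maximal_lq q (fun j x => (sigma x * f j x)%R)) <=
      C%:E * Ap_constant p w sigma `^ p^-1 *
      Ainfty_constant w `^ Num.max (q^-1 - p^-1)%R 0%R *
      Lp_norm p sigma (lq_norm q f)).
Proof.
split => [|pq].
  exists (strong_constant n p q); first exact: strong_constant_gt0.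
  move=> w s hw hs f hf; have [w' [s' [f' [[bw bs mf f0] -> [-> ->] -> [-> _]]]]] :=
    borel_reduction p q hw hs hf.
  exact: borel_strong_norm.
exists (weak_constant n p q); first exact: weak_constant_gt0.
move=> w s hw hs f hf; have [w' [s' [f' [[bw bs mf f0] -> [-> _] -> [_ ->]]]]] :=
    borel_reduction p q hw hs hf.
exact: borel_weak_norm.
Qed.
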